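(* Let $A>0$ and $B>0$ be fixed. There are absolute constants $K_1,K_2$ such that the following holds. Let $y\ge2$, let $q$ be an integer with $\sqrt{y}\le q\le y^{A}$, let $x$ satisfy $e^{(\log x)^{1/10}}<y\le x$, and put $u=\log x/\log y$. Suppose $\log x/((B+1)\log q)\ge K_1$ and let $k$ satisfy $0\le k\le (\log q)/2$ and $k/((A+1)\log(u\log u))\ge K_2$. Then for every primitive Dirichlet character $\chi\in\Xi(k)$, every real $\sigma$ with $\alpha-Bk/\log x\le\sigma\le\alpha$, and every real $t$ with $|t|\le q/2$, $$\left|\frac{L'(\sigma+it,\chi)}{L(\sigma+it,\chi)}\right|\ll\log q,$$ with an implied constant not depending on $x,y,q,k,\chi,\sigma,t$.
   Context: $L(s,\chi)$ is the Dirichlet $L$-function. $\alpha=\alpha(x,y)>0$ is the Hildebrand–Tenenbaum saddle point for counting $y$-smooth numbers up to $x$ (coprime to $q$, as in de la Bretèche–Tenenbaum), i.e. the positive solution of $\sum_{p\le y,\,p\nmid q}\frac{\log p}{p^{\alpha}-1}=\log x$; in the present range it satisfies $\alpha=1-\frac{\log(u\log u)}{\log y}+O(\frac{1}{\log y})$. Let $\chi_0$ denote the principal character mod $q$. For $0\le k\le(\log q)/2$, $\Xi(k)$ is the set of characters $\chi\ne\chi_0$ modulo $q$ such that $L(\sigma+it,\chi)\neq0$ whenever $\sigma>1-\frac{k}{\log q}$ and $|t|\le q$, but $L(\sigma+it,\chi)=0$ for some $\sigma>1-\frac{k+1}{\log q}$, $|t|\le q$. *)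

(* Defs.v *)
From HB Require Import structures.
From mathcomp Require Import all_boot all_order all_algebra.
From mathcomp Require Import complex.
From mathcomp Require Import all_classical all_reals all_analysis.
Set Implicit Arguments.
Unset Strict Implicit.
Unset Printing Implicit Defensive.
Import Order.TTheory GRing.Theory Num.Theory numFieldNormedType.Exports.
Local Open Scope classical_set_scope.
Local Open Scope complex_scope.
Local Open Scope ring_scope.

(* R[i] as a numFieldType, so that it carries the topology of its modulus and
   [derive1] is the complex derivative. *)
Definition Cplx (R : realType) : numFieldType := R[i].

Section Dirichlet.
Variable R : realType.
Local Notation C := (Cplx R).

Definition is_dirichlet_character (q : nat) (chi : nat -> C) : Prop :=
  [/\ forall n, chi (n + q)%N = chi n,
      chi 1%N = 1,
      forall m n, chi (m * n)%N = chi m * chi n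
    & forall n, (chi n != 0) = coprime n q].

Definition principal_character (q : nat) : nat -> C := fun n => (coprime n q)%:R.

Definition is_primitive_character (q : nat) (chi : nat -> C) : Prop :=
  is_dirichlet_character q chi /\
  ~ exists d : nat, exists psi : nat -> C,
      [/\ (d %| q)%N, (d < q)%N, is_dirichlet_character d psi
        & forall n, coprime n q -> chi n = psi n].

(* n ^ (- s) = exp (- s * ln n), for n > 0 *)
Definition nat_cpowN (n : nat) (s : C) : C :=
  (expR (- (complex.Re s * ln n%:R)) * cos (complex.Im s * ln n%:R))
  -i* (expR (- (complex.Re s * ln n%:R)) * sin (complex.Im s * ln n%:R)).

(* L(s, chi) as the analytic continuation of \sum_(n >= 1) chi(n) n^(-s) from
   the half-plane Re s > 1: entire for chi nonprincipal; for chi principal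
   holomorphic on C \ {1}, the value at the pole 1 being unspecified. *)
Definition is_dirichlet_L (q : nat) (chi : nat -> C) (F : C -> C) : Prop :=
  (forall s : C, s != 1 \/ chi <> principal_character q -> derivable F s 1) /\
  (forall s : C, 1 < complex.Re s ->
     series (fun n : nat => chi n.+1 * nat_cpowN n.+1 s) @ \oo --> F s).

Definition dirichlet_L (q : nat) (chi : nat -> C) : C -> C :=
  xget (fun=> 0) [set F | is_dirichlet_L q chi F].

Definition Xi (q : nat) (k : R) : set (nat -> C) :=
  [set chi | [/\ is_dirichlet_character q chi,
     chi <> principal_character q,
     forall sigma t : R, 1 - k / ln q%:R < sigma -> `|t| <= q%:R ->
       dirichlet_L q chi (sigma +i* t) != 0
   & exists sigma t : R, [/\ 1 - (k + 1) / ln q%:R < sigma, `|t| <= q%:R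
       & dirichlet_L q chi (sigma +i* t) = 0]]].

Definition is_saddle_point (q : nat) (x y alpha : R) : Prop :=
  0 < alpha /\
  \sum_(0 <= p < (Num.truncn y).+1 | prime p && ~~ (p %| q)%N)
     ln p%:R / (p%:R `^ alpha - 1) = ln x.

End Dirichlet.

(* Main.v *)
(* Let r = k / log q. The primes p <= y not dividing q carry enough of the sum of
   log p / p to force alpha >= 1 - 32 log (u log u) / log y in the saddle point
   equation, so that for large K1, K2 every admissible sigma satisfies
   sigma >= 1 - r / 8, while L has no zero with Re s > 1 - r, |Im s| <= q.

   On a disc of fixed radius about 2 + it, L is bounded by a power of q, and
   |L(2 + it)| >= 1/4. Dividing out the zeros, whose contributions Re 1/(s - rho)
   are nonnegative to the right of Re s = 1 - r, and applying Harnack's inequality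
   to the logarithm of what remains gives Re L'/L >= - C log q there. At 1 + r + it
   the Dirichlet series of L'/L gives |L'/L| << 1/r << log q, and Harnack's
   inequality for Re L'/L + C log q on a disc of radius 2r about that point
   (Borel-Caratheodory) yields |L'/L| << log q up to Re s = 1 - r / 2. *)

Require Import Defs.
From mathcomp Require Import all_boot all_order all_algebra.
From mathcomp Require Import complex.
From mathcomp Require Import all_classical all_reals all_analysis.
From mathcomp Require Import ring lra zify.
From mathcomp Require cyclic.
Import Order.TTheory GRing.Theory Num.Theory numFieldNormedType.Exports.
Set Implicit Arguments.
Unset Strict Implicit.
Unset Printing Implicit Defensive.
Local Open Scope classical_set_scope.
Local Open Scope complex_scope.
Local Open Scope ring_scope.

(** * Complex derivatives *)

Section ComplexDerivative.
Variable R : realType.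
Local Notation C := (Cplx R).
Local Notation Re := (@complex.Re R).
Local Notation Im := (@complex.Im R).

(** Borel-Caratheodory applied to log L on discs of radius r gives only (log q) / r, and 1 / r may
    be as large as log q. Two scales avoid this loss. At scale 1 only a one-sided bound for Re L'/L
    is sought, and for that side the unknown zeros help. At scale r Harnack's inequality is scale
    invariant, so it costs a constant. The data on L are differentiability on the whole plane and
    the series for Re s > 1. The growth bound left of 1 therefore has to be carried over from the
    partial sums, which obey it for Re s > 0. All function theory starts from pointwise
    differentiability: Goursat's bisection acts on Riemann sums, and log f enters only through ln
    |f|, so that no branch is ever chosen. That y is large comes from K2: K2 (A + 1) <= k <= (log q)
    / 2 <= A (log y) / 2. The condition on y and x gives log q <= (log y)^10, which makes the primes
    p >= y^(1/16) dividing q negligible. *)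

Definition cmod (z : C) : R := Num.sqrt (Re z ^+ 2 + Im z ^+ 2).

(** The norm of [Cplx R] takes its values in [Cplx R]; [cmod] is the same number in [R], where the
    real order and [lra] apply. *)
Lemma normC_cmod (z : C) : `|z| = (cmod z)%:C.
Proof. exact: normc_def. Qed.

Lemma cReD (z w : C) : Re (z + w) = Re z + Re w. Proof. by case: z; case: w. Qed.
Lemma cImD (z w : C) : Im (z + w) = Im z + Im w. Proof. by case: z; case: w. Qed.
Lemma cReN (z : C) : Re (- z) = - Re z. Proof. by case: z. Qed.
Lemma cImN (z : C) : Im (- z) = - Im z. Proof. by case: z. Qed.
Lemma cReM (z w : C) : Re (z * w) = Re z * Re w - Im z * Im w.
Proof. by case: z; case: w. Qed.
Lemma cImM (z w : C) : Im (z * w) = Re z * Im w + Im z * Re w.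
Proof. by case: z; case: w. Qed.

Lemma complexP (z w : C) : Re z = Re w -> Im z = Im w -> z = w.
Proof. by case: z => a b; case: w => c d /= -> ->. Qed.

Definition ofR (x : R) : C := x%:C.

Lemma ofRD x y : ofR (x + y) = ofR x + ofR y. Proof. exact: rmorphD. Qed.
Lemma ofRB x y : ofR (x - y) = ofR x - ofR y. Proof. exact: rmorphB. Qed.
Lemma ofRM x y : ofR (x * y) = ofR x * ofR y. Proof. exact: rmorphM. Qed.
Lemma ofRV x : ofR (x^-1) = (ofR x)^-1. Proof. exact: (fmorphV (real_complex R)). Qed.
Lemma ofR0 : ofR 0 = 0. Proof. by []. Qed.
Lemma ofR1 : ofR 1 = 1. Proof. by []. Qed.
Lemma ofRX x n : ofR (x ^+ n) = ofR x ^+ n. Proof. exact: rmorphXn. Qed.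
Lemma ofR_nat n : ofR n%:R = n%:R. Proof. exact: rmorph_nat. Qed.
Lemma ofR_inj x y : ofR x = ofR y -> x = y. Proof. by case. Qed.
Lemma Re_ofR x : Re (ofR x) = x. Proof. by []. Qed.
Lemma Im_ofR x : Im (ofR x) = 0. Proof. by []. Qed.
Lemma ReZ x (z : C) : Re (ofR x * z) = x * Re z.
Proof. by rewrite cReM /= mul0r subr0. Qed.
Lemma ImZ x (z : C) : Im (ofR x * z) = x * Im z.
Proof. by rewrite cImM /= mul0r addr0. Qed.

Lemma cmodM z w : cmod (z * w) = cmod z * cmod w.
Proof. by apply: ofR_inj; rewrite ofRM /ofR -!normC_cmod normrM. Qed.
Lemma cmodN z : cmod (- z) = cmod z.
Proof. by apply: ofR_inj; rewrite /ofR -!normC_cmod normrN. Qed.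
Lemma cmodB z w : cmod (z - w) = cmod (w - z).
Proof. by rewrite -cmodN opprB. Qed.
Lemma cmodV z : cmod (z^-1) = (cmod z)^-1.
Proof. by apply: ofR_inj; rewrite ofRV /ofR -!normC_cmod normfV. Qed.
Lemma cmod_ge0 z : 0 <= cmod z. Proof. exact: sqrtr_ge0. Qed.
Lemma cmod_ofR x : cmod (ofR x) = `|x|.
Proof. by rewrite /cmod /= expr0n addr0 sqrtr_sqr. Qed.
Lemma cmod0 : cmod 0 = 0. Proof. by rewrite -ofR0 cmod_ofR normr0. Qed.
Lemma cmod1 : cmod 1 = 1. Proof. by rewrite -ofR1 cmod_ofR normr1. Qed.
Lemma cmod_eq0 z : cmod z = 0 -> z = 0.
Proof. by move=> z0; apply/eqP; rewrite -normr_eq0 normC_cmod z0. Qed.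
Lemma cmod_gt0 z : z != 0 -> 0 < cmod z.
Proof.
by move=> z0; rewrite lt_neqAle cmod_ge0 andbT eq_sym; apply: contra_neq z0; exact: cmod_eq0.
Qed.
Lemma cmod_gt0_neq z : 0 < cmod z -> z != 0.
Proof. by apply: contraTneq => ->; rewrite cmod0 ltxx. Qed.

Lemma lecR (x y : R) : (ofR x <= ofR y :> C) = (x <= y).
Proof. by rewrite /ofR lecE /= eqxx. Qed.
Lemma ltcR (x y : R) : (ofR x < ofR y :> C) = (x < y).
Proof. by rewrite /ofR ltcE /= eqxx. Qed.

Lemma le_cmodD z w : cmod (z + w) <= cmod z + cmod w.
Proof. by rewrite -lecR ofRD /ofR -!normC_cmod; exact: ler_normD. Qed.
Lemma le_cmodB z w : cmod (z - w) <= cmod z + cmod w.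
Proof. by rewrite -(cmodN w); exact: le_cmodD. Qed.
Lemma le_Bcmod z w : cmod z - cmod w <= cmod (z + w).
Proof.
rewrite lerBlDr; apply: le_trans (le_cmodB (z + w) w).
by rewrite addrK.
Qed.
Lemma le_cmod_sum n (F : 'I_n -> C) : cmod (\sum_i F i) <= \sum_i cmod (F i).
Proof.
elim/big_ind2: _ => [|z a w b za wb|//]; first by rewrite cmod0.
exact: le_trans (le_cmodD _ _) (lerD za wb).
Qed.
Lemma cmodX z n : cmod (z ^+ n) = cmod z ^+ n.
Proof. by elim: n => [|n IH]; rewrite ?expr0 ?cmod1// !exprS cmodM IH. Qed.
Lemma cmod_div z w : cmod (z / w) = cmod z / cmod w.
Proof. by rewrite cmodM cmodV. Qed.

Lemma sqr_cmod z : cmod z ^+ 2 = Re z ^+ 2 + Im z ^+ 2.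
Proof. by rewrite sqr_sqrtr // addr_ge0 // sqr_ge0. Qed.
Lemma normRe_le z : `|Re z| <= cmod z.
Proof.
by rewrite -(ler_pXn2r (n := 2)) ?nnegrE ?cmod_ge0// sqr_cmod real_normK ?num_real// lerDl sqr_ge0.
Qed.
Lemma normIm_le z : `|Im z| <= cmod z.
Proof.
by rewrite -(ler_pXn2r (n := 2)) ?nnegrE ?cmod_ge0// sqr_cmod real_normK ?num_real// lerDr sqr_ge0.
Qed.
Lemma Re_le z : Re z <= cmod z.
Proof. exact: le_trans (ler_norm _) (normRe_le z). Qed.
Lemma cmod_le_ReIm z : cmod z <= `|Re z| + `|Im z|.
Proof.
have -> : z = ofR (Re z) + 'i * ofR (Im z).
  by apply: complexP; rewrite ?cReD ?cImD ?cReM ?cImM /=; ring.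
apply: le_trans (le_cmodD _ _) _; rewrite cmodM !cmod_ofR.
have -> : cmod 'i = 1 by rewrite /cmod /= expr0n expr1n add0r sqrtr1.
by rewrite mul1r cReD cImD cReM cImM /= !(mul0r, mul1r, mulr0, subr0, addr0, add0r).
Qed.

Definition cconj (z : C) : C := Re z -i* Im z.
Lemma cmod_conj z : cmod (cconj z) = cmod z.
Proof. by rewrite /cmod /= sqrrN. Qed.
Lemma conj_mul z : cconj z * z = ofR (cmod z ^+ 2).
Proof. by rewrite sqr_cmod; apply: complexP; rewrite ?cReM ?cImM /=; ring. Qed.

Lemma conj_unit z : cmod z = 1 -> cconj z = z^-1.
Proof.
move=> z1; have z0 : z != 0 by apply: cmod_gt0_neq; rewrite z1.
by apply: (mulIf z0); rewrite conj_mul z1 expr1n mulVf.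
Qed.

(** Free of quotients and filters: [h = 0] is no exception, both [e] and [r] are real, and error
    bounds can be added and composed directly. *)
Definition is_cder (f : C -> C) (z d : C) : Prop :=
  forall e : R, 0 < e -> exists2 r : R, 0 < r &
    forall h, cmod h < r -> cmod (f (z + h) - f z - d * h) <= e * cmod h.

Definition is_rder (f : R -> R) (x d : R) : Prop :=
  forall e : R, 0 < e -> exists2 r : R, 0 < r &
    forall h, `|h| < r -> `|f (x + h) - f x - d * h| <= e * `|h|.

Lemma is_rderE f x d : is_rder f x d <-> is_derive x 1 f d.
Proof.
split=> [fd|[dfx <-]].
  have H : (fun h : R => h^-1 *: (f (h *: (1 : R) + x) - f x)) @ 0^' --> d.
    apply/cvgrPdist_le => e e0; have [r r0 hr] := fd e e0.
    near=> h.
    have h0 : h != 0 by near: h; exact: nbhs_dnbhs_neq.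
    have /hr : `|h| < r.
      by near: h; apply: dnbhs0_lt.
    rewrite /GRing.scale /= mulr1 (addrC h) => H.
    rewrite distrC -(ler_pM2r (_ : 0 < `|h|)) ?normr_gt0// -normrM.
    by rewrite mulrBl mulrAC mulVf// mul1r.
  by apply: DeriveDef; [apply/cvg_ex; exists d|apply/cvg_lim].
move=> e e0; have : (fun h : R => h^-1 *: (f (h *: (1 : R) + x) - f x)) @ 0^' --> 'D_1 f x := dfx.
move=> /cvgrPdist_le /(_ _ e0).
rewrite /dnbhs => -[r /= r0 hr]; exists r => // h hlt.
have [->|h0] := eqVneq h 0; first by rewrite addr0 mulr0 subrr subr0 !normr0 mulr0.
have /(_ _ h0) := hr h; rewrite /= sub0r normrN => /(_ hlt).
rewrite -/('D_1 f x) /GRing.scale /= mulr1 (addrC h) => H.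
have -> : f (x + h) - f x - 'D_1 f x * h = - ((('D_1 f x) - h^-1 * (f (x + h) - f x)) * h).
  by field.
by rewrite normrN normrM ler_wpM2r.
Unshelve. all: by end_near.
Qed.

Lemma derivable_is_cder (f : C -> C) z : derivable f z 1 -> is_cder f z (derive1 f z).
Proof.
move=> dfx; rewrite derive1E => e e0.
have : (fun h : C => h^-1 *: (f (h *: (1 : C) + z) - f z)) @ 0^' --> 'D_1 f z := dfx.
move=> /cvgrPdist_le /(_ (ofR e)).
rewrite -ofR0 ltcR => /(_ e0).
rewrite /dnbhs => -[r /= r0 hr].
have rE : r = ofR (Re r).
  by move: r0; rewrite ltcE => /andP[/eqP ir _]; apply: complexP.
exists (Re r); first by rewrite -ltcR -rE.
move=> h hlt.
have [->|h0] := eqVneq h 0.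
  by rewrite addr0 mulr0 subrr subr0 cmod0 mulr0.
have /(_ _ h0) := hr h; rewrite /= sub0r normrN normC_cmod rE -/(ofR _) ltcR => /(_ hlt).
rewrite -/('D_1 f z) /GRing.scale /= mulr1 (addrC h) => H.
have -> : f (z + h) - f z - 'D_1 f z * h = - ((('D_1 f z) - h^-1 * (f (z + h) - f z)) * h).
  by field.
rewrite cmodN cmodM ler_wpM2r ?cmod_ge0//.
by rewrite -lecR /ofR -normC_cmod.
Qed.

End ComplexDerivative.

(** * Rules for complex derivatives *)

Section CderRules.
Variable R : realType.
Local Notation C := (Cplx R).
Local Notation Re := (@complex.Re R).
Local Notation Im := (@complex.Im R).
Local Notation ofR := (@ofR R).

Lemma is_cder_is_derive (f : C -> C) (z d : C) : is_cder f z d <-> is_derive z (1 : C) f d.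
Proof.
split=> [fd|[/derivable_is_cder + <-]]; last by rewrite derive1E.
have H : (fun h : C => h^-1 *: (f (h *: (1 : C) + z) - f z)) @ 0^' --> d.
  apply/cvgrPdist_le => e e0.
  move: (e0); rewrite ltcE => /andP[/eqP ie e0'].
  have eE : e = ofR (Re e) by apply: complexP.
  have [r r0 hr] := fd _ e0'.
  exists (ofR r); first by rewrite /= -ofR0 ltcR.
  move=> h /=; rewrite sub0r normrN normC_cmod -/(ofR _) ltcR => hlt h0.
  have := hr h hlt.
  rewrite /GRing.scale /= mulr1 (addrC h) => H.
  rewrite distrC normC_cmod eE -/(ofR _) lecR -(ler_pM2r (cmod_gt0 h0)) -cmodM.
  by rewrite mulrBl mulrAC mulVf// mul1r.
by apply: DeriveDef; [apply/cvg_ex; exists d|apply/cvg_lim].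
Qed.

Lemma is_cder_cst (c z : C) : is_cder (fun=> c) z 0.
Proof. by apply/is_cder_is_derive; exact: is_derive_cst. Qed.

Lemma is_cder_id (z : C) : is_cder (fun x => x) z 1.
Proof. by apply/is_cder_is_derive; exact: is_derive_id. Qed.

Lemma is_cderD (f g : C -> C) (z d d' : C) : is_cder f z d -> is_cder g z d' ->
  is_cder (fun x => f x + g x) z (d + d').
Proof.
by move=> /is_cder_is_derive fd /is_cder_is_derive gd; apply/is_cder_is_derive; exact: is_deriveD.
Qed.

Lemma is_cderB (f g : C -> C) (z d d' : C) : is_cder f z d -> is_cder g z d' ->
  is_cder (fun x => f x - g x) z (d - d').
Proof.
by move=> /is_cder_is_derive fd /is_cder_is_derive gd; apply/is_cder_is_derive; exact: is_deriveB.
Qed.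

Lemma is_cderM (f g : C -> C) (z d d' : C) : is_cder f z d -> is_cder g z d' ->
  is_cder (fun x => f x * g x) z (d * g z + f z * d').
Proof.
move=> /is_cder_is_derive fd /is_cder_is_derive gd; apply/is_cder_is_derive.
have -> : d * g z + f z * d' = f z *: d' + g z *: d.
  by rewrite /GRing.scale /= addrC [g z * d]mulrC.
exact: is_deriveM.
Qed.

Lemma is_cderZ (c : C) (f : C -> C) (z d : C) : is_cder f z d ->
  is_cder (fun x => c * f x) z (c * d).
Proof. by move=> fd; have := is_cderM (is_cder_cst c z) fd; rewrite mul0r add0r. Qed.

Lemma is_cder_sum n (f : 'I_n -> C -> C) (z : C) (d : 'I_n -> C) :
  (forall i, is_cder (f i) z (d i)) -> is_cder (fun x => \sum_i f i x) z (\sum_i d i).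
Proof.
elim: n f d => [|n IH] f d fd.
  rewrite big_ord0 (_ : (fun x => _) = fun=> 0); first exact: is_cder_cst.
  by apply/funext => x; rewrite big_ord0.
rewrite big_ord_recl (_ : (fun x => _) = fun x => f ord0 x + \sum_i f (lift ord0 i) x).
  by apply: is_cderD => //; apply: IH.
by apply/funext => x; rewrite big_ord_recl.
Qed.

Lemma is_cderV (f : C -> C) (z d : C) : f z != 0 -> is_cder f z d ->
  is_cder (fun x => (f x)^-1) z (- d / f z ^+ 2).
Proof.
move=> fz0 /is_cder_is_derive fd; apply/is_cder_is_derive.
have [fz <-] := fd; apply: DeriveDef; first exact: derivableV.
by rewrite deriveV// /GRing.scale /= !mulNr mulrC.
Qed.

Lemma is_cder_lip (f : C -> C) (z d : C) : is_cder f z d ->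
  exists2 r : R, 0 < r & forall h, cmod h < r -> cmod (f (z + h) - f z) <= (cmod d + 1) * cmod h.
Proof.
move=> /(_ 1 ltr01)[r r0 hr]; exists r => // h /hr; rewrite mul1r => H.
have -> : f (z + h) - f z = (f (z + h) - f z - d * h) + d * h by rewrite subrK.
by apply: le_trans (le_cmodD _ _) _; rewrite cmodM mulrDl mul1r addrC lerD2l.
Qed.

Lemma is_cder_comp (f g : C -> C) (z d d' : C) : is_cder g z d' -> is_cder f (g z) d ->
  is_cder (fun x => f (g x)) z (d * d').
Proof.
move=> gd fd e e0.
have [r1 r10 H1] := is_cder_lip gd.
pose D := cmod d' + 1; have D0 : 0 < D by rewrite ltr_pwDr ?cmod_ge0.
pose E := cmod d + 1; have E0 : 0 < E by rewrite ltr_pwDr ?cmod_ge0.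
have e1 : 0 < e / (D * 2) by rewrite divr_gt0 ?mulr_gt0.
have e2 : 0 < e / (E * 2) by rewrite divr_gt0 ?mulr_gt0.
have [r2 r20 H2] := fd _ e1.
have [r3 r30 H3] := gd _ e2.
exists (Num.min r1 (Num.min r3 (r2 / D))).
  by rewrite !lt_min r10 r30 divr_gt0.
move=> h; rewrite !lt_min => /and3P[h1 h3 h2].
have {}H1 := H1 _ h1; have {}H3 := H3 _ h3.
set k := g (z + h) - g z in H1 *.
have kr : cmod k < r2.
  by apply: le_lt_trans H1 _; rewrite mulrC -ltr_pdivlMr.
have gk : g z + k = g (z + h) by rewrite /k addrC subrK.
have := H2 _ kr; rewrite gk => {}H2.
have -> : f (g (z + h)) - f (g z) - d * d' * h =
  (f (g (z + h)) - f (g z) - d * k) + d * (k - d' * h) by ring.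
apply: le_trans (le_cmodD _ _) _; rewrite cmodM.
have -> : e * cmod h = e / (D * 2) * (D * cmod h) + E * (e / (E * 2) * cmod h).
  by field; rewrite !lt0r_neq0.
apply: lerD; first by apply: le_trans H2 _; rewrite ler_wpM2l// ltW.
by apply: ler_pM => //; rewrite ?cmod_ge0// /E lerDl.
Qed.

Lemma is_cder_eq (f : C -> C) (z d d' : C) : is_cder f z d -> d = d' -> is_cder f z d'.
Proof. by move=> + <-. Qed.

Lemma is_cder_near (f g : C -> C) (z d : C) (r : R) : 0 < r ->
  (forall w, cmod (w - z) < r -> f w = g w) -> is_cder f z d -> is_cder g z d.
Proof.
move=> r0 fg fd e e0; have [r' r'0 H] := fd e e0.
exists (Num.min r r') => [|h]; first by rewrite lt_min r0.
rewrite lt_min => /andP[h1 h2]; rewrite -!fg ?subrr ?cmod0//; first exact: H.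
by rewrite addrC addKr.
Qed.

Lemma is_cder_shift (f : C -> C) (a z d : C) : is_cder f (a + z) d -> is_cder (fun x => f (a + x)) z d.
Proof. by move=> fd e /fd[r r0 H]; exists r => // h /H; rewrite addrA. Qed.

(** * The complex exponential and mean value inequalities *)

Definition cexp (z : C) : C := (expR (Re z) * cos (Im z)) +i* (expR (Re z) * sin (Im z)).

Lemma cexpD z w : cexp (z + w) = cexp z * cexp w.
Proof.
by apply: complexP; rewrite ?cReM ?cImM /= cReD cImD expRD ?cosD ?sinD; ring.
Qed.

Lemma cexp0 : cexp 0 = 1.
Proof. by apply: complexP; rewrite /= expR0 ?cos0 ?sin0 mul1r. Qed.

Lemma cmod_cexp z : cmod (cexp z) = expR (Re z).
Proof.
rewrite /cmod /= !exprMn -mulrDr cos2Dsin2 mulr1 sqrtr_sqr ger0_norm//.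
Qed.

Lemma is_cder_cexp z : is_cder cexp z (cexp z).
Proof.
(* By [cexpD] it suffices to differentiate at 0, where the real derivatives of exp, cos and sin are
   combined. *)
suff H e : 0 < e -> exists2 r : R, 0 < r &
    forall h, cmod h < r -> cmod (cexp h - 1 - h) <= e * cmod h.
  move=> e e0; have e1 : 0 < e / cmod (cexp z) by rewrite divr_gt0// cmod_cexp expR_gt0.
  have [r r0 hr] := H _ e1; exists r => // h /hr {}hr.
  rewrite cexpD -{2}[cexp z]mulr1 -!mulrBr cmodM.
  apply: le_trans (ler_wpM2l (cmod_ge0 _) hr) _.
  by rewrite mulrA mulrCA divff ?mulr1// lt0r_neq0// cmod_cexp expR_gt0.
move=> e0; have e8 : 0 < e / 16 by rewrite divr_gt0.
have /is_rderE/(_ _ e8)[r1 r10 H1] := is_derive_expR (0 : R).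
have /is_rderE/(_ _ e8)[r2 r20 H2] := is_derive_cos (0 : R).
have /is_rderE/(_ _ e8)[r3 r30 H3] := is_derive_sin (0 : R).
have /is_rderE/(_ _ ltr01)[r5 r50 H5] := is_derive_expR (0 : R).
(* The five error terms below add up to at most 1 + 3 + 3 + 1 + 1 = 9 times [e / 16 * cmod h]; the
   radii [r5] and 1 give [expR (Re h) <= 3]. *)
exists (Num.min r5 (Num.min 1 (Num.min r1 (Num.min r2 (Num.min r3 (e / 16)))))).
  by rewrite !lt_min ltr01 r10 r20 r30 e8 r50.
move=> h; rewrite !lt_min => /andP[h5 /and5P[h0 h1 h2 h3 h4]].
have hR := normRe_le h; have hI := normIm_le h.
have := H1 (Re h) (le_lt_trans hR h1); rewrite add0r expR0 mul1r => {}H1.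
have := H5 (Re h) (le_lt_trans hR h5); rewrite add0r expR0 !mul1r => {}H5.
have := H2 (Im h) (le_lt_trans hI h2); rewrite add0r cos0 sin0 oppr0 mul0r subr0 => {}H2.
have := H3 (Im h) (le_lt_trans hI h3); rewrite add0r cos0 sin0 mul1r subr0 => {}H3.
have E2 : expR (Re h) <= 3.
  have := ler_norm (expR (Re h) - 1 - Re h); have := ler_norm (Re h); lra.
have E0 := expR_ge0 (Re h).
apply: le_trans (cmod_le_ReIm _) _.
rewrite !cReD !cImD !cReN !cImN /=.
set X := expR (Re h) in H1 E2 E0 *; set c := cos _ in H2 *; set s := sin _ in H3 *.
have -> : X * c - 1 - Re h = (X - 1 - Re h) + X * (c - 1) by ring.
have -> : X * s - 0 - Im h = X * (s - Im h) + (X - 1 - Re h) * Im h + Re h * Im h by ring.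
set m := cmod h in hR hI h0 h1 h2 h3 h4 *.
have m0 : 0 <= m by exact: cmod_ge0.
have A1 : `|X - 1 - Re h| <= e / 16 * m by apply: le_trans H1 _; rewrite ler_wpM2l// ltW.
have A2 : `|X * (c - 1)| <= 3 * (e / 16 * m).
  rewrite normrM (ger0_norm E0); apply: ler_pM => //; apply: le_trans H2 _; by rewrite ler_wpM2l// ltW.
have A3 : `|X * (s - Im h)| <= 3 * (e / 16 * m).
  rewrite normrM (ger0_norm E0); apply: ler_pM => //; apply: le_trans H3 _; by rewrite ler_wpM2l// ltW.
have A4 : `|(X - 1 - Re h) * Im h| <= e / 16 * m.
  rewrite normrM; apply: le_trans (ler_wpM2l (normr_ge0 _) (le_trans hI (ltW h0))) _.
  by rewrite mulr1.
have A5 : `|Re h * Im h| <= e / 16 * m.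
  rewrite normrM mulrC ler_pM//; exact: le_trans hI (ltW h4).
have B1 := ler_normD (X - 1 - Re h) (X * (c - 1)).
have B2 := ler_normD (X * (s - Im h) + (X - 1 - Re h) * Im h) (Re h * Im h).
have B3 := ler_normD (X * (s - Im h)) ((X - 1 - Re h) * Im h).
have -> : e * m = 16 * (e / 16 * m) by field.
move: A1 A2 A3 A4 A5; set t := e / 16 * m => A1 A2 A3 A4 A5.
have t0 : 0 <= t := le_trans (normr_ge0 _) A1.
apply: le_trans (lerD B1 (le_trans B2 (lerD B3 (lexx _)))) _.
apply: le_trans (lerD (lerD A1 A2) (lerD (lerD A3 A4) A5)) _.
lra.
Qed.

Lemma is_cder_Re (f : C -> C) (c z w d : C) : is_cder f z d ->
  is_rder (fun t => Re (c * f (z + ofR t * w))) 0 (Re (c * (d * w))).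
Proof.
move=> fd e e0.
pose W := cmod c * cmod w + 1.
have W0 : 0 < W by rewrite ltr_pwDr ?mulr_ge0 ?cmod_ge0.
have e1 : 0 < e / W by rewrite divr_gt0.
have [r r0 H] := fd _ e1.
pose w1 := cmod w + 1; have w10 : 0 < w1 by rewrite ltr_pwDr ?cmod_ge0.
exists (r / w1); first by rewrite divr_gt0.
move=> h; rewrite ltr_pdivlMr// => hr.
have hw : cmod (ofR h * w) <= `|h| * cmod w by rewrite cmodM cmod_ofR.
have /H {}H : cmod (ofR h * w) < r.
  apply: le_lt_trans hw (le_lt_trans _ hr).
  by rewrite ler_wpM2l// /w1 lerDl.
rewrite add0r ofR0 mul0r addr0.
have -> : Re (c * f (z + ofR h * w)) - Re (c * f z) - Re (c * (d * w)) * h =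
  Re (c * (f (z + ofR h * w) - f z - d * (ofR h * w))).
  rewrite !mulrBr !cReD !cReN; congr (_ - _ - _).
  by rewrite mulrC -ReZ; congr (Re _); ring.
apply: le_trans (normRe_le _) _; rewrite cmodM.
apply: le_trans (ler_wpM2l (cmod_ge0 c) H) _.
rewrite cmodM cmod_ofR.
have -> : cmod c * (e / W * (`|h| * cmod w)) = (e * `|h|) * ((cmod c * cmod w) / W).
  by ring.
rewrite ler_piMr//; first by rewrite mulr_ge0// ltW.
by rewrite ler_pdivrMr// mul1r /W lerDl.
Qed.

Lemma is_rder_shift (f : R -> R) (a x d : R) : is_rder (fun t => f (a + t)) x d <-> is_rder f (a + x) d.
Proof. by split=> fd e /fd[r r0 H]; exists r => // h /H; rewrite addrA. Qed.

Lemma rder_le_increment (f df : R -> R) (K : R) :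
  (forall t, 0 <= t <= 1 -> is_rder f t (df t)) -> (forall t, 0 <= t <= 1 -> df t <= K) ->
  f 1 - f 0 <= K.
Proof.
move=> fd dK.
have [||c c01 ->] := @MVT R f df 0 1 ltr01.
- move=> x; rewrite in_itv /= => /andP[x0 x1]; apply/is_rderE/fd; by rewrite !ltW.
- apply: derivable_within_continuous => x; rewrite in_itv /= => x01.
  by have /is_rderE[] := fd x x01.
rewrite subr0 mulr1; apply: dK; move: c01; rewrite in_itv /= => /andP[c0 c1].
by rewrite !ltW.
Qed.

(** The mean value theorem fails for complex values. It is applied to the real function
    [Re (cconj D * f)] along the segment, [D] being the whole increment: this gives
    [cmod D ^+ 2 <= cmod D * (L * cmod w)]. *)
Lemma cder_lipschitz (f df : C -> C) (z w : C) (L : R) :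
  (forall t : R, 0 <= t <= 1 -> is_cder f (z + ofR t * w) (df (z + ofR t * w))) ->
  (forall t : R, 0 <= t <= 1 -> cmod (df (z + ofR t * w)) <= L) ->
  cmod (f (z + w) - f z) <= L * cmod w.
Proof.
move=> fd dL; set D := f (z + w) - f z.
have [->|D0] := eqVneq D 0.
  rewrite cmod0 mulr_ge0 ?cmod_ge0//.
  by apply: le_trans (cmod_ge0 _) (dL 0 _); rewrite lexx ler01.
pose c := cconj D.
have := @rder_le_increment (fun t => Re (c * f (z + ofR t * w)))
  (fun t => Re (c * (df (z + ofR t * w) * w))) (cmod D * (L * cmod w)).
rewrite ofR1 ofR0 mul1r mul0r addr0 => /(_ _ _)/wrap[].
- move=> t t01; rewrite -[X in is_rder _ X]addr0; apply/is_rder_shift.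
  have := is_cder_Re c w (fd t t01).
  by under eq_fun do rewrite -addrA -mulrDl -ofRD.
- move=> t t01; apply: le_trans (Re_le _) _; rewrite !cmodM cmod_conj.
  by rewrite ler_wpM2l ?cmod_ge0// ler_wpM2r ?cmod_ge0// dL.
rewrite -cReN -cReD -mulrBr -/D conj_mul Re_ofR expr2 ler_pM2l//.
exact: cmod_gt0.
Qed.

End CderRules.

(** * Goursat's theorem on rectangles *)

Section Goursat.
Variable R : realType.
Local Notation C := (Cplx R).
Local Notation Re := (@complex.Re R).
Local Notation Im := (@complex.Im R).
Local Notation ofR := (@ofR R).

(* Opposite sides of the rectangle are sampled at the same offsets, which makes
   [rsum] vanish on affine functions and additive under bisection. *)
Definition hsum (K : C -> C) (n : nat) (x y a : R) : C :=
  \sum_(j < n) K ((x + a * j%:R / n%:R) +i* y) * ofR (a / n%:R).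
Definition vsum (K : C -> C) (n : nat) (x y b : R) : C :=
  \sum_(j < n) K (x +i* (y + b * j%:R / n%:R)) * ofR (b / n%:R).
Definition rsum (K : C -> C) (n : nat) (x y a b : R) : C :=
  hsum K n x y a - hsum K n x (y + b) a + 'i * (vsum K n (x + a) y b - vsum K n x y b).

Lemma hsum_split K n x y a : (0 < n)%N ->
  hsum K (n + n) x y a = hsum K n x y (a / 2) + hsum K n (x + a / 2) y (a / 2).
Proof.
move=> n0; have n0' : n%:R != 0 :> R by rewrite pnatr_eq0 -lt0n.
rewrite /hsum big_split_ord /=; congr (_ + _); apply: eq_bigr => j _;
  congr (K (_ +i* _) * ofR _); rewrite ?natrD; field; by rewrite n0' -mulr2n mulrn_eq0.
Qed.

Lemma vsum_split K n x y b : (0 < n)%N ->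
  vsum K (n + n) x y b = vsum K n x y (b / 2) + vsum K n x (y + b / 2) (b / 2).
Proof.
move=> n0; have n0' : n%:R != 0 :> R by rewrite pnatr_eq0 -lt0n.
rewrite /vsum big_split_ord /=; congr (_ + _); apply: eq_bigr => j _;
  congr (K (_ +i* _) * ofR _); rewrite ?natrD; field; by rewrite n0' -mulr2n mulrn_eq0.
Qed.

Lemma rsum_split K n x y a b : (0 < n)%N ->
  rsum K (n + n) x y a b =
    rsum K n x y (a / 2) (b / 2) + rsum K n (x + a / 2) y (a / 2) (b / 2)
  + rsum K n x (y + b / 2) (a / 2) (b / 2) + rsum K n (x + a / 2) (y + b / 2) (a / 2) (b / 2).
Proof.
move=> n0; rewrite /rsum !hsum_split// !vsum_split//.
have h2 (u v : R) : u + v / 2 + v / 2 = u + v by field.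
rewrite !h2; ring.
Qed.

Lemma rsumB K1 K2 n x y a b :
  rsum (fun z => K1 z - K2 z) n x y a b = rsum K1 n x y a b - rsum K2 n x y a b.
Proof.
have hB u v : hsum (fun z => K1 z - K2 z) n u v a = hsum K1 n u v a - hsum K2 n u v a.
  by rewrite /hsum -sumrB; apply: eq_bigr => j _; rewrite mulrBl.
have vB u v : vsum (fun z => K1 z - K2 z) n u v b = vsum K1 n u v b - vsum K2 n u v b.
  by rewrite /vsum -sumrB; apply: eq_bigr => j _; rewrite mulrBl.
by rewrite /rsum !hB !vB; ring.
Qed.

Lemma rsum_affine (c d : C) n x y a b : (0 < n)%N ->
  rsum (fun z => c + d * z) n x y a b = 0.
Proof.
move=> n0; have n0' : n%:R != 0 :> R by rewrite pnatr_eq0 -lt0n.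
rewrite /rsum /hsum /vsum -!sumrB mulr_sumr -big_split big1//= => j _.
set X := a * j%:R / n%:R; set Y := b * j%:R / n%:R.
have e1 : ((x + X) +i* (y + b) : C) = ((x + X) +i* y) + 'i * ofR b.
  by apply: complexP; rewrite ?cReD ?cImD ?cReM ?cImM /=; ring.
have e2 : ((x + a) +i* (y + Y) : C) = (x +i* (y + Y)) + ofR a.
  by apply: complexP; rewrite ?cReD ?cImD ?cReM ?cImM /=; ring.
by rewrite e1 e2 !ofRM; ring.
Qed.

Lemma rsum_le (K : C -> C) (eta : R) n x y a b : 0 <= a -> 0 <= b ->
  (forall z, x <= Re z <= x + a -> y <= Im z <= y + b -> cmod (K z) <= eta) ->
  cmod (rsum K n x y a b) <= eta * (2 * (a + b)).
Proof.
move=> a0 b0 HK.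
have eta0 : 0 <= eta.
  by apply: le_trans (cmod_ge0 _) (HK (x +i* y) _ _); rewrite /= lexx lerDl.
have [->|n0] := posnP n.
  rewrite /rsum /hsum /vsum !big_ord0 !subrr mulr0 addr0 cmod0.
  by rewrite !mulr_ge0// addr_ge0.
have n0' : n%:R != 0 :> R by rewrite pnatr_eq0 -lt0n.
have jn (j : 'I_n) (c : R) : 0 <= c -> 0 <= c * j%:R / n%:R <= c.
  move=> c0; apply/andP; split; first by rewrite divr_ge0// mulr_ge0.
  by rewrite ler_pdivrMr ?ltr0n// ler_wpM2l// ler_nat ltnW.
have S (c : R) : 0 <= c -> \sum_(j < n) eta * `|c / n%:R| = eta * c.
  move=> c0; rewrite sumr_const card_ord -mulr_natr ger0_norm ?divr_ge0//.
  by field.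
have hb v : y <= v <= y + b -> cmod (hsum K n x v a) <= eta * a.
  move=> hv; apply: le_trans (le_cmod_sum _) _; rewrite -S//; apply: ler_sum => j _.
  rewrite cmodM cmod_ofR ler_wpM2r//; apply: HK => //=.
  by have /andP[j0 j1] := jn j a a0; rewrite lerDl j0 lerD2l.
have vb v : x <= v <= x + a -> cmod (vsum K n v y b) <= eta * b.
  move=> hv; apply: le_trans (le_cmod_sum _) _; rewrite -S//; apply: ler_sum => j _.
  rewrite cmodM cmod_ofR ler_wpM2r//; apply: HK => //=.
  by have /andP[j0 j1] := jn j b b0; rewrite lerDl j0 lerD2l.
have ci : cmod ('i : C) = 1 by rewrite /cmod /= expr0n expr1n add0r sqrtr1.
rewrite /rsum; apply: le_trans (le_cmodD _ _) _; rewrite cmodM ci mul1r.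
have := le_cmodB (hsum K n x y a) (hsum K n x (y + b) a).
have := le_cmodB (vsum K n (x + a) y b) (vsum K n x y b).
have := hb y; have := hb (y + b); have := vb x; have := vb (x + a).
rewrite !lexx !lerDl !a0 !b0 /= => /(_ isT) ? /(_ isT) ? /(_ isT) ? /(_ isT) ?.
by move=> ? ?; lra.
Qed.

(** Subtracting the tangent map at [z0] does not change [rsum]; what remains is at most
    [e * (a + b)] on a rectangle of perimeter [2 * (a + b)]. *)
Lemma rsum_near (K : C -> C) (z0 d : C) (e : R) n x y a b : (0 < n)%N ->
  0 <= a -> 0 <= b -> 0 <= e -> x <= Re z0 <= x + a -> y <= Im z0 <= y + b ->
  (forall h, cmod h <= a + b -> cmod (K (z0 + h) - K z0 - d * h) <= e * cmod h) ->
  cmod (rsum K n x y a b) <= 2 * e * (a + b) ^+ 2.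
Proof.
move=> n0 a0 b0 e0 xz yz HK.
have -> : rsum K n x y a b = rsum (fun z => K z - ((K z0 - d * z0) + d * z)) n x y a b.
  by rewrite rsumB rsum_affine// subr0.
have -> : 2 * e * (a + b) ^+ 2 = (e * (a + b)) * (2 * (a + b)) by ring.
apply: rsum_le => // z xz' yz'.
have zz : cmod (z - z0) <= a + b.
  apply: le_trans (cmod_le_ReIm _) _; rewrite cReD cImD cReN cImN.
  by apply: lerD; rewrite ler_norml; lra.
have := HK _ zz; rewrite (addrC z0) subrK => H.
have -> : K z - (K z0 - d * z0 + d * z) = K z - K z0 - d * (z - z0) by ring.
by apply: le_trans H _; rewrite ler_wpM2l.
Qed.

Lemma nested_point (u l : nat -> R) : (forall k, u k <= u k.+1) ->
  (forall k, u k.+1 + l k.+1 <= u k + l k) -> (forall k, 0 <= l k) ->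
  exists x : R, forall k, u k <= x <= u k + l k.
Proof.
move=> u1 ul l0.
have um k m : u k <= u (k + m)%N.
  by elim: m => [|m IH]; rewrite ?addn0// addnS; apply: le_trans IH (u1 _).
have lm k m : u (k + m)%N + l (k + m)%N <= u k + l k.
  by elim: m => [|m IH]; rewrite ?addn0// addnS; apply: le_trans (ul _) IH.
have ub m k : u m <= u k + l k.
  have := um m k; have := lm k m; have := l0 (k + m)%N; rewrite [(m + k)%N]addnC; lra.
exists (sup (range u)) => k; apply/andP; split.
  by apply: ub_le_sup; [exists (u k + l k) => _ [m _ <-]|exists k].
by apply: ge_sup; [exists (u k); exists k|move=> _ [m _ <-]].
Qed.

(** Bisection as in the classical proof, but on sums with [2 ^ N] nodes per side: [rsum_split] is
    exact, so no limit has to exist beforehand. *)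
Lemma goursat (K : C -> C) (x y a b : R) : 0 < a -> 0 < b ->
  (forall z, x <= Re z <= x + a -> y <= Im z <= y + b -> exists d, is_cder K z d) ->
  forall c : R, 0 < c -> exists N0 : nat, forall N, (N0 <= N)%N ->
    cmod (rsum K (2 ^ N) x y a b) < c.
Proof.
move=> a0 b0 dK c c0; apply: contrapT => nex.
pose sz (s : R) (k : nat) : R := s / 2 ^+ k.
have szS s k : sz s k / 2 = sz s k.+1 by rewrite /sz exprS; field; rewrite expf_neq0.
have sz0 (s : R) k : 0 <= s -> 0 <= sz s k by move=> s0; rewrite divr_ge0// exprn_ge0.
(* The sums over the k-th rectangle exceed their share [c / 4 ^+ k] for arbitrarily large [N]; if
   all four quarters eventually stayed below theirs, so would the whole. *)
pose bad (k : nat) (p : R * R) := forall N0 : nat, exists2 N, (N0 <= N)%N &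
  c / 4 ^+ k <= cmod (rsum K (2 ^ N) p.1 p.2 (sz a k) (sz b k)).
have bad0 : bad 0%N (x, y).
  move=> N0; rewrite /sz !expr0 !divr1; apply: contrapT => H; apply: nex.
  exists N0 => N NN0; rewrite ltNge; apply/negP => cN; apply: H; by exists N.
have badS k p : bad k p -> exists q, [/\ bad k.+1 q,
    p.1 <= q.1 <= p.1 + sz a k.+1 & p.2 <= q.2 <= p.2 + sz b k.+1].
  move=> bk; apply: contrapT => H.
  have good q : p.1 <= q.1 <= p.1 + sz a k.+1 -> p.2 <= q.2 <= p.2 + sz b k.+1 ->
      exists N0 : nat, forall N, (N0 <= N)%N ->
      cmod (rsum K (2 ^ N) q.1 q.2 (sz a k.+1) (sz b k.+1)) < c / 4 ^+ k.+1.
    move=> q1 q2; apply: contrapT => H2; apply: H; exists q; split=> // N0.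
    apply: contrapT => H3; apply: H2; exists N0 => N NN0.
    by rewrite ltNge; apply/negP => cN; apply: H3; exists N.
  have a1 := sz0 a k.+1 (ltW a0); have b1 := sz0 b k.+1 (ltW b0).
  have [N1 H1] := good (p.1, p.2) ltac:(by rewrite /= lexx lerDl) ltac:(by rewrite /= lexx lerDl).
  have [N2 H2] := good (p.1 + sz a k.+1, p.2) ltac:(by rewrite /= lexx lerDl a1) ltac:(by rewrite /= lexx lerDl).
  have [N3 H3] := good (p.1, p.2 + sz b k.+1) ltac:(by rewrite /= lexx lerDl) ltac:(by rewrite /= lexx lerDl b1).
  have [N4 H4] := good (p.1 + sz a k.+1, p.2 + sz b k.+1) ltac:(by rewrite /= lexx lerDl a1) ltac:(by rewrite /= lexx lerDl b1).
  (* The successor leaves one factor 2 in the number of nodes, which the splitting consumes. *)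
  have [N] := bk (maxn (maxn N1 N2) (maxn N3 N4)).+1.
  case: N => // N; rewrite ltnS !geq_max => /andP[/andP[n1 n2] /andP[n3 n4]].
  rewrite expnS mul2n -addnn rsum_split ?expn_gt0// !szS => H5.
  have {}H1 := H1 N n1; have {}H2 := H2 N n2; have {}H3 := H3 N n3; have {}H4 := H4 N n4.
  move: H1 H2 H3 H4 H5; rewrite /=; set r1 := rsum _ _ _ _ _ _; set r2 := rsum _ _ _ _ _ _.
  set r3 := rsum _ _ _ _ _ _; set r4 := rsum _ _ _ _ _ _ => H1 H2 H3 H4.
  have := le_cmodD (r1 + r2 + r3) r4; have := le_cmodD (r1 + r2) r3; have := le_cmodD r1 r2.
  have -> : c / 4 ^+ k = 4 * (c / 4 ^+ k.+1) by rewrite exprS; field; rewrite expf_neq0.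
  by move: H1 H2 H3 H4; lra.
have /choice[P HP] : forall kp : nat * (R * R), exists q, bad kp.1 kp.2 -> [/\ bad kp.1.+1 q,
    kp.2.1 <= q.1 <= kp.2.1 + sz a kp.1.+1 & kp.2.2 <= q.2 <= kp.2.2 + sz b kp.1.+1].
  move=> [k p]; have [bk|nb] := pselect (bad k p); last by exists p.
  by have [q Hq] := badS k p bk; exists q.
pose s := fix s k := if k is k'.+1 then P (k', s k') else (x, y).
have sb k : bad k (s k) by elim: k => //= k IH; have [] := HP (k, s k) IH.
have s1 k : (s k).1 <= (s k.+1).1 <= (s k).1 + sz a k.+1 by have [] := HP (k, s k) (sb k).
have s2 k : (s k).2 <= (s k.+1).2 <= (s k).2 + sz b k.+1 by have [] := HP (k, s k) (sb k).
have [X HX] : exists X, forall k, (s k).1 <= X <= (s k).1 + sz a k.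
  apply: nested_point => k; [by have /andP[] := s1 k| |exact/sz0/ltW].
  by have /andP[_] := s1 k; have := szS a k; lra.
have [Y HY] : exists Y, forall k, (s k).2 <= Y <= (s k).2 + sz b k.
  apply: nested_point => k; [by have /andP[] := s2 k| |exact/sz0/ltW].
  by have /andP[_] := s2 k; have := szS b k; lra.
have [d dd] : exists d, is_cder K (X +i* Y) d.
  by apply: dK; [have := HX 0%N|have := HY 0%N]; rewrite /sz expr0 divr1.
have ab0 : 0 < a + b by rewrite addr_gt0.
(* With this tolerance [rsum_near] bounds the sum over the k-th rectangle by half of
   [c / 4 ^+ k]. *)
have e0 : 0 < c / (4 * (a + b) ^+ 2) by rewrite divr_gt0// mulr_gt0// exprn_gt0.
have [r r0 Hr] := dd _ e0.
pose k := (Num.truncn ((a + b) / r)).+1.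
have kr : sz a k + sz b k < r.
  rewrite /sz -mulrDl ltr_pdivrMr ?exprn_gt0// mulrC -ltr_pdivrMr//.
  apply: lt_trans (truncnS_gt _) _; rewrite -/k -natrX ltr_nat.
  exact: ltn_expl.
have [N _] := sb k 0%N.
apply/negP; rewrite -ltNge.
apply: le_lt_trans (_ : _ <= c / 4 ^+ k / 2) _; last first.
  have : 0 < c / 4 ^+ k by rewrite divr_gt0// exprn_gt0.
  lra.
have -> : c / 4 ^+ k / 2 = 2 * (c / (4 * (a + b) ^+ 2)) * (sz a k + sz b k) ^+ 2.
  rewrite /sz -mulrDl exprMn exprVn -exprM mulnC exprM.
  have -> : (2 : R) ^+ 2 = 4 by rewrite expr2; ring.
  by field; rewrite expf_neq0//= lt0r_neq0.
apply: (@rsum_near K (X +i* Y) d); rewrite ?expn_gt0//; try exact/sz0/ltW; try exact: ltW.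
by move=> h hh; apply: Hr; apply: le_lt_trans hh kr.
Qed.

End Goursat.

(** * Circle averages *)

Section CircleMean.
Variable R : realType.
Local Notation C := (Cplx R).
Local Notation Re := (@complex.Re R).
Local Notation Im := (@complex.Im R).
Local Notation ofR := (@ofR R).

(* The mean over the circle is the limit along an ultrafilter of the means over
   the 2^N-th roots of unity: it is linear and positive on all bounded functions,
   so that no integral is needed. *)
Definition ultra_oo : set_system nat :=
  sval (cid (ultraFilterLemma (eventually_filter))).

Lemma ultra_ooP : UltraFilter ultra_oo /\ \oo `<=` ultra_oo.
Proof. exact: svalP (cid (ultraFilterLemma (eventually_filter))). Qed.

Instance ultra_oo_proper : ProperFilter ultra_oo.
Proof. by have [U _] := ultra_ooP; exact: ultra_proper. Qed.

Definition ulim (u : nat -> R) : R := lim (u @ ultra_oo).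

(** Compactness of the segment provides a cluster point, and an ultrafilter converges to its cluster
    points. *)
Lemma bounded_cvg_ultra (u : nat -> R) (B : R) : (forall n, `|u n| <= B) ->
  u @ ultra_oo --> ulim u.
Proof.
move=> uB; have [U _] := ultra_ooP.
suff [p up] : exists p : R, u @ ultra_oo --> p.
  by rewrite /ulim (cvg_lim _ up).
have H : (u @ ultra_oo) `[- B, B]%classic.
  by apply: (@filterE _ ultra_oo) => n /=; rewrite in_itv /= -ler_norml.
have [p [_ clp]] := @segment_compact R (- B) B (u @ ultra_oo) _ H.
exists p => V Vp; rewrite /fmap /=.
have [//|nV] := in_ultra_setVsetC (u @^-1` V) U.
have [x [] //] := clp (~` V) V nV Vp.
Qed.

Lemma ulimD u v (B B' : R) : (forall n, `|u n| <= B) -> (forall n, `|v n| <= B') ->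
  ulim (fun n => u n + v n) = ulim u + ulim v.
Proof.
move=> uB vB; apply: cvg_lim => //.
by apply: cvgD; [apply: bounded_cvg_ultra uB|apply: bounded_cvg_ultra vB].
Qed.

Lemma ulimZ c u (B : R) : (forall n, `|u n| <= B) -> ulim (fun n => c * u n) = c * ulim u.
Proof.
move=> uB; apply: cvg_lim => //.
by apply: cvgM; [exact: cvg_cst|apply: bounded_cvg_ultra uB].
Qed.

Lemma ulim_le u v (B B' : R) : (forall n, `|u n| <= B) -> (forall n, `|v n| <= B') ->
  (forall n, u n <= v n) -> ulim u <= ulim v.
Proof.
move=> uB vB uv; rewrite -subr_ge0.
have -> : ulim v - ulim u = ulim (fun n => v n + (-1) * u n).
  rewrite (ulimD vB (B' := B)) ?(ulimZ _ uB) ?mulN1r// => n.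
  by rewrite mulN1r normrN.
apply: (@cvgr_to_ge _ ultra_oo _ R (fun n => v n + (-1) * u n)).
  apply: (@bounded_cvg_ultra _ (B' + B)) => n; rewrite mulN1r.
  exact: le_trans (ler_normB _ _) (lerD (vB n) (uB n)).
by apply: filterE => n; rewrite mulN1r subr_ge0.
Qed.

Lemma ulim_cst c : ulim (fun=> c) = c.
Proof. by apply: cvg_lim => //; exact: cvg_cst. Qed.

Lemma ulim0 u : (forall e, 0 < e -> exists N0, forall N, (N0 <= N)%N -> `|u N| <= e) -> ulim u = 0.
Proof.
move=> H; apply: cvg_lim => //; have [_ oU] := ultra_ooP.
apply/cvgrPdist_le => e /H[N0 HN]; apply: oU; exists N0 => // n /= /HN.
by rewrite sub0r normrN.
Qed.

Definition cis (t : R) : C := cexp (0 +i* t).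

Lemma cmod_cis t : cmod (cis t) = 1.
Proof. by rewrite cmod_cexp /= expR0. Qed.

Definition root_angle (N j : nat) : R := 2 * pi * j%:R / (2 ^ N)%:R.

Definition root_mean (g : C -> C) (N : nat) : C :=
  ofR ((2 ^ N)%:R^-1) * \sum_(j < 2 ^ N) g (cis (root_angle N j)).

Definition circ (g : C -> C) : C :=
  ulim (fun N => Re (root_mean g N)) +i* ulim (fun N => Im (root_mean g N)).

(** Stated through the angle, because boundedness will come from the extreme value theorem on
    [[0, 2 * pi]], which contains every [root_angle]. *)
Definition cbounded (g : C -> C) :=
  exists B : R, forall t, 0 <= t <= 2 * pi -> cmod (g (cis t)) <= B.

Lemma root_angle_itv N (j : 'I_(2 ^ N)) : 0 <= root_angle N j <= 2 * pi.
Proof.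
have p0 : 0 <= 2 * pi :> R by rewrite mulr_ge0// pi_ge0.
have n0 : 0 < (2 ^ N)%:R :> R by rewrite ltr0n expn_gt0.
apply/andP; split; first by rewrite divr_ge0// mulr_ge0.
by rewrite ler_pdivrMr// ler_wpM2l// ler_nat ltnW.
Qed.

Lemma root_mean_le g (B : R) N : (forall t, 0 <= t <= 2 * pi -> cmod (g (cis t)) <= B) ->
  cmod (root_mean g N) <= B.
Proof.
move=> gB; rewrite cmodM cmod_ofR ger0_norm ?invr_ge0//.
have n0 : 0 < (2 ^ N)%:R :> R by rewrite ltr0n expn_gt0.
rewrite mulrC ler_pdivrMr//; apply: le_trans (le_cmod_sum _) _.
apply: (@le_trans _ _ (\sum_(j < 2 ^ N) B)); last by rewrite sumr_const card_ord mulr_natr.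
by apply: ler_sum => j _; apply: gB; exact: root_angle_itv.
Qed.

Lemma Re_root_mean_le g (B : R) N : (forall t, 0 <= t <= 2 * pi -> cmod (g (cis t)) <= B) ->
  `|Re (root_mean g N)| <= B.
Proof. by move=> gB; apply: le_trans (normRe_le _) (root_mean_le _ gB). Qed.

Lemma Im_root_mean_le g (B : R) N : (forall t, 0 <= t <= 2 * pi -> cmod (g (cis t)) <= B) ->
  `|Im (root_mean g N)| <= B.
Proof. by move=> gB; apply: le_trans (normIm_le _) (root_mean_le _ gB). Qed.

Lemma root_meanD f g N : root_mean (fun w => f w + g w) N = root_mean f N + root_mean g N.
Proof. by rewrite /root_mean -mulrDr -big_split. Qed.

Lemma root_meanZ c g N : root_mean (fun w => c * g w) N = c * root_mean g N.
Proof. by rewrite /root_mean -mulr_sumr mulrCA. Qed.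

Lemma circD f g : cbounded f -> cbounded g ->
  circ (fun w => f w + g w) = circ f + circ g.
Proof.
move=> [B fB] [B' gB]; apply: complexP; rewrite ?cReD ?cImD /=.
  rewrite -(ulimD (B := B) (B' := B')) => [|n|n]; try exact: Re_root_mean_le.
  by congr ulim; apply/funext => N; rewrite root_meanD cReD.
rewrite -(ulimD (B := B) (B' := B')) => [|n|n]; try exact: Im_root_mean_le.
by congr ulim; apply/funext => N; rewrite root_meanD cImD.
Qed.

Lemma circZ c g : cbounded g -> circ (fun w => c * g w) = c * circ g.
Proof.
move=> [B gB]; have rB n := Re_root_mean_le n gB; have iB n := Im_root_mean_le n gB.
have rC := bounded_cvg_ultra rB; have iC := bounded_cvg_ultra iB.
apply: complexP; rewrite ?cReM ?cImM; apply: cvg_lim => //.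
  rewrite (_ : (fun N => _) = (fun N => Re c * Re (root_mean g N) - Im c * Im (root_mean g N))).
    exact: cvgB (cvgM (cvg_cst (Re c)) rC) (cvgM (cvg_cst (Im c)) iC).
  by apply/funext => N; rewrite root_meanZ cReM.
rewrite (_ : (fun N => _) = (fun N => Re c * Im (root_mean g N) + Im c * Re (root_mean g N))).
  exact: cvgD (cvgM (cvg_cst (Re c)) iC) (cvgM (cvg_cst (Im c)) rC).
by apply/funext => N; rewrite root_meanZ cImM.
Qed.

Lemma circ_conj g : cbounded g -> circ (fun w => cconj (g w)) = cconj (circ g).
Proof.
move=> [B gB]; have iB n := Im_root_mean_le n gB.
have E N : root_mean (fun w => cconj (g w)) N = cconj (root_mean g N).
  have J : cconj (\sum_(j < 2 ^ N) g (cis (root_angle N j))) =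
      \sum_(j < 2 ^ N) cconj (g (cis (root_angle N j))).
    apply: (big_morph (@cconj R)) => [x y|]; last by apply: complexP; rewrite /= ?oppr0.
    by apply: complexP; rewrite /= ?cReD ?cImD//= ?cReD ?cImD ?opprD.
  rewrite /root_mean -J; apply: complexP; rewrite ?ReZ ?ImZ /cconj;
  by cbn [complex.Re complex.Im]; rewrite ?ReZ ?ImZ ?mulrN.
apply: complexP; rewrite /=.
  by congr ulim; apply/funext => N; rewrite E.
rewrite -mulN1r -(ulimZ _ iB); congr ulim; apply/funext => N.
by rewrite E mulN1r.
Qed.

Lemma circ_ext f g : (forall t, 0 <= t <= 2 * pi -> f (cis t) = g (cis t)) -> circ f = circ g.
Proof.
move=> fg; have E : root_mean f = root_mean g; last by rewrite /circ E.
apply/funext => N; rewrite /root_mean; congr (_ * _); apply: eq_bigr => j _.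
by apply: fg; exact: root_angle_itv.
Qed.

Lemma cboundedD f g : cbounded f -> cbounded g -> cbounded (fun w => f w + g w).
Proof.
move=> [B fB] [B' gB]; exists (B + B') => t t0.
exact: le_trans (le_cmodD _ _) (lerD (fB t t0) (gB t t0)).
Qed.

Lemma cboundedM f g : cbounded f -> cbounded g -> cbounded (fun w => f w * g w).
Proof.
move=> [B fB] [B' gB]; exists (B * B') => t t0; rewrite cmodM.
by apply: ler_pM; rewrite ?cmod_ge0 ?fB ?gB.
Qed.

Lemma cbounded_cst c : cbounded (fun=> c).
Proof. by exists (cmod c). Qed.

Lemma cbounded_conj g : cbounded g -> cbounded (fun w => cconj (g w)).
Proof. by move=> [B gB]; exists B => t t0; rewrite cmod_conj gB. Qed.

Lemma cboundedX n : cbounded (fun w => w ^+ n).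
Proof. by exists 1 => t _; rewrite cmodX cmod_cis expr1n. Qed.

Lemma cboundedV : cbounded (fun w => w^-1).
Proof. by exists 1 => t _; rewrite cmodV cmod_cis invr1. Qed.

Lemma circ_cst c : circ (fun=> c) = c.
Proof.
have E N : root_mean (fun=> c) N = c.
  rewrite /root_mean sumr_const card_ord -[c *+ _]mulr_natr -(ofR_nat _ (2 ^ N)) mulrC -mulrA -ofRM divff.
    by rewrite mulr1.
  by rewrite pnatr_eq0 expn_eq0.
apply: complexP; rewrite /= -[RHS]ulim_cst; congr ulim; apply/funext => N; by rewrite E.
Qed.

Lemma circB f g : cbounded f -> cbounded g ->
  circ (fun w => f w - g w) = circ f - circ g.
Proof.
move=> fB gB; rewrite -mulN1r -circZ// -circD//; last first.
  by apply: cboundedM => //; exact: cbounded_cst.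
by apply: circ_ext => t _; rewrite mulN1r.
Qed.

Lemma Re_circ_le f g : cbounded f -> cbounded g ->
  (forall w, cmod w = 1 -> Re (f w) <= Re (g w)) -> Re (circ f) <= Re (circ g).
Proof.
move=> [B fB] [B' gB] fg; apply: (ulim_le (B := B) (B' := B')) => [n|n|N]; try exact: Re_root_mean_le.
rewrite /root_mean !ReZ ler_wpM2l ?invr_ge0//.
have ReS (h : C -> C) : Re (\sum_(j < 2 ^ N) h (cis (root_angle N j))) =
    \sum_(j < 2 ^ N) Re (h (cis (root_angle N j))).
  by apply: (big_morph Re) => // x y; rewrite cReD.
by rewrite !ReS; apply: ler_sum => j _; apply: fg; exact: cmod_cis.
Qed.

(** Positivity is available only for real parts: multiply [g] by the conjugate of its mean [D], so
    that [cmod D ^+ 2] becomes the mean of [Re (cconj D * g)]. *)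
Lemma circ_dominated g (v : C -> R) : cbounded g -> cbounded (fun w => ofR (v w)) ->
  (forall w, cmod w = 1 -> cmod (g w) <= v w) -> cmod (circ g) <= Re (circ (fun w => ofR (v w))).
Proof.
move=> gb vb gv; set D := circ g.
have [->|D0] := eqVneq D 0.
  rewrite cmod0 -[X in X <= _](_ : Re (circ (fun=> 0)) = 0); last by rewrite circ_cst.
  apply: Re_circ_le => //; first exact: cbounded_cst.
  by move=> w w1; rewrite Re_ofR (le_trans (cmod_ge0 _) (gv w w1)).
have Dp := cmod_gt0 D0.
rewrite -(ler_pM2l Dp) -expr2 -[X in X <= _]Re_ofR -conj_mul {2}/D -circZ//.
rewrite -ReZ -circZ//; apply: Re_circ_le; try by apply: cboundedM => //; exact: cbounded_cst.
move=> w w1; rewrite ReZ Re_ofR; apply: le_trans (Re_le _) _.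
by rewrite cmodM cmod_conj ler_wpM2l ?gv// ltW.
Qed.

Lemma circ_le g (B : R) : cbounded g -> (forall w, cmod w = 1 -> cmod (g w) <= B) ->
  cmod (circ g) <= B.
Proof.
move=> gb gB; have := circ_dominated (v := fun=> B) gb (cbounded_cst _) gB.
by rewrite circ_cst.
Qed.

Lemma rder_bounded (f df : R -> R) (a b : R) : a <= b ->
  (forall t, a <= t <= b -> is_rder f t (df t)) -> exists B : R, forall t, a <= t <= b -> `|f t| <= B.
Proof.
move=> ab fd.
have fc : {within `[a, b], continuous f}.
  apply: derivable_within_continuous => x; rewrite in_itv /= => xab.
  by have /is_rderE[] := fd x xab.
have [c1 _ H1] := EVT_max ab fc; have [c2 _ H2] := EVT_min ab fc.
exists (`|f c1| + `|f c2|) => t tab.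
have tab' : t \in `[a, b] by rewrite in_itv.
have := H1 _ tab'; have := H2 _ tab'; have := ler_norm (f c1); have := ler_norm (- f c2).
rewrite normrN ler_norml; have := normr_ge0 (f c1); have := normr_ge0 (f c2).
by move=> *; apply/andP; split; lra.
Qed.

(** The real and imaginary parts of [f] along the circle are differentiable in the angle, hence
    bounded on a period; the multipliers 1 and [- 'i] select them. *)
Lemma cder_cbounded (f : C -> C) (c : C) (r : R) :
  (forall t, exists d, is_cder f (c + ofR r * cis t) d) -> cbounded (fun w => f (c + ofR r * w)).
Proof.
move=> fd.
have Hd t : exists d, is_cder (fun z => f (c + ofR r * cexp z)) (0 +i* t) d.
  have [d dd] := fd t; eexists.
  apply: (is_cder_comp (g := fun z => c + ofR r * cexp z)); last exact: dd.
  by apply: is_cderD; [exact: is_cder_cst|apply: is_cderZ; exact: is_cder_cexp].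
have /choice[D HD] := Hd.
have p0 : 0 <= 2 * pi :> R by rewrite mulr_ge0// pi_ge0.
have H (k : C) : exists B : R, forall t, 0 <= t <= 2 * pi ->
    `|Re (k * f (c + ofR r * cis t))| <= B.
  apply: (rder_bounded (df := fun t => Re (k * (D t * 'i)))) => // t _.
  have := is_cder_Re k 'i (HD t).
  rewrite -[X in _ -> is_rder _ X _]addr0 -is_rder_shift.
  suff -> : (fun s => Re (k * f (c + ofR r * cexp ((0 +i* t) + ofR s * 'i)))) =
    (fun s => Re (k * f (c + ofR r * cis (t + s)))) by [].
  apply/funext => s; congr (Re (_ * f (_ + _ * cexp _))).
  by apply: complexP; rewrite ?cReD ?cImD ?cReM ?cImM /=; ring.
have [B1 H1] := H 1; have [B2 H2] := H (- 'i).
exists (B1 + B2) => t t0; apply: le_trans (cmod_le_ReIm _) _.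
have := H1 t t0; have := H2 t t0; rewrite mul1r cReM /= => h2 h1; apply: lerD => //.
by move: h2; rewrite oppr0 mul0r sub0r mulN1r opprK.
Qed.

(* Goursat's theorem for [f (c + exp z)] on the rectangle of vertical side [2 * pi]:
   its horizontal sides cancel by periodicity. *)
Lemma circ_radius (f : C -> C) (c : C) (r1 r2 : R) : 0 < r1 -> r1 < r2 ->
  (forall z, r1 <= cmod (z - c) <= r2 -> exists d, is_cder f z d) ->
  circ (fun w => f (c + ofR r1 * w)) = circ (fun w => f (c + ofR r2 * w)).
Proof.
move=> r10 r12 fd; have r20 := lt_trans r10 r12.
have p0 : 0 < 2 * pi :> R by rewrite mulr_gt0// pi_gt0.
have fb (r : R) : r1 <= r <= r2 -> cbounded (fun w => f (c + ofR r * w)).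
  move=> rr; apply: cder_cbounded => t; apply: fd.
  rewrite addrC addKr cmodM cmod_ofR cmod_cis mulr1 ger0_norm//.
  by have /andP[h _] := rr; exact: le_trans (ltW r10) h.
pose K z := f (c + cexp z).
have cexp_ln (r t : R) : 0 < r -> cexp (ln r +i* t) = ofR r * cis t.
  move=> r0; have -> : (ln r +i* t : C) = ofR (ln r) + (0 +i* t).
    by apply: complexP; rewrite /= ?addr0 ?add0r.
  rewrite cexpD; congr (_ * _); apply: complexP; rewrite /= ?cos0 ?sin0 ?mulr1 ?mulr0//.
  by rewrite lnK.
have ln12 : 0 < ln r2 - ln r1 by rewrite subr_gt0 ltr_ln.
have G : forall e : R, 0 < e -> exists N0 : nat, forall N, (N0 <= N)%N ->
    cmod (rsum K (2 ^ N) (ln r1) 0 (ln r2 - ln r1) (2 * pi)) < e.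
  apply: goursat => // z; rewrite (addrC (ln r1)) subrK => /andP[z1 z2] _.
  have [d dd] : exists d, is_cder f (c + cexp z) d.
    apply: fd; rewrite addrC addKr cmod_cexp -[r1]lnK// -[r2]lnK// !ler_expR.
    by apply/andP.
  exists (d * (0 + cexp z)); apply: (is_cder_comp (g := fun z => c + cexp z)) => //.
  by apply: is_cderD; [exact: is_cder_cst|exact: is_cder_cexp].
have per (n : nat) : hsum K n (ln r1) (0 + 2 * pi) (ln r2 - ln r1) = hsum K n (ln r1) 0 (ln r2 - ln r1).
  apply: eq_bigr => j _; congr (f (_ + _) * _); rewrite /cexp /= add0r.
  by rewrite mulr_natl cos2pi sin2pi cos0 sin0.
have vE (n N : nat) (r : R) : 0 < r -> n = (2 ^ N)%N ->
    vsum K n (ln r) 0 (2 * pi) = ofR (2 * pi) * root_mean (fun w => f (c + ofR r * w)) N.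
  move=> r0 ->; rewrite /vsum /root_mean mulrA -ofRM mulr_sumr.
  by apply: eq_bigr => j _; rewrite /K cexp_ln// add0r mulrC.
have rE N : cmod (rsum K (2 ^ N) (ln r1) 0 (ln r2 - ln r1) (2 * pi)) =
   2 * pi * cmod (root_mean (fun w => f (c + ofR r2 * w)) N - root_mean (fun w => f (c + ofR r1 * w)) N).
  rewrite /rsum per subrr add0r (addrC (ln r1)) subrK !(vE _ N)// -mulrBr !cmodM cmod_ofR.
  have -> : cmod ('i : C) = 1 by rewrite /cmod /= expr0n expr1n add0r sqrtr1.
  by rewrite mul1r ger0_norm// ltW.
have Z : circ (fun w => f (c + ofR r2 * w) - f (c + ofR r1 * w)) = 0.
  have E N : root_mean (fun w => f (c + ofR r2 * w) - f (c + ofR r1 * w)) N =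
    root_mean (fun w => f (c + ofR r2 * w)) N - root_mean (fun w => f (c + ofR r1 * w)) N.
    by rewrite /root_mean -mulrBr -sumrB.
  have small (e : R) : 0 < e -> exists N0 : nat, forall N, (N0 <= N)%N ->
      cmod (root_mean (fun w => f (c + ofR r2 * w) - f (c + ofR r1 * w)) N) <= e.
    move=> e0; have [|N0 HN] := G (2 * pi * e); last first.
      exists N0 => N /HN; rewrite rE -E ltr_pM2l// => /ltW//.
    by rewrite mulr_gt0.
  apply: complexP; rewrite /=; apply: ulim0 => e /small[N0 HN]; exists N0 => N /HN.
    by apply: le_trans; exact: normRe_le.
  by apply: le_trans; exact: normIm_le.
apply/eqP; rewrite eq_sym -subr_eq0 -circB ?Z//; apply: fb; rewrite lexx ltW//.
Qed.

End CircleMean.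

(** * Holomorphic functions on a disc *)

Section LocalTheory.
Variable R : realType.
Local Notation C := (Cplx R).
Local Notation Re := (@complex.Re R).
Local Notation Im := (@complex.Im R).
Local Notation ofR := (@ofR R).

Definition hol (c : C) (r : R) (f : C -> C) :=
  forall z, cmod (z - c) < r -> exists d, is_cder f z d.

Definition cd (f : C -> C) (z : C) : C := derive1 f z.

Lemma is_cder_cdE f z d : is_cder f z d -> cd f z = d.
Proof. by move=> /is_cder_is_derive[_ <-]; rewrite /cd derive1E. Qed.

Lemma is_cder_cd f z : (exists d, is_cder f z d) -> is_cder f z (cd f z).
Proof. by move=> [d dd]; rewrite (is_cder_cdE dd). Qed.

Lemma addrCK (c x : C) : c + x - c = x.
Proof. by rewrite addrAC subrr add0r. Qed.

Lemma cmod_small (z : C) : (forall e : R, 0 < e -> cmod z <= e) -> z = 0.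
Proof.
move=> H; apply: cmod_eq0; apply/eqP; rewrite eq_le cmod_ge0 andbT leNgt.
apply/negP => z0; have := H _ (divr_gt0 z0 (ltr0n R 2)); lra.
Qed.

Lemma unit_cis (w : C) : cmod w = 1 -> exists2 t : R, 0 <= t <= 2 * pi & w = cis t.
Proof.
move=> w1; have ab : Re w ^+ 2 + Im w ^+ 2 = 1 by rewrite -sqr_cmod w1 expr1n.
have a1 : -1 <= Re w <= 1 by rewrite -ler_norml -w1 normRe_le.
have [t0 tp] := (acos_ge0 a1, acos_lepi a1).
have ct : cos (acos (Re w)) = Re w by rewrite acosK// in_itv.
have st : sin (acos (Re w)) = `|Im w|.
  by rewrite sin_acos// -sqrtr_sqr -ab addrC addKr.
have [i0|i0] := leP 0 (Im w).
  exists (acos (Re w)); first by apply/andP; split=> //; lra.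
  by apply: complexP; rewrite /= expR0 mul1r ?ct ?st ?ger0_norm.
exists (pi *+ 2 - acos (Re w)); first by rewrite -mulr_natl; apply/andP; split; lra.
apply: complexP; rewrite /= expR0 mul1r addrC; first by rewrite cosD2pi cosN ct.
by rewrite sinD2pi sinN st ltr0_norm// opprK.
Qed.

Lemma cbounded_unit (g : C -> C) : cbounded g -> exists B : R, forall w, cmod w = 1 -> cmod (g w) <= B.
Proof. by move=> [B gB]; exists B => w /unit_cis[t t0 ->]; exact: gB. Qed.

(** The mean does not depend on the radius, and on small circles [g] is close to [l]. As [g] need
    not be differentiable at [c], this serves both the mean value property and Cauchy's formula for
    the derivative. *)
Lemma punctured_mean (g : C -> C) (c l : C) (r rho : R) : 0 < rho < r ->
  (forall z, 0 < cmod (z - c) < r -> exists d, is_cder g z d) ->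
  (forall e : R, 0 < e -> exists2 s : R, 0 < s &
     forall h, 0 < cmod h < s -> cmod (g (c + h) - l) <= e) ->
  circ (fun w => g (c + ofR rho * w)) = l.
Proof.
move=> /andP[rho0 rhor] gd gl; apply/eqP; rewrite -subr_eq0; apply/eqP; apply: cmod_small => e e0.
have [s s0 Hs] := gl e e0.
pose r1 := Num.min (rho / 2) (s / 2).
have r10 : 0 < r1 by rewrite lt_min !divr_gt0.
have r1rho : r1 < rho by rewrite gt_min; apply/orP; left; lra.
have r1s : r1 < s by rewrite gt_min; apply/orP; right; lra.
rewrite -(@circ_radius R g c r1 rho)//; last first.
  move=> z /andP[z1 z2]; apply: gd; rewrite (lt_le_trans r10 z1)/=.
  exact: le_lt_trans z2 rhor.
have cw (w : C) : cmod w = 1 -> cmod (ofR r1 * w) = r1.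
  by move=> w1; rewrite cmodM cmod_ofR w1 mulr1 gtr0_norm.
have gb : cbounded (fun w => g (c + ofR r1 * w)).
  apply: cder_cbounded => t; apply: gd; rewrite addrC addKr cw ?cmod_cis// r10.
  exact: lt_trans r1rho rhor.
rewrite -[l]circ_cst -circB//; last exact: cbounded_cst.
apply: circ_le => [|w w1]; last by apply: Hs; rewrite cw// r10.
have [B gB] := gb; exists (B + cmod l) => t t0.
exact: le_trans (le_cmodB _ _) (lerD (gB t t0) (lexx _)).
Qed.

Lemma mean_value (f : C -> C) (c : C) (r rho : R) : 0 < rho < r -> hol c r f ->
  circ (fun w => f (c + ofR rho * w)) = f c.
Proof.
move=> rr hf; apply: (punctured_mean rr) => [z /andP[_ zr]|e e0]; first exact: hf.
have [|d /is_cder_lip[s s0 Hs]] := hf c.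
  by rewrite subrr cmod0; case/andP: rr => /lt_trans; apply.
pose L := cmod d + 1; have L0 : 0 < L by rewrite ltr_pwDr ?cmod_ge0.
exists (Num.min s (e / L)); first by rewrite lt_min s0 divr_gt0.
move=> h; rewrite lt_min => /and3P[_ h1 h2].
by apply: le_trans (Hs h h1) _; rewrite -/L mulrC -ler_pdivlMr// ltW.
Qed.

Lemma hol_sub (c c' : C) (r r' : R) f : cmod (c' - c) + r' <= r -> hol c r f -> hol c' r' f.
Proof.
move=> cr hf z zr; apply: hf; have -> : z - c = (z - c') + (c' - c) by ring.
by apply: le_lt_trans (le_cmodD _ _) _; lra.
Qed.

Lemma hol_cbounded (f : C -> C) (c : C) (r rho : R) : 0 < rho < r -> hol c r f ->
  cbounded (fun w => f (c + ofR rho * w)).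
Proof.
move=> /andP[rho0 rr] hf; apply: cder_cbounded => t; apply: hf.
by rewrite addrC addKr cmodM cmod_ofR cmod_cis mulr1 gtr0_norm.
Qed.

Lemma holM c r f g : hol c r f -> hol c r g -> hol c r (fun z => f z * g z).
Proof.
by move=> hf hg z zr; have [d1 D1] := hf z zr; have [d2 D2] := hg z zr; eexists; exact: is_cderM D1 D2.
Qed.

Lemma holD c r f g : hol c r f -> hol c r g -> hol c r (fun z => f z + g z).
Proof.
by move=> hf hg z zr; have [d1 D1] := hf z zr; have [d2 D2] := hg z zr; eexists; exact: is_cderD D1 D2.
Qed.

Lemma hol_cst c r k : hol c r (fun=> k).
Proof. by move=> z _; exists 0; exact: is_cder_cst. Qed.

Lemma hol_id c r : hol c r id.
Proof. by move=> z _; exists 1; exact: is_cder_id. Qed.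

Lemma holX c r f n : hol c r f -> hol c r (fun z => f z ^+ n).
Proof.
move=> hf; elim: n => [|n IH]; first by under eq_fun do rewrite expr0; exact: hol_cst.
by under eq_fun do rewrite exprS; exact: holM.
Qed.

Lemma holV c r f : hol c r f -> (forall z, cmod (z - c) < r -> f z != 0) ->
  hol c r (fun z => (f z)^-1).
Proof. by move=> hf f0 z zr; have [d D] := hf z zr; eexists; exact: is_cderV (f0 z zr) D. Qed.

Lemma circ_moment (f : C -> C) (c : C) (r rho : R) (k : nat) : 0 < rho < r -> hol c r f ->
  circ (fun w => f (c + ofR rho * w) * w ^+ k.+1) = 0.
Proof.
move=> rr hf; have rho0 : 0 < rho by case/andP: rr.
have hg : hol c r (fun z => f z * (z + - c) ^+ k.+1).
  apply: holM => //; apply: holX; apply: holD; [exact: hol_id|exact: hol_cst].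
have := mean_value rr hg; rewrite subrr expr0n mulr0 => E.
have K0 : ofR (rho ^+ k.+1) != 0.
  by apply: cmod_gt0_neq; rewrite cmod_ofR normr_gt0 expf_neq0// gt_eqF.
apply: (mulfI K0); rewrite mulr0 -E -circZ.
  by apply: circ_ext => t _; rewrite addrCK exprMn ofRX; ring.
by apply: cboundedM; [exact: hol_cbounded rr hf|exact: cboundedX].
Qed.

(** Passing from radius 1 to radius 2 preserves the mean of [z^-1] and also halves it. *)
Lemma circ_inv : circ (fun w : C => w^-1) = 0.
Proof.
have H := @circ_radius R (fun z => z^-1) 0 1 2 ltr01 _ _.
have : circ (fun w : C => w^-1) = ofR 2^-1 * circ (fun w : C => w^-1).
  rewrite -circZ; last exact: cboundedV.
  have -> : circ (fun w : C => w^-1) = circ (fun w => (0 + ofR 1 * w)^-1).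
    by apply: circ_ext => t _; rewrite add0r ofR1 mul1r.
  rewrite H; last 2 first.
  - by lra.
  - move=> z; rewrite subr0 => /andP[z1 _]; eexists; apply: (@is_cderV R id); last exact: is_cder_id.
    by apply: cmod_gt0_neq; apply: lt_le_trans z1.
  by apply: circ_ext => t _; rewrite add0r invfM ofRV.
move=> E; have : (1 - ofR 2^-1) * circ (fun w : C => w^-1) = 0 by rewrite mulrBl mul1r -E subrr.
move/eqP; rewrite mulf_eq0 => /orP[|/eqP//] /eqP.
rewrite -ofR1 -ofRB -ofR0 => /ofR_inj E1; exfalso; move: E1; clear; lra.
Qed.

(** Cauchy's formula: [punctured_mean] for the difference quotient at [c], whose limit there is the
    derivative; the constant [f c] drops out by [circ_inv]. *)
Lemma circ_deriv (f : C -> C) (c : C) (r rho : R) : 0 < rho < r -> hol c r f ->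
  circ (fun w => f (c + ofR rho * w) * w^-1) = ofR rho * cd f c.
Proof.
move=> rr hf; have rho0 : 0 < rho by case/andP: rr.
have r0 : 0 < r by case/andP: rr => /lt_trans; apply.
have fc : is_cder f c (cd f c) by apply/is_cder_cd/hf; rewrite subrr cmod0.
have := @punctured_mean (fun z => (f z - f c) * (z - c)^-1) c (cd f c) r rho rr.
move=> /(_ _ _)/wrap[z /andP[z0 zr]|e e0|E].
- have [d D] := hf z zr; eexists; apply: is_cderM; first exact: is_cderB D (is_cder_cst _ _).
  apply: is_cderV; first exact: cmod_gt0_neq.
  exact: is_cderB (is_cder_id _) (is_cder_cst _ _).
- have [s s0 Hs] := fc e e0; exists s => // h /andP[h0 hs].
  have hn := cmod_gt0_neq h0.
  have -> : (f (c + h) - f c) * (c + h - c)^-1 - cd f c = (f (c + h) - f c - cd f c * h) * h^-1.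
    by rewrite addrAC subrr add0r; field.
  by rewrite cmodM cmodV ler_pdivrMr// Hs.
have fb := hol_cbounded rr hf.
have rn : ofR rho != 0 by apply: cmod_gt0_neq; rewrite cmod_ofR gtr0_norm.
rewrite -E -circZ; last first.
  apply: cboundedM; first by apply: cboundedD fb (cbounded_cst _).
  exists (rho^-1) => t _; by rewrite addrC addKr cmodV cmodM cmod_ofR cmod_cis mulr1 gtr0_norm.
have -> : circ (fun w => ofR rho * ((f (c + ofR rho * w) - f c) * (c + ofR rho * w - c)^-1)) =
    circ (fun w => f (c + ofR rho * w) * w^-1 - f c * w^-1).
  apply: circ_ext => t _.
  have w0 : cis t != 0 by apply: cmod_gt0_neq; rewrite cmod_cis.
  by rewrite [_ - c]addrC addKr; field; rewrite rn w0.
rewrite circB; first by rewrite circZ ?circ_inv ?mulr0 ?subr0//; exact: cboundedV.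
  by apply: cboundedM => //; exact: cboundedV.
by apply: cboundedM; [exact: cbounded_cst|exact: cboundedV].
Qed.

Lemma cauchy_estimate (f : C -> C) (c : C) (r rho M : R) : 0 < rho < r -> hol c r f ->
  (forall z, cmod (z - c) = rho -> cmod (f z) <= M) -> cmod (cd f c) <= M / rho.
Proof.
move=> rr hf fM; have rho0 : 0 < rho by case/andP: rr.
rewrite ler_pdivlMr// mulrC -[X in X * _](gtr0_norm rho0) -cmod_ofR -cmodM -(circ_deriv rr hf).
apply: circ_le => [|w w1].
  by apply: cboundedM; [exact: hol_cbounded rr hf|exact: cboundedV].
rewrite cmodM cmodV w1 invr1 mulr1; apply: fM.
by rewrite addrC addKr cmodM w1 cmod_ofR mulr1 gtr0_norm.
Qed.

(* The mean value property at 0 of [f] composed with the Moebius map of the disc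
   sending 0 to [z]. *)
Lemma max_modulus (f : C -> C) (c : C) (r rho M : R) : 0 < rho < r -> hol c r f ->
  (forall z, cmod (z - c) = rho -> cmod (f z) <= M) ->
  forall z, cmod (z - c) <= rho -> cmod (f z) <= M.
Proof.
move=> /andP[rho0 rr] hf fM z; rewrite le_eqVlt => /orP[/eqP/fM//|zr].
have rn : ofR rho != 0 by apply: cmod_gt0_neq; rewrite cmod_ofR gtr0_norm.
pose a := (z - c) / ofR rho; pose A := cmod a.
have A1 : A < 1 by rewrite /A cmod_div cmod_ofR gtr0_norm// ltr_pdivrMr// mul1r.
have A0 : 0 <= A := cmod_ge0 _.
pose b := (1 + A) / 2; have b1 : 0 < 1 - b by rewrite /b; lra.
pose q := (r / rho) ^+ 2 - 1.
have q0 : 0 < q by rewrite subr_gt0 -(expr1n _ 2) ltrXn2r ?nnegrE ?divr_ge0 ?ltW// ?ltr_pdivlMr ?mul1r// (lt_trans rho0).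
have qb : 0 < q * (1 - b) ^+ 2 by rewrite mulr_gt0// exprn_gt0.
(* The Moebius map must be defined slightly beyond the unit circle: the second bound keeps its
   denominator at least [1 - b], the third keeps its image within radius [r]. *)
pose eta := Num.min 1 (Num.min ((1 - A) / 2) (q * (1 - b) ^+ 2 / 6)).
have eta0 : 0 < eta by rewrite !lt_min ltr01 !divr_gt0// subr_gt0.
have eta1 : eta <= 1 by rewrite ge_min lexx.
have eta2 : eta <= (1 - A) / 2 by rewrite !ge_min lexx !orbT.
have eta3 : eta <= q * (1 - b) ^+ 2 / 6 by rewrite !ge_min lexx !orbT.
pose den w := 1 + cconj a * w.
have denb w : cmod w < 1 + eta -> 1 - b <= cmod (den w).
  move=> w1; apply: le_trans (le_Bcmod _ _); rewrite cmod1 cmodM cmod_conj -/A lerD2l lerN2.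
  have : A * cmod w <= A * (1 + eta) by rewrite ler_wpM2l// ltW.
  have : A * eta <= 1 * eta by exact: (ler_wpM2r (ltW eta0) (ltW A1)).
  by rewrite /b; lra.
have denn w : cmod w < 1 + eta -> den w != 0.
  by move=> /denb h; apply: cmod_gt0_neq; apply: lt_le_trans h.
(* For [cmod w = 1] the last term vanishes, so the map preserves the circle; for slightly larger [w]
   it measures how far the image leaves the disc. *)
have key w : cmod (w + a) ^+ 2 = cmod (den w) ^+ 2 + (1 - A ^+ 2) * (cmod w ^+ 2 - 1).
  rewrite /den /A !sqr_cmod /cconj /= !(cReD, cImD, cReM, cImM) /=; ring.
pose phi w := c + ofR rho * ((w + a) / den w).
have phi_norm w : cmod (phi w - c) = rho * (cmod (w + a) / cmod (den w)).
  by rewrite /phi addrC addKr cmodM cmod_ofR gtr0_norm// cmod_div.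
have phir w : cmod w < 1 + eta -> cmod (phi w - c) < r.
  move=> w1; have D0 := lt_le_trans b1 (denb w w1).
  have rr0 : 0 < r / rho by rewrite divr_gt0// (lt_trans rho0).
  rewrite phi_norm mulrC -ltr_pdivlMr// -(ltr_pXn2r (n := 2)) ?nnegrE ?(ltW rr0)//; last by rewrite divr_ge0 ?cmod_ge0.
  rewrite expr_div_n key ltr_pdivrMr ?exprn_gt0//.
  have -> : (r / rho) ^+ 2 = q + 1 by rewrite /q subrK.
  set D := cmod (den w) in D0 *; set W := cmod w ^+ 2 - 1.
  have W3 : W <= 3 * eta.
    have : cmod w ^+ 2 <= (1 + eta) ^+ 2 by rewrite lerXn2r ?nnegrE ?cmod_ge0 ?ltW// addr_gt0.
    have : eta ^+ 2 <= eta by rewrite expr2 ler_piMr// ltW.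
    by rewrite /W sqrrD expr1n mul1r -mulr_natl; lra.
  have A2 : 0 <= 1 - A ^+ 2 <= 1.
    by apply/andP; split; [rewrite subr_ge0 expr_le1// ltW|rewrite gerBl sqr_ge0].
  have h1 : (1 - A ^+ 2) * W <= (1 - A ^+ 2) * (3 * eta) by rewrite ler_wpM2l//; case/andP: A2.
  have h2 : (1 - A ^+ 2) * (3 * eta) <= 1 * (3 * eta).
    by rewrite ler_wpM2r//; [lra|case/andP: A2].
  have h3 : q * (1 - b) ^+ 2 <= q * D ^+ 2.
    rewrite ler_wpM2l ?(ltW q0)// lerXn2r ?nnegrE ?(ltW D0) ?(ltW b1)//; exact: denb.
  by rewrite mulrDl mul1r; lra.
have hg : hol 0 (1 + eta) (fun w => f (phi w)).
  move=> v; rewrite subr0 => w1; have [d D] := hf _ (phir v w1); eexists.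
  apply: (is_cder_comp (g := phi)); last exact: D.
  apply: is_cderD; first exact: is_cder_cst.
  apply: is_cderZ; apply: is_cderM; first exact: is_cderD (is_cder_id _) (is_cder_cst _ _).
  apply: is_cderV; first exact: denn.
  apply: is_cderD; first exact: is_cder_cst.
  by apply: is_cderZ; exact: is_cder_id.
have e1 : 0 < (1 : R) < 1 + eta by rewrite ltr01 ltrDl.
have := mean_value e1 hg.
have -> : phi 0 = z by rewrite /phi /den mulr0 addr0 divr1 add0r /a mulrC divfK// addrC subrK.
move=> <-; apply: circ_le => [|w w1]; first exact: (hol_cbounded e1 hg).
rewrite add0r ofR1 mul1r; apply: fM; rewrite phi_norm.
suff -> : cmod (w + a) = cmod (den w).
  by rewrite divff ?mulr1// gt_eqF// cmod_gt0// denn// w1 ltrDl.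
by apply/eqP; rewrite -(eqrXn2 (n := 2)) ?cmod_ge0// key w1 expr1n subrr mulr0 addr0.
Qed.

Lemma hol_bounded (f : C -> C) (c : C) (r rho : R) : 0 < rho < r -> hol c r f ->
  exists M : R, forall z, cmod (z - c) <= rho -> cmod (f z) <= M.
Proof.
move=> rr hf; have rho0 : 0 < rho by case/andP: rr.
have [M HM] := cbounded_unit (hol_cbounded rr hf); exists M; apply: max_modulus rr hf _.
move=> z zr; have rn : ofR rho != 0 by apply: cmod_gt0_neq; rewrite cmod_ofR gtr0_norm.
have -> : z = c + ofR rho * ((z - c) / ofR rho).
  by rewrite [ofR rho * _]mulrC divfK// addrC subrK.
by apply: HM; rewrite cmod_div zr cmod_ofR gtr0_norm// divff// gt_eqF.
Qed.

Lemma cd_bounded (f : C -> C) (c : C) (r rho : R) : 0 < rho < r -> hol c r f ->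
  exists L : R, forall z, cmod (z - c) <= rho -> cmod (cd f z) <= L.
Proof.
move=> /andP[rho0 rr] hf; pose s := (r - rho) / 2.
have s0 : 0 < s by rewrite /s; lra.
have [|M HM] := @hol_bounded f c r (rho + s) _ hf; first by rewrite /s; apply/andP; split; lra.
exists (M / s) => z zr.
apply: (@cauchy_estimate f z (r - rho)); first by rewrite /s; apply/andP; split; lra.
  by apply: hol_sub hf; lra.
move=> w ws; apply: HM; have -> : w - c = (w - z) + (z - c) by ring.
by apply: le_trans (le_cmodD _ _) _; lra.
Qed.

Lemma seg_disc (c z h : C) (rho t : R) : cmod (z - c) <= rho -> cmod (z + h - c) <= rho ->
  0 <= t <= 1 -> cmod (z + ofR t * h - c) <= rho.
Proof.
move=> z0 z1 /andP[t0 t1].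
have -> : z + ofR t * h - c = ofR (1 - t) * (z - c) + ofR t * (z + h - c).
  by rewrite ofRB ofR1; ring.
apply: le_trans (le_cmodD _ _) _; rewrite !cmodM !cmod_ofR ger0_norm ?subr_ge0// ger0_norm//.
have : (1 - t) * cmod (z - c) <= (1 - t) * rho by rewrite ler_wpM2l// subr_ge0.
have : t * cmod (z + h - c) <= t * rho by rewrite ler_wpM2l.
lra.
Qed.

Lemma hol_lipschitz (f : C -> C) (c : C) (r rho : R) : 0 < rho < r -> hol c r f ->
  exists2 L : R, 0 <= L & forall z h, cmod (z - c) <= rho -> cmod (z + h - c) <= rho ->
    cmod (f (z + h) - f z) <= L * cmod h.
Proof.
move=> rr hf; have [L HL] := cd_bounded rr hf.
have rho0 : 0 < rho by case/andP: rr.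
exists L; first by apply: le_trans (cmod_ge0 _) (HL c _); rewrite subrr cmod0 ltW.
move=> z h z0 z1; apply: (@cder_lipschitz R f (cd f)) => t t01.
  apply/is_cder_cd/hf; apply: le_lt_trans (seg_disc z0 z1 t01) _; by case/andP: rr.
by apply: HL; exact: seg_disc.
Qed.

(** By [circ_deriv] the derivative is a circle mean of [f], so it inherits the Lipschitz bound that
    [f] has on a slightly larger disc. *)
Lemma cd_lipschitz (f : C -> C) (c : C) (r rho : R) : 0 < rho < r -> hol c r f ->
  exists2 L : R, 0 <= L & forall z h, cmod (z - c) <= rho -> cmod (z + h - c) <= rho ->
    cmod (cd f (z + h) - cd f z) <= L * cmod h.
Proof.
move=> /andP[rho0 rr] hf; pose s := (r - rho) / 2.
have s0 : 0 < s by rewrite /s; lra.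
have [|L L0 HL] := @hol_lipschitz f c r (rho + s) _ hf; first by rewrite /s; apply/andP; split; lra.
have sr : 0 < s < r - rho by rewrite /s; apply/andP; split; lra.
have sn : ofR s != 0 by apply: cmod_gt0_neq; rewrite cmod_ofR gtr0_norm.
exists (L / s); first by rewrite divr_ge0// ltW.
move=> z h z0 z1.
have hz x : cmod (x - c) <= rho -> hol x (r - rho) f by move=> xc; apply: hol_sub hf; lra.
have b x : cmod (x - c) <= rho -> cbounded (fun w => f (x + ofR s * w) * w^-1).
  move=> xc; apply: cboundedM; last exact: cboundedV.
  exact: hol_cbounded sr (hz x xc).
rewrite mulrAC ler_pdivlMr// mulrC -[X in X * _](gtr0_norm s0) -cmod_ofR -cmodM.
have -> : ofR s * (cd f (z + h) - cd f z) =
    circ (fun w => f (z + h + ofR s * w) * w^-1 - f (z + ofR s * w) * w^-1).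
  rewrite (circB (b _ z1) (b _ z0)) (circ_deriv sr (hz _ z1)) (circ_deriv sr (hz _ z0)).
  exact: mulrBr.
apply: circ_le => [|w w1].
  have [B1 H1] := b _ z1; have [B2 H2] := b _ z0; exists (B1 + B2) => t t0.
  exact: le_trans (le_cmodB _ _) (lerD (H1 t t0) (H2 t t0)).
rewrite -mulrBl cmodM cmodV w1 invr1 mulr1.
have -> : z + h + ofR s * w = (z + ofR s * w) + h by ring.
have ws : cmod (ofR s * w) = s by rewrite cmodM w1 cmod_ofR mulr1 gtr0_norm.
apply: HL.
  have -> : z + ofR s * w - c = (z - c) + ofR s * w by ring.
  by apply: le_trans (le_cmodD _ _) _; rewrite ws lerD2r.
have -> : z + ofR s * w + h - c = (z + h - c) + ofR s * w by ring.
by apply: le_trans (le_cmodD _ _) _; rewrite ws lerD2r.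
Qed.

Lemma taylor1 (f : C -> C) (c : C) (r rho : R) : 0 < rho < r -> hol c r f ->
  exists2 L : R, 0 <= L & forall z h, cmod (z - c) <= rho -> cmod (z + h - c) <= rho ->
    cmod (f (z + h) - f z - cd f z * h) <= L * cmod h ^+ 2.
Proof.
move=> rr hf; have [L L0 HL] := cd_lipschitz rr hf; exists L => // z h z0 z1.
have := @cder_lipschitz R (fun x => f x - cd f z * x) (fun x => cd f x - cd f z) z h (L * cmod h).
move=> /(_ _ _)/wrap[t t01|t t01|].
- have := is_cderB (is_cder_cd (hf (z + ofR t * h) _)) (is_cderZ (cd f z) (is_cder_id _)).
  rewrite mulr1; apply.
  by apply: le_lt_trans (seg_disc z0 z1 t01) _; case/andP: rr.
- apply: le_trans (HL z (ofR t * h) z0 (seg_disc z0 z1 t01)) _.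
  case/andP: t01 => t0 t1.
  by rewrite ler_wpM2l// cmodM cmod_ofR ger0_norm// ler_piMl// cmod_ge0.
rewrite -mulrA -expr2; apply: le_trans; rewrite le_eqVlt; apply/orP; left; apply/eqP; congr cmod.
by move: (f _) (f _) (cd f _) => u1 u2 u3; ring.
Qed.

(** Differentiation under the circle mean in [circ_deriv]; the error bound of [taylor1] is uniform
    on the circle and so survives averaging. *)
Lemma hol_cd (f : C -> C) (c : C) (r : R) : hol c r f -> hol c r (cd f).
Proof.
move=> hf z zr; pose s := (r - cmod (z - c)) / 4.
have s0 : 0 < s by rewrite /s; lra.
have hz : hol z (4 * s) f by apply: hol_sub hf; rewrite /s; lra.
have [|L L0 HL] := @taylor1 f z (4 * s) (3 * s) _ hz; first by apply/andP; split; lra.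
have [|B HB] := @cd_bounded f z (4 * s) (3 * s) _ hz; first by apply/andP; split; lra.
have s1 : 0 < s < 2 * s by apply/andP; split; lra.
have sn : ofR s != 0 by apply: cmod_gt0_neq; rewrite cmod_ofR gtr0_norm.
have cw (w : C) : cmod w = 1 -> cmod (ofR s * w) = s.
  by move=> w1; rewrite cmodM w1 cmod_ofR mulr1 gtr0_norm.
have b2 : cbounded (fun w => cd f (z + ofR s * w) * w^-1).
  apply: cboundedM; last exact: cboundedV.
  by exists B => t _; apply: HB; rewrite addrCK cw ?cmod_cis//; lra.
exists ((ofR s)^-1 * circ (fun w => cd f (z + ofR s * w) * w^-1)) => e e0.
pose L1 := L / s + 1; have L10 : 0 < L1 by rewrite ltr_pwDr// divr_ge0// ltW.
exists (Num.min s (e / L1)); first by rewrite lt_min s0 divr_gt0.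
move=> h; rewrite lt_min => /andP[h1 h2].
have hzz x : cmod (x - z) <= s -> hol x (2 * s) f by move=> xz; apply: hol_sub hz; lra.
have z1 : cmod (z + h - z) <= s by rewrite addrCK ltW.
have z2 : cmod (z - z) <= s by rewrite subrr cmod0 ltW.
have b x : cmod (x - z) <= s -> cbounded (fun w => f (x + ofR s * w) * w^-1).
  move=> xc; apply: cboundedM; last exact: cboundedV.
  exact: hol_cbounded s1 (hzz x xc).
have E : cd f (z + h) - cd f z - (ofR s)^-1 * circ (fun w => cd f (z + ofR s * w) * w^-1) * h =
   (ofR s)^-1 * circ (fun w => f (z + h + ofR s * w) * w^-1 - f (z + ofR s * w) * w^-1
                              - h * (cd f (z + ofR s * w) * w^-1)).
  rewrite circB; last 2 first.
  - have [B1 H1] := b _ z1; have [B2 H2] := b _ z2; exists (B1 + B2) => t t0.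
    exact: le_trans (le_cmodB _ _) (lerD (H1 t t0) (H2 t t0)).
  - exact: cboundedM (cbounded_cst _) b2.
  rewrite circB; try exact: b.
  rewrite (circ_deriv s1 (hzz _ z1)) (circ_deriv s1 (hzz _ z2)) circZ//.
  by move: (cd f (z + h)) (cd f z) (circ _) => u1 u2 u3; field.
rewrite E cmodM cmodV cmod_ofR gtr0_norm//.
apply: (@le_trans _ _ (s^-1 * (L * cmod h ^+ 2))); last first.
  have -> : s^-1 * (L * cmod h ^+ 2) = (L / s * cmod h) * cmod h by ring.
  rewrite ler_wpM2r ?cmod_ge0//.
  apply: le_trans (_ : L1 * cmod h <= _); first by rewrite ler_wpM2r ?cmod_ge0// lerDl.
  by rewrite mulrC -ler_pdivlMr// ltW.
rewrite ler_wpM2l ?invr_ge0 ?(ltW s0)//.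
apply: circ_le => [|w w1].
  have [B1 H1] := b _ z1; have [B2 H2] := b _ z2.
  have [B3 H3] := cboundedM (cbounded_cst h) b2.
  exists (B1 + B2 + B3) => t t0; apply: le_trans (le_cmodB _ _) (lerD _ (H3 t t0)).
  exact: le_trans (le_cmodB _ _) (lerD (H1 t t0) (H2 t t0)).
have -> : f (z + h + ofR s * w) * w^-1 - f (z + ofR s * w) * w^-1 - h * (cd f (z + ofR s * w) * w^-1)
  = (f (z + ofR s * w + h) - f (z + ofR s * w) - cd f (z + ofR s * w) * h) * w^-1.
  have -> : z + h + ofR s * w = z + ofR s * w + h by ring.
  by move: (f _) (f _) (cd f _) => u1 u2 u3; ring.
rewrite cmodM cmodV w1 invr1 mulr1; apply: HL; first by rewrite addrCK cw//; lra.
have -> : z + ofR s * w + h - z = ofR s * w + h by ring.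
by apply: le_trans (le_cmodD _ _) _; rewrite cw//; lra.
Qed.

(** The quotient of [f] by [z - a], with the value at [a] that removes the singularity when
    [f a = 0]. *)
Definition divX (f : C -> C) (a z : C) : C := if z == a then cd f a else f z / (z - a).

Lemma divXE f a z : f a = 0 -> f z = (z - a) * divX f a z.
Proof.
move=> fa; rewrite /divX; case: eqVneq => [->|za]; first by rewrite subrr mul0r.
by rewrite mulrC divfK// subr_eq0.
Qed.

(** At [a] itself, integrating [taylor1] for the derivative gives a second order expansion of [f]
    with cubic error, hence the derivative [f''(a) / 2] of the quotient. *)
Lemma hol_divX f (c a : C) (r : R) : cmod (a - c) < r -> f a = 0 -> hol c r f -> hol c r (divX f a).
Proof.
move=> ar fa hf z zr; have [->|za] := eqVneq z a; last first.
  have [d D] := hf z zr.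
  have za0 : z - a != 0 by rewrite subr_eq0.
  eexists; apply: (@is_cder_near R (fun w => f w * (w - a)^-1) _ z _ (cmod (z - a))).
  - exact: cmod_gt0.
  - move=> w wz; rewrite /divX; case: eqVneq => // wa.
    by move: wz; rewrite wa cmodB ltxx.
  - apply: is_cderM D _; apply: is_cderV => //.
    exact: is_cderB (is_cder_id _) (is_cder_cst _ _).
pose s := (r - cmod (a - c)) / 2.
have s0 : 0 < s by rewrite /s; lra.
have ha : hol a (2 * s) f by apply: hol_sub hf; rewrite /s; lra.
have hd := hol_cd ha.
have ss : 0 < s < 2 * s by apply/andP; split; lra.
have [L L0 HL] := taylor1 ss hd.
have aa : cmod (a - a) <= s by rewrite subrr cmod0 ltW.
have T h : cmod h <= s -> cmod (f (a + h) - cd f a * h - cd (cd f) a / 2 * h ^+ 2) <= L * cmod h ^+ 2 * cmod h.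
  move=> hs; have ah : cmod (a + h - a) <= s by rewrite addrCK.
  have := @cder_lipschitz R (fun x => f x - cd f a * x - cd (cd f) a / 2 * ((x - a) * (x - a)))
     (fun x => cd f x - cd f a - cd (cd f) a * (x - a)) a h (L * cmod h ^+ 2).
  move=> /(_ _ _)/wrap[t t01|t t01|].
  - have ts := seg_disc aa ah t01.
    have := is_cderB (is_cderB (is_cder_cd (ha (a + ofR t * h) _)) (is_cderZ (cd f a) (is_cder_id _)))
      (is_cderZ (cd (cd f) a / 2) (is_cderM (is_cderB (is_cder_id (a + ofR t * h)) (is_cder_cst a _))
        (is_cderB (is_cder_id (a + ofR t * h)) (is_cder_cst a _)))).
    move=> /(_ _)/wrap[|/is_cder_eq]; first by apply: le_lt_trans ts _; lra.
    by apply; move: (cd f _) (cd f a) (cd (cd f) a) => u1 u2 u3; field.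
  - have ts := seg_disc aa ah t01.
    have := HL a (ofR t * h) aa ts; rewrite addrCK => /le_trans; apply.
    case/andP: t01 => t0 t1; rewrite ler_wpM2l// lerXn2r ?nnegrE ?cmod_ge0//.
    by rewrite cmodM cmod_ofR ger0_norm// ler_piMl// cmod_ge0.
  apply: le_trans; rewrite le_eqVlt; apply/orP; left; apply/eqP; congr cmod.
  by rewrite fa addrCK; move: (f _) (cd f a) (cd (cd f) a) => u1 u2 u3; ring.
exists (cd (cd f) a / 2) => e e0.
pose L1 := L + 1; have L10 : 0 < L1 by rewrite ltr_pwDr.
exists (Num.min s (e / L1)); first by rewrite lt_min s0 divr_gt0.
move=> h; rewrite lt_min => /andP[h1 h2].
have [->|h0] := eqVneq h 0; first by rewrite addr0 mulr0 subrr subr0 cmod0 mulr0.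
have hp := cmod_gt0 h0.
have ahn : (a + h == a) = false by rewrite -subr_eq0 addrCK; exact/negbTE.
rewrite /divX ahn eqxx addrCK.
have -> : f (a + h) / h - cd f a - cd (cd f) a / 2 * h =
  (f (a + h) - cd f a * h - cd (cd f) a / 2 * h ^+ 2) / h.
  by move: (f _) (cd f a) (cd (cd f) a) => u1 u2 u3; field.
rewrite cmod_div ler_pdivrMr//; apply: le_trans (T h (ltW h1)) _.
rewrite ler_wpM2r ?cmod_ge0// expr2 mulrA ler_wpM2r ?cmod_ge0//.
apply: le_trans (_ : L1 * cmod h <= _); first by rewrite ler_wpM2r ?cmod_ge0// lerDl.
by rewrite mulrC -ler_pdivlMr// ltW.
Qed.

End LocalTheory.

(** * Harnack's inequality and logarithmic derivatives *)

Section Harnack.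
Variable R : realType.
Local Notation C := (Cplx R).
Local Notation Re := (@complex.Re R).
Local Notation Im := (@complex.Im R).
Local Notation ofR := (@ofR R).

(* [p] is the derivative of a holomorphic function of real part [v]. *)
Definition is_grad (v : C -> R) (z p : C) : Prop :=
  forall e : R, 0 < e -> exists2 r : R, 0 < r &
    forall h, cmod h < r -> `|v (z + h) - v z - Re (p * h)| <= e * cmod h.

Lemma is_cder_grad (f : C -> C) (k : R) (z d : C) : is_cder f z d ->
  is_grad (fun x => Re (f x) + k) z d.
Proof.
move=> fd e /fd[r r0 H]; exists r => // h /H; apply: le_trans.
apply: le_trans (normRe_le _); rewrite !cReD !cReN le_eqVlt; apply/orP; left; apply/eqP.
by congr (`| _ |); ring.
Qed.

Lemma is_grad_rder (v : C -> R) (z h p : C) (t : R) : is_grad v (z + ofR t * h) p ->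
  is_rder (fun t => v (z + ofR t * h)) t (Re (p * h)).
Proof.
move=> vd e e0; pose H := cmod h + 1; have H0 : 0 < H by rewrite ltr_pwDr ?cmod_ge0.
have e1 : 0 < e / H by rewrite divr_gt0.
have [r r0 Hr] := vd _ e1; exists (r / H); first by rewrite divr_gt0.
move=> s; rewrite ltr_pdivlMr// => sr.
have sh : cmod (ofR s * h) <= `|s| * H by rewrite cmodM cmod_ofR ler_wpM2l// lerDl.
have := Hr _ (le_lt_trans sh sr).
have -> : z + ofR t * h + ofR s * h = z + ofR (t + s) * h by rewrite ofRD; ring.
have -> : Re (p * (ofR s * h)) = Re (p * h) * s by rewrite mulrCA ReZ mulrC.
move=> /le_trans; apply; apply: le_trans (ler_wpM2l (ltW e1) sh) _.
have -> // : e / H * (`|s| * H) = e * `|s| by field; rewrite gt_eqF.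
Qed.

(** * Circle averages of the real part of a holomorphic function *)

Section Gradient.
Variables (v : C -> R) (psi : C -> C) (z0 : C) (r rho : R).
Hypothesis rr : 0 < rho < r.
Hypothesis hpsi : hol z0 r psi.
Hypothesis vgrad : forall z, cmod (z - z0) < r -> is_grad v z (psi z).

Let rho0 : 0 < rho. Proof. by case/andP: rr. Qed.

Lemma grad_taylor : exists2 L : R, 0 <= L & forall z h, cmod (z - z0) <= rho ->
  cmod (z + h - z0) <= rho -> `|v (z + h) - v z - Re (psi z * h)| <= L * cmod h ^+ 2.
Proof.
have [L L0 HL] := hol_lipschitz rr hpsi; exists L => // z h z1 z2.
have half (sg : R) : `|sg| = 1 ->
    sg * (v (z + h) - v z - Re (psi z * h)) <= L * cmod h ^+ 2.
  move=> sg1.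
  have := @rder_le_increment R (fun t => sg * v (z + ofR t * h) + (- (sg * Re (psi z * h))) * t)
     (fun t => sg * Re (psi (z + ofR t * h) * h) - sg * Re (psi z * h)) (L * cmod h ^+ 2).
  move=> /(_ _ _)/wrap[t t01|t t01|]; last first.
    rewrite ofR1 ofR0 mul1r mul0r addr0 mulr1 mulr0 addr0; apply: le_trans.
    by rewrite !mulrBr; lra.
  - rewrite -mulrBr -cReN -cReD -mulrBl; apply: le_trans (ler_norm _) _.
    rewrite normrM sg1 mul1r; apply: le_trans (normRe_le _) _; rewrite cmodM.
    rewrite expr2 mulrA ler_wpM2r ?cmod_ge0//.
    apply: le_trans (HL z (ofR t * h) z1 (seg_disc z1 z2 t01)) _.
    case/andP: t01 => t0 t1.
    by rewrite ler_wpM2l// cmodM cmod_ofR ger0_norm// ler_piMl// cmod_ge0.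
  - have zt : cmod (z + ofR t * h - z0) < r.
      by apply: le_lt_trans (seg_disc z1 z2 t01) _; case/andP: rr.
    have /is_rderE D := is_grad_rder (vgrad zt); apply/is_rderE.
    have := is_deriveD (is_deriveZ sg D) (is_deriveZ (- (sg * Re (psi z * h))) (is_derive_id t 1)).
    by rewrite /GRing.scale /= mulr1.
rewrite ler_norml; apply/andP; split.
  by have := half (-1); rewrite normrN normr1 => /(_ erefl); rewrite mulN1r; lra.
by have := half 1; rewrite normr1 mul1r => /(_ erefl).
Qed.

(** Cutting the interval into [n] pieces leaves a total error [L * rho ^+ 2 / n]. This integrates a
    constant derivative for functions known only through their increments. *)
Lemma quadratic_increments (B : R -> C) (D : C) (L : R) : 0 <= L ->
  (forall t s, 0 <= t -> 0 <= s -> t + s <= rho -> cmod (B (t + s) - B t - ofR s * D) <= L * s ^+ 2) ->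
  B rho - B 0 = ofR rho * D.
Proof.
move=> L0 HB; apply/eqP; rewrite -subr_eq0; apply/eqP; apply: cmod_small => e e0.
pose n := (Num.truncn (L * rho ^+ 2 / e)).+1.
have n0 : 0 < n%:R :> R by rewrite ltr0n.
have nn : n%:R != 0 :> R by rewrite gt_eqF.
have step k : (k <= n)%N ->
    cmod (B (k%:R * (rho / n%:R)) - B 0 - ofR (k%:R * (rho / n%:R)) * D) <= k%:R * (L * (rho / n%:R) ^+ 2).
  elim: k => [_|k IH kn]; first by rewrite !mul0r !subrr cmod0.
  have s0 : 0 <= rho / n%:R by rewrite divr_ge0// ltW.
  have {}IH := IH (ltnW kn).
  have := HB (k%:R * (rho / n%:R)) (rho / n%:R).
  rewrite mulr_ge0// s0 => /(_ isT isT).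
  have -> : k%:R * (rho / n%:R) + rho / n%:R = k.+1%:R * (rho / n%:R) by rewrite -natr1 mulrDl mul1r.
  move=> /(_ _)/wrap[|H].
    rewrite mulrA ler_pdivrMr// mulrC ler_wpM2l ?(ltW rho0)// ler_nat//.
  have -> : B (k.+1%:R * (rho / n%:R)) - B 0 - ofR (k.+1%:R * (rho / n%:R)) * D =
     (B (k%:R * (rho / n%:R)) - B 0 - ofR (k%:R * (rho / n%:R)) * D) +
     (B (k.+1%:R * (rho / n%:R)) - B (k%:R * (rho / n%:R)) - ofR (rho / n%:R) * D).
    have -> : ofR (k.+1%:R * (rho / n%:R)) = ofR (k%:R * (rho / n%:R)) + ofR (rho / n%:R).
      by rewrite -ofRD -natr1 mulrDl mul1r.
    by ring.
  apply: le_trans (le_cmodD _ _) _; apply: le_trans (lerD IH H) _.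
  by rewrite -natr1 mulrDl mul1r.
have := step n (leqnn n).
have -> : n%:R * (rho / n%:R) = rho by rewrite mulrC divfK.
move=> /le_trans; apply.
have -> : n%:R * (L * (rho / n%:R) ^+ 2) = L * rho ^+ 2 / n%:R by field.
rewrite ler_pdivrMr// [e * _]mulrC -ler_pdivrMr//; apply: ltW.
exact: truncnS_gt.
Qed.

Lemma cbounded_grad (t : R) : 0 <= t <= rho -> cbounded (fun w => ofR (v (z0 + ofR t * w))).
Proof.
move=> /andP[t0 t1]; have [L L0 HL] := grad_taylor.
exists (L * t ^+ 2 + cmod (psi z0) * t + `|v z0|) => s _.
have ct : cmod (ofR t * cis s) = t by rewrite cmodM cmod_cis cmod_ofR mulr1 ger0_norm.
have := HL z0 (ofR t * cis s); rewrite subrr cmod0 addrCK ct => /(_ (ltW rho0) t1) H.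
rewrite cmod_ofR.
have -> : v (z0 + ofR t * cis s) = (v (z0 + ofR t * cis s) - v z0 - Re (psi z0 * (ofR t * cis s)))
   + Re (psi z0 * (ofR t * cis s)) + v z0 by ring.
apply: le_trans (ler_normD _ _) _; rewrite lerD2r.
apply: le_trans (ler_normD _ _) _; apply: lerD => //.
by apply: le_trans (normRe_le _) _; rewrite cmodM ct.
Qed.

Lemma cbounded_psi (t : R) : 0 <= t <= rho -> cbounded (fun w => psi (z0 + ofR t * w)).
Proof.
move=> /andP[t0 t1]; have [M HM] := hol_bounded rr hpsi; exists M => s _; apply: HM.
by rewrite addrCK cmodM cmod_cis cmod_ofR mulr1 ger0_norm.
Qed.

Lemma circ_psi (t : R) : 0 <= t <= rho -> circ (fun w => psi (z0 + ofR t * w)) = psi z0.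
Proof.
move=> /andP[t0 t1]; have [->|tn] := eqVneq t 0.
  rewrite (circ_ext (g := fun=> psi z0)) ?circ_cst// => s _.
  by rewrite ofR0 mul0r addr0.
apply: (mean_value (r := r)) => //; rewrite lt_neqAle eq_sym tn t0 /=.
by apply: le_lt_trans t1 _; case/andP: rr.
Qed.

Lemma circ_psi_moment (t : R) (k : nat) : 0 <= t <= rho ->
  circ (fun w => psi (z0 + ofR t * w) * w ^+ k.+1) = 0.
Proof.
move=> /andP[t0 t1]; have [->|tn] := eqVneq t 0.
  rewrite (circ_ext (g := fun w => psi z0 * w ^+ k.+1)); last first.
    by move=> s _; rewrite ofR0 mul0r addr0.
  have r12 : 0 < (1 : R) < 2 by apply/andP; split; lra.
  exact: (circ_moment k r12 (@hol_cst R 0 2 (psi z0))).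
apply: (circ_moment (r := r)) => //; rewrite lt_neqAle eq_sym tn t0 /=.
by apply: le_lt_trans t1 _; case/andP: rr.
Qed.

(** As a function of the radius [t], the mean of [v * k] has derivative equal to the mean of
    [Re (psi * w) * k], assumed to be the constant [D]. It is used with [k = 1] and [k = w^-1]. *)
Lemma circ_grad (k : C -> C) (D : C) : (forall w, cmod w = 1 -> cmod (k w) = 1) ->
  (forall t, 0 <= t <= rho ->
     circ (fun w => ofR (Re (psi (z0 + ofR t * w) * w)) * k w) = D) ->
  circ (fun w => ofR (v (z0 + ofR rho * w)) * k w) = ofR (v z0) * circ k + ofR rho * D.
Proof.
move=> k1 kD; have [L L0 HL] := grad_taylor.
have kb : cbounded k by exists 1 => s _; rewrite k1// cmod_cis.
pose B t := circ (fun w => ofR (v (z0 + ofR t * w)) * k w).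
have Bb t : 0 <= t <= rho -> cbounded (fun w => ofR (v (z0 + ofR t * w)) * k w).
  by move=> tt; exact: cboundedM (cbounded_grad tt) kb.
have := @quadratic_increments B D L L0 _.
have -> : B 0 = ofR (v z0) * circ k.
  by rewrite -circZ//; apply: circ_ext => s _; rewrite ofR0 mul0r addr0.
rewrite -/(B rho) => <-; first by rewrite addrC subrK.
move=> t s t0 s0 ts.
have tt : 0 <= t <= rho by apply/andP; split=> //; lra.
have tts : 0 <= t + s <= rho by apply/andP; split=> //; lra.
have pb : cbounded (fun w => ofR (Re (psi (z0 + ofR t * w) * w)) * k w).
  apply: cboundedM kb; have [M HM] := cbounded_psi tt; exists M => a a0.
  rewrite cmod_ofR; apply: le_trans (normRe_le _) _; rewrite cmodM cmod_cis mulr1; exact: HM.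
rewrite -(kD t tt) /B -(circZ _ pb) -(circB (Bb _ tts) (Bb _ tt)) -circB; last 2 first.
- have [B1 H1] := Bb _ tts; have [B2 H2] := Bb _ tt; exists (B1 + B2) => a a0.
  exact: le_trans (le_cmodB _ _) (lerD (H1 a a0) (H2 a a0)).
- exact: cboundedM (cbounded_cst _) pb.
apply: circ_le => [|w w1].
  have [B1 H1] := Bb _ tts; have [B2 H2] := Bb _ tt.
  have [B3 H3] := cboundedM (cbounded_cst (ofR s)) pb; exists (B1 + B2 + B3) => a a0.
  apply: le_trans (le_cmodB _ _) (lerD _ (H3 a a0)).
  exact: le_trans (le_cmodB _ _) (lerD (H1 a a0) (H2 a a0)).
have -> : ofR (v (z0 + ofR (t + s) * w)) * k w - ofR (v (z0 + ofR t * w)) * k w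
   - ofR s * (ofR (Re (psi (z0 + ofR t * w) * w)) * k w) =
   ofR (v (z0 + ofR (t + s) * w) - v (z0 + ofR t * w) - s * Re (psi (z0 + ofR t * w) * w)) * k w.
  by rewrite !ofRB ofRM; ring.
rewrite cmodM k1// mulr1 cmod_ofR -ReZ mulrCA.
have -> : z0 + ofR (t + s) * w = z0 + ofR t * w + ofR s * w by rewrite ofRD; ring.
have cw (a : R) : 0 <= a -> cmod (ofR a * w) = a.
  by move=> a0; rewrite cmodM w1 cmod_ofR mulr1 ger0_norm.
have := HL (z0 + ofR t * w) (ofR s * w); rewrite cw//; apply.
  by rewrite addrCK cw//; case/andP: tt.
have -> : z0 + ofR t * w + ofR s * w - z0 = ofR (t + s) * w by rewrite ofRD; ring.
by rewrite cw; lra.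
Qed.

Lemma Re_half (x : C) : ofR (Re x) = ofR 2^-1 * (x + cconj x).
Proof. by apply: complexP; rewrite ?ReZ ?ImZ ?cReD ?cImD /=; lra. Qed.

Lemma circ_grad_mean : circ (fun w => ofR (v (z0 + ofR rho * w))) = ofR (v z0).
Proof.
have E := @circ_grad (fun=> 1) 0 _ _.
transitivity (circ (fun w => ofR (v (z0 + ofR rho * w)) * 1)).
  by apply: circ_ext => t _; rewrite mulr1.
rewrite E ?circ_cst ?mulr1 ?mulr0 ?addr0// => [w _|t tt]; first exact: cmod1.
have mb : cbounded (fun w => psi (z0 + ofR t * w) * w ^+ 1).
  exact: cboundedM (cbounded_psi tt) (cboundedX _ 1).
transitivity (circ (fun w => ofR 2^-1 * (psi (z0 + ofR t * w) * w ^+ 1 + cconj (psi (z0 + ofR t * w) * w ^+ 1)))).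
  by apply: circ_ext => a _; rewrite mulr1 Re_half expr1.
rewrite circZ; last exact: cboundedD mb (cbounded_conj mb).
rewrite (circD mb (cbounded_conj mb)) (circ_conj mb) circ_psi_moment//.
by apply: complexP; rewrite ?ReZ ?ImZ ?cReD ?cImD /=; lra.
Qed.

(** On the unit circle [Re (psi * w) / w] is half of [psi + cconj (psi * w ^+ 2)]; the first term
    has mean [psi z0], the second has mean 0. *)
Lemma circ_grad_inv : circ (fun w => ofR (v (z0 + ofR rho * w)) * w^-1) = ofR (rho / 2) * psi z0.
Proof.
have E := @circ_grad (fun w => w^-1) (ofR 2^-1 * psi z0) _ _.
rewrite E ?circ_inv ?mulr0 ?add0r.
- by rewrite ofRM mulrA.
- by move=> w w1; rewrite cmodV w1 invr1.
move=> t tt.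
have mb : cbounded (fun w => psi (z0 + ofR t * w) * w ^+ 2).
  exact: cboundedM (cbounded_psi tt) (cboundedX _ 2).
have pb := cbounded_psi tt.
transitivity (circ (fun w => ofR 2^-1 * (psi (z0 + ofR t * w) + cconj (psi (z0 + ofR t * w) * w ^+ 2)))).
  apply: circ_ext => a _; rewrite Re_half -mulrA; congr (_ * _).
  have w0 : cis a != 0 by apply: cmod_gt0_neq; rewrite cmod_cis.
  rewrite mulrDl mulfK//; congr (_ + _).
  rewrite -(conj_unit (cmod_cis a)) /cconj; apply: complexP;
    rewrite !(cReM, cImM) /= ?(cReM, cImM) /= ?(cReM, cImM) /=; ring.
rewrite circZ; last exact: cboundedD pb (cbounded_conj mb).
rewrite (circD pb (cbounded_conj mb)) (circ_conj mb) circ_psi_moment// circ_psi//.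
congr (_ * _); apply: complexP; rewrite ?cReD ?cImD /=; lra.
Qed.

(* [circ (v / w)] is [rho / 2] times the derivative, [circ v] is [v z0]. *)
Lemma harnack_grad : (forall z, cmod (z - z0) < r -> 0 <= v z) -> cmod (psi z0) <= 2 / rho * v z0.
Proof.
move=> v0; have rho1 : 0 <= rho <= rho by rewrite lexx ltW.
have := @circ_dominated R (fun w => ofR (v (z0 + ofR rho * w)) * w^-1) (fun w => v (z0 + ofR rho * w)).
move=> /(_ _ _ _)/wrap[||w w1|].
- exact: cboundedM (cbounded_grad rho1) (cboundedV R).
- exact: cbounded_grad.
- rewrite cmodM cmodV w1 invr1 mulr1 cmod_ofR ger0_norm//; apply: v0.
  by rewrite addrCK cmodM cmod_ofR w1 mulr1 gtr0_norm//; case/andP: rr.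
rewrite circ_grad_mean circ_grad_inv Re_ofR cmodM cmod_ofR gtr0_norm ?divr_gt0//.
rewrite -ler_pdivlMl ?divr_gt0//; move=> /le_trans; apply.
by rewrite invf_div.
Qed.

End Gradient.

Lemma gronwall (g dg : R -> R) (c : R) :
  (forall t, 0 <= t <= 1 -> is_rder g t (dg t)) -> (forall t, 0 <= t <= 1 -> dg t <= c * g t) ->
  g 1 <= expR c * g 0.
Proof.
move=> gd gc.
have := @rder_le_increment R (fun t => g t * expR (- c * t)) (fun t => (dg t - c * g t) * expR (- c * t)) 0.
move=> /(_ _ _)/wrap[t t01|t t01|].
- apply/is_rderE; have /is_rderE D := gd t t01.
  have E : is_derive t 1 (fun t => expR (- c * t)) (- c * expR (- c * t)).
    have h : is_derive t 1 (fun t : R => - c * t) (- c).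
      by have := is_deriveZ (- c) (is_derive_id t 1); rewrite /GRing.scale /= mulr1.
    have H := @is_derive1_comp R expR (fun t => - c * t) t (expR (- c * t)) (- c) (is_derive_expR _) h.
    by rewrite mulrC; exact: H.
  have := is_deriveM D E; rewrite /GRing.scale /=.
  by have -> : g t * (- c * expR (- c * t)) + expR (- c * t) * dg t = (dg t - c * g t) * expR (- c * t) by ring.
- by rewrite mulr_le0_ge0 ?expR_ge0// subr_le0 gc.
rewrite mulr0 mulr1 expR0 mulr1 subr_le0 expRN ler_pdivrMr ?expR_gt0//.
by rewrite mulrC.
Qed.

(** [harnack_grad] on discs of radius [r - rho] bounds the gradient of [v] by a multiple of [v]
    itself; Gronwall's inequality along the segment from [z0] then compares [v] with [v z0]. *)
Lemma harnack (v : C -> R) (psi : C -> C) (z0 : C) (r rho : R) : 0 < rho < r -> hol z0 r psi ->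
  (forall z, cmod (z - z0) < r -> is_grad v z (psi z)) ->
  (forall z, cmod (z - z0) < r -> 0 <= v z) ->
  forall z, cmod (z - z0) <= rho ->
    cmod (psi z) <= 4 / (r - rho) * expR (4 * rho / (r - rho)) * v z0.
Proof.
move=> /andP[rho0 rhor] hp vg v0 z zr.
have d0 : 0 < r - rho by rewrite subr_gt0.
have G x : cmod (x - z0) <= rho -> cmod (psi x) <= 4 / (r - rho) * v x.
  move=> xr; have sub y : cmod (y - x) < r - rho -> cmod (y - z0) < r.
    move=> yx; have -> : y - z0 = (y - x) + (x - z0) by ring.
    by apply: le_lt_trans (le_cmodD _ _) _; lra.
  have h2 : 0 < (r - rho) / 2 < r - rho by apply/andP; split; lra.
  have -> : 4 / (r - rho) = 2 / ((r - rho) / 2) by field; rewrite gt_eqF.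
  apply: (@harnack_grad v psi x (r - rho)) => //.
  - by apply: hol_sub hp; lra.
  - by move=> y /sub; exact: vg.
  - by move=> y /sub; exact: v0.
apply: le_trans (G z zr) _; rewrite -[X in _ <= X]mulrA ler_wpM2l ?divr_ge0 ?(ltW d0)//.
have z0r : cmod (z0 - z0) <= rho by rewrite subrr cmod0 ltW.
have zz : cmod (z0 + (z - z0) - z0) <= rho by rewrite addrCK.
have := @gronwall (fun t => v (z0 + ofR t * (z - z0)))
  (fun t => Re (psi (z0 + ofR t * (z - z0)) * (z - z0))) (4 * rho / (r - rho)).
have zE : z0 + (z - z0) = z by rewrite addrC subrK.
rewrite ofR1 ofR0 mul1r mul0r addr0 zE; apply => t t01.
  by apply: is_grad_rder; apply: vg; apply: le_lt_trans (seg_disc z0r zz t01) _.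
have tr := seg_disc z0r zz t01.
apply: le_trans (Re_le _) _; rewrite cmodM.
apply: le_trans (ler_pM (cmod_ge0 _) (cmod_ge0 _) (G _ tr) zr) _.
by rewrite le_eqVlt; apply/orP; left; apply/eqP; field; rewrite gt_eqF.
Qed.

(** Reduced to the derivative of the real logarithm at 1 by [cmod (1 + u) ^+ 2 = 1 + x] with
    [x = 2 * Re u + cmod u ^+ 2]. *)
Lemma ln_cmod1D (e : R) : 0 < e -> exists2 r : R, 0 < r &
  forall u : C, cmod u < r -> `|ln (cmod (1 + u)) - Re u| <= e * cmod u.
Proof.
move=> e0; have e3 : 0 < e / 3 by rewrite divr_gt0.
have /is_rderE/(_ _ e3)[r r0 H] := is_derive1_ln (@ltr01 R).
exists (Num.min (Num.min (2^-1) e) (r / 3)); first by rewrite !lt_min invr_gt0 ltr0n e0 divr_gt0.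
move=> u; rewrite !lt_min => /andP[/andP[u2 ue] ur].
have u0 := cmod_ge0 u; have R1 := normRe_le u.
pose x := 2 * Re u + cmod u ^+ 2.
have x3 : `|x| <= 3 * cmod u.
  rewrite /x; apply: le_trans (ler_normD _ _) _; rewrite normrM ger0_norm// [`|_ ^+ 2|]ger0_norm ?sqr_ge0//.
  have : cmod u ^+ 2 <= cmod u by rewrite expr2 ler_piMr//; lra.
  lra.
have /H : `|x| < r by apply: le_lt_trans x3 _; rewrite mulrC -ltr_pdivlMr.
rewrite ln1 subr0 invr1 mul1r => {}H.
have c1 : cmod (1 + u) ^+ 2 = 1 + x.
  by rewrite /x !sqr_cmod !cReD !cImD /=; ring.
have c0 : 0 < cmod (1 + u).
  by apply: lt_le_trans (le_Bcmod _ _); rewrite cmod1; lra.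
have l2 : ln (1 + x) = 2 * ln (cmod (1 + u)) by rewrite -c1 lnXn// mulr_natl.
have -> : ln (cmod (1 + u)) - Re u = (ln (1 + x) - x) / 2 + cmod u ^+ 2 / 2.
  by rewrite l2 /x; field.
apply: le_trans (ler_normD _ _) _.
rewrite [`|_ ^+ 2 / _|]ger0_norm ?divr_ge0 ?sqr_ge0// normrM [`|2^-1|]ger0_norm ?invr_ge0//.
have : cmod u ^+ 2 <= e * cmod u by rewrite expr2 ler_wpM2r// ltW.
have : `|ln (1 + x) - x| <= e * cmod u.
  apply: le_trans H _; apply: le_trans (ler_wpM2l (ltW e3) x3) _.
  by rewrite le_eqVlt; apply/orP; left; apply/eqP; field.
lra.
Qed.

(** Takes the place of a branch of the logarithm: [ln (cmod (f x))] behaves like the real part of a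
    function with derivative [f' / f]. *)
Lemma is_grad_ln (f : C -> C) (k : R) (z d : C) : is_cder f z d -> f z != 0 ->
  is_grad (fun x => k - ln (cmod (f x))) z (- (d / f z)).
Proof.
move=> fd f0 e e0; have fp := cmod_gt0 f0.
have e2 : 0 < e / 2 by rewrite divr_gt0.
pose m := (cmod d + 1) / cmod (f z).
have m0 : 0 < m by rewrite divr_gt0// ltr_pwDr ?cmod_ge0.
have em : 0 < e / 2 / m by rewrite divr_gt0.
have ef : 0 < e / 2 * cmod (f z) by rewrite mulr_gt0.
have [r1 r10 H1] := ln_cmod1D em.
have [r2 r20 H2] := fd _ ef.
have [r3 r30 H3] := is_cder_lip fd.
exists (Num.min (Num.min r2 r3) (Num.min (r1 / m) (m^-1 / 2))).
  by rewrite !lt_min r20 r30 (divr_gt0 r10 m0) divr_gt0// invr_gt0.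
move=> h; rewrite !lt_min => /andP[/andP[h2 h3] /andP[h1 h4]].
pose u := (f (z + h) - f z) / f z.
have um : cmod u <= m * cmod h.
  rewrite /u cmod_div ler_pdivrMr//.
  have -> : m * cmod h * cmod (f z) = (cmod d + 1) * cmod h by rewrite /m; field; rewrite gt_eqF.
  exact: H3.
have /H1 {}H1 : cmod u < r1 by apply: le_lt_trans um _; rewrite mulrC -ltr_pdivlMr.
have u1 : cmod u < 1.
  apply: le_lt_trans um _.
  by have : m * cmod h < m * (m^-1 / 2) by [rewrite ltr_pM2l]; rewrite mulrA divff ?gt_eqF// => hm; lra.
have fE : f (z + h) = f z * (1 + u) by rewrite /u; field.
have n0 : 0 < cmod (1 + u) by apply: lt_le_trans (le_Bcmod _ _); rewrite cmod1; lra.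
rewrite fE cmodM lnM ?posrE//.
have -> : k - (ln (cmod (f z)) + ln (cmod (1 + u))) - (k - ln (cmod (f z))) - Re (- (d / f z) * h)
  = - (ln (cmod (1 + u)) - Re u) - Re (u - d / f z * h).
  by rewrite cReD cReN mulNr cReN; ring.
apply: le_trans (ler_normB _ _) _; rewrite normrN.
have A : e / 2 / m * cmod u <= e / 2 * cmod h.
  by apply: le_trans (ler_wpM2l (ltW em) um) _; rewrite mulrA divfK// gt_eqF.
have B : `|Re (u - d / f z * h)| <= e / 2 * cmod h.
  apply: le_trans (normRe_le _) _.
  have -> : u - d / f z * h = (f (z + h) - f z - d * h) / f z by rewrite /u; field.
  by rewrite cmod_div ler_pdivrMr// mulrAC; exact: H2.
have -> : e * cmod h = e / 2 * cmod h + e / 2 * cmod h by field.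
exact: lerD (le_trans H1 A) B.
Qed.

(** Harnack's inequality for the nonnegative function [ln M - ln (cmod (f x))], whose gradient is
    minus the logarithmic derivative. *)
Lemma zero_free_logderiv (f : C -> C) (M r rho : R) : 0 < rho < r -> hol 0 r f ->
  (forall z, cmod z < r -> f z != 0) -> (forall z, cmod z < r -> cmod (f z) <= M) ->
  forall z, cmod z <= rho ->
  cmod (cd f z / f z) <= 4 / (r - rho) * expR (4 * rho / (r - rho)) * (ln M - ln (cmod (f 0))).
Proof.
move=> rr hf f0 fM z zr.
have s0 (x : C) : cmod (x - 0) = cmod x by rewrite subr0.
have := @harnack (fun x => ln M - ln (cmod (f x))) (fun x => - (cd f x / f x)) 0 r rho rr.
move=> /(_ _ _ _)/wrap[|x|x|/(_ z)].
- have : hol 0 r (fun x => (-1) * (cd f x * (f x)^-1)).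
    apply: holM; first exact: hol_cst.
    apply: holM; first exact: hol_cd.
    by apply: holV => // x; rewrite s0; exact: f0.
  by under eq_fun do rewrite mulN1r.
- rewrite s0 => xr; apply: is_grad_ln; last exact: f0.
  by apply: is_cder_cd; apply: hf; rewrite s0.
- rewrite s0 => xr; rewrite subr_ge0 ler_ln ?posrE ?fM ?cmod_gt0 ?f0//.
  by apply: lt_le_trans (fM _ xr); rewrite cmod_gt0 ?f0.
by rewrite s0 cmodN => /(_ zr).
Qed.

(** This is [f] divided by the Blaschke factor [P * (z - a) / (P ^+ 2 - z * cconj a)] of the disc of
    radius [P = 11/8], written with [divX] to make sense at [a]. *)
Definition blaschke (f : C -> C) (a z : C) : C :=
  divX f a z * ((ofR (121/64) - z * cconj a) * ofR (8/11)).

Lemma ofR811_neq0 : ofR (8/11) != 0.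
Proof. by apply: cmod_gt0_neq; rewrite cmod_ofR gtr0_norm; lra. Qed.

Lemma blaschke_algebra (F : fieldType) (u1 u2 d k c x : F) :
  u2 != 0 -> d != 0 -> k != 0 -> x != 0 ->
  (u2 + x * u1) / (x * u2) = (u1 * (d * k) + u2 * (- c * k)) / (u2 * (d * k)) + c / d + x^-1.
Proof. by move=> u0 d0 k0 x0; field; rewrite u0 d0 k0 x0. Qed.

Section Blaschke.
Variables (f : C -> C) (a : C).
Hypotheses (hf : hol 0 2 f) (a1 : cmod a < 5/4) (fa : f a = 0).

Let hg : hol 0 2 (divX f a).
Proof. by apply: hol_divX => //; rewrite subr0; apply: lt_trans a1 _; lra. Qed.

Lemma hol_blaschke : hol 0 2 (blaschke f a).
Proof.
apply: (holM hg); apply: holM; last exact: hol_cst.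
have : hol 0 2 (fun z => ofR (121/64) + (-1) * (z * cconj a)).
  apply: holD; first exact: hol_cst.
  apply: holM; first exact: hol_cst.
  by apply: holM; [exact: hol_id|exact: hol_cst].
by under eq_fun do rewrite mulN1r.
Qed.

Lemma blaschke_circle z : cmod z = 11/8 -> cmod (blaschke f a z) = cmod (f z).
Proof.
move=> z1; rewrite /blaschke (divXE z fa) !cmodM cmod_ofR [RHS]mulrC; congr (_ * _).
rewrite (@ger0_norm _ (8/11)); last by lra.
suff -> : cmod (ofR (121/64) - z * cconj a) = 11/8 * cmod (z - a) by field.
have h : 0 <= 11/8 * cmod (z - a) by rewrite mulr_ge0 ?cmod_ge0//; lra.
apply/eqP; rewrite -(eqrXn2 (n := 2) _ (cmod_ge0 _) h)//.
have E : Re z ^+ 2 + Im z ^+ 2 = 121/64 by rewrite -sqr_cmod z1; field.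
apply/eqP; rewrite exprMn !sqr_cmod /cconj !(cReD, cImD, cReN, cImN, cReM, cImM) Re_ofR Im_ofR /=.
have -> : (11/8 : R) ^+ 2 = Re z ^+ 2 + Im z ^+ 2 by rewrite E; field.
have -> : (121/64 : R) = Re z ^+ 2 + Im z ^+ 2 by [].
by ring.
Qed.

(** At 0 the factor has modulus [cmod a / (11/8)], and [cmod a < 5/4]: hence the gain (11/8) / (5/4)
    = 11/10. *)
Lemma blaschke0 : 11/10 * cmod (f 0) <= cmod (blaschke f a 0).
Proof.
rewrite (divXE 0 fa) /blaschke mul0r subr0 sub0r !cmodM cmodN !cmod_ofR.
rewrite (@ger0_norm _ (121/64)); last by lra.
rewrite (@ger0_norm _ (8/11)); last by lra.
set G := cmod (divX f a 0); have G0 : 0 <= G := cmod_ge0 _.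
have : cmod a * G <= 5/4 * G by rewrite ler_wpM2r// ltW.
lra.
Qed.

Lemma blaschke_den_lb z : cmod z <= 9/8 -> 31/64 <= cmod (ofR (121/64) - z * cconj a).
Proof.
move=> z1; rewrite -mulrN; apply: le_trans (le_Bcmod _ _).
rewrite cmod_ofR cmodM cmodN cmod_conj (@ger0_norm _ (121/64)); last by lra.
have : cmod z * cmod a <= 9/8 * (5/4) by rewrite ler_pM ?cmod_ge0// ltW.
lra.
Qed.

Lemma blaschke_zero z : cmod z < 5/4 -> blaschke f a z = 0 -> f z = 0.
Proof.
move=> z1 /eqP; rewrite !mulf_eq0 => /orP[/eqP g0|]; first by rewrite (divXE z fa) g0 mulr0.
case/orP => /eqP E; exfalso.
  have := le_Bcmod (ofR (121/64)) (- (z * cconj a)); rewrite E cmod0 cmodN cmodM cmod_conj cmod_ofR.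
  rewrite (@ger0_norm _ (121/64)); last by lra.
  have : cmod z * cmod a <= 5/4 * (5/4) by rewrite ler_pM ?cmod_ge0// ltW.
  lra.
by move: ofR811_neq0; rewrite E eqxx.
Qed.

(** The logarithmic derivative of the factor is [(z - a)^-1 + cconj a / D]. The first term has
    nonnegative real part to the right of [a]; the second is at most (5/4) / (31/64) < 3. *)
Lemma blaschke_logderiv z : cmod z <= 9/8 -> Re a < Re z -> f z != 0 ->
  Re (cd (blaschke f a) z / blaschke f a z) - 3 <= Re (cd f z / f z).
Proof.
move=> z1 az fz.
have z2 : cmod (z - 0) < 2 by rewrite subr0; lra.
have za : z - a != 0.
  by apply/eqP => E; move: az; rewrite -(subr_gt0 (Re a)) -cReN -cReD E ltxx.
have gd := is_cder_cd (hg z2).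
have fd : cd f z = divX f a z + (z - a) * cd (divX f a) z.
  apply: is_cder_cdE; rewrite (_ : f = fun x => (x - a) * divX f a x); last first.
    by apply/funext => x; exact: divXE.
  have := is_cderM (is_cderB (is_cder_id z) (is_cder_cst a z)) gd.
  by move=> /is_cder_eq; apply; rewrite subr0 mul1r (_ : (fun x => (x - a) * divX f a x) = f)//;
    apply/funext => x; rewrite -divXE.
set D := ofR (121/64) - z * cconj a.
have D0 : D != 0.
  apply: cmod_gt0_neq; apply: lt_le_trans (blaschke_den_lb z1); lra.
have bd : cd (blaschke f a) z = cd (divX f a) z * (D * ofR (8/11)) + divX f a z * (- cconj a * ofR (8/11)).
  apply: is_cder_cdE.
  have := is_cderM gd (is_cderM (is_cderB (is_cder_cst (ofR (121/64)) z)
    (is_cderM (is_cder_id z) (is_cder_cst (cconj a) z))) (is_cder_cst (ofR (8/11)) z)).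
  move=> /is_cder_eq; apply; rewrite -/D.
  by move: (cd _ _) (divX f a z) => u1 u2; ring.
have g0 : divX f a z != 0.
  by apply: contraNneq fz => g0; rewrite (divXE z fa) g0 mulr0.
have k0 := ofR811_neq0.
have E : cd f z / f z = cd (blaschke f a) z / blaschke f a z + cconj a / D + (z - a)^-1.
  rewrite fd bd /blaschke -/D (divXE z fa).
  exact: blaschke_algebra.
refine (eq_ind_r (fun x => _ <= Re x) _ E); rewrite !cReD {E}.
have P : 0 <= Re (z - a)^-1.
  have cz := cmod_gt0 za.
  have -> : (z - a)^-1 = ofR (cmod (z - a) ^- 2) * cconj (z - a).
    apply: (mulIf za); rewrite mulVf// -mulrA conj_mul -ofRM mulVf//.
    by rewrite expf_neq0// gt_eqF.
  by rewrite ReZ mulr_ge0 ?invr_ge0 ?sqr_ge0//= cReD cReN subr_ge0 ltW.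
have Q : `|Re (cconj a / D)| <= 3.
  apply: le_trans (normRe_le _) _; rewrite cmod_div cmod_conj ler_pdivrMr ?cmod_gt0//.
  by have := blaschke_den_lb z1; have := a1; rewrite -/D; lra.
by move: Q; rewrite ler_norml => /andP[Q _]; lra.
Qed.

End Blaschke.

(** The exponent [n] plays the role of Jensen's bound for the number of zeros. [K] is absolute: it
    depends neither on [f] nor on the position of its zeros. *)
Definition logderiv_lower (K : R) : Prop :=
  forall (n : nat) (f : C -> C) (M b : R), hol 0 2 f -> 0 < M ->
  (forall z, cmod z = 11/8 -> cmod (f z) <= M) -> M <= (11/10) ^+ n * cmod (f 0) ->
  (forall z, cmod z < 5/4 -> f z = 0 -> Re z <= b) ->
  forall z, cmod z <= 9/8 -> b < Re z -> - (K * n%:R) <= Re (cd f z / f z).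

(* Each zero is divided out by a Blaschke factor of the disc of radius 11/8,
   which multiplies [|f 0|] by at least 11/10 and adds to [f'/f] a term of
   nonnegative real part, up to a bounded error; the maximum principle bounds
   the number of steps. *)
Lemma logderiv_lower_bound : exists2 K : R, 0 < K & logderiv_lower K.
Proof.
pose K1 : R := 4 / (5/4 - 9/8) * expR (4 * (9/8) / (5/4 - 9/8)).
have K10 : 0 <= K1 by rewrite !mulr_ge0 ?expR_ge0 ?invr_ge0//; lra.
have k1 : 1 < 11/10 :> R by lra.
(* Each unit of [n] pays either for a factor 11/10 in the zero-free estimate, of Harnack constant
   [K1], or for the error 3 of one removed zero. *)
pose K := K1 * ln (11/10) + 3.
have K2 : 0 <= K1 * ln (11/10) by rewrite mulr_ge0// ln_ge0// ltW.
exists K; first by rewrite /K; lra.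
have k0 m : 0 < (11/10 : R) ^+ m by rewrite exprn_gt0//; lra.
have r2 : 0 < (11/8 : R) < 2 by apply/andP; split; lra.
have r3 : 0 < (9/8 : R) < 5/4 by apply/andP; split; lra.
have fp n (f : C -> C) (M : R) : 0 < M -> M <= (11/10) ^+ n * cmod (f 0) -> 0 < cmod (f 0).
  by move=> M0 Mf; rewrite -(pmulr_rgt0 _ (k0 n)); exact: lt_le_trans M0 Mf.
have MM (f : C -> C) (M : R) : hol 0 2 f -> (forall x, cmod x = 11/8 -> cmod (f x) <= M) ->
    forall x, cmod x <= 11/8 -> cmod (f x) <= M.
  by move=> hf fM x x1; apply: (max_modulus r2 hf); rewrite ?subr0// => y; rewrite subr0; exact: fM.
have zf n (f : C -> C) (M : R) z : hol 0 2 f -> 0 < M -> (forall z, cmod z = 11/8 -> cmod (f z) <= M) ->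
    M <= (11/10) ^+ n * cmod (f 0) -> (forall z, cmod z < 5/4 -> f z != 0) -> cmod z <= 9/8 ->
    - (K * n%:R) <= Re (cd f z / f z).
  move=> hf M0 fM Mf nz z98.
  have hf1 : hol 0 (5/4) f by apply: hol_sub hf; rewrite subrr cmod0; lra.
  have := @zero_free_logderiv f M (5/4) (9/8) r3 hf1 nz _ z z98.
  rewrite -/K1 => /(_ _)/wrap[x x1|H]; first by apply: (MM f M hf fM); lra.
  have f0 := fp n f M M0 Mf.
  have : ln M - ln (cmod (f 0)) <= ln (11/10) * n%:R.
    rewrite lerBlDr mulr_natr -lnXn; last by lra.
    by rewrite -lnM ?posrE ?k0// ler_ln ?posrE ?mulr_gt0.
  move=> /(ler_wpM2l K10)/(le_trans H); rewrite mulrA => {}H.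
  have := le_trans (normRe_le _) H; rewrite ler_norml => /andP[+ _].
  have : 0 <= n%:R :> R by [].
  by rewrite /K mulrDl; lra.
move=> n f M b; elim: n f => [|n IH] f hf M0 fM Mf fz z z98 bz.
  have [[a a1 fa]|nz] := pselect (exists2 a, cmod a < 5/4 & f a = 0); last first.
    apply: (zf 0%N f M) => // x x1; apply/eqP => fx; apply: nz; by exists x.
  (* No zero is left to remove when [n = 0]: the quotient would have modulus at least [11/10 * M] at
     0 although it is at most [M] on the circle. *)
  exfalso; have H1 := blaschke0 a1 fa.
  have := MM _ M (hol_blaschke hf a1 fa) _ 0; rewrite cmod0 => /(_ _ _)/wrap[x x1||].
  - by rewrite blaschke_circle//; exact: fM.
  - by lra.
  - by have := fp 0%N f M M0 Mf; move: Mf; rewrite expr0 mul1r; lra.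
have [[a a1 fa]|nz] := pselect (exists2 a, cmod a < 5/4 & f a = 0); last first.
  apply: (zf n.+1 f M) => // x x1; apply/eqP => fx; apply: nz; by exists x.
have fzn : f z != 0.
  by apply/eqP => E; have := fz z _ E; have : cmod z < 5/4 by [lra]; move=> h /(_ h); lra.
apply: le_trans (blaschke_logderiv hf a1 fa z98 (le_lt_trans (fz a a1 fa) bz) fzn).
have := IH (blaschke f a) (hol_blaschke hf a1 fa) M0 _ _ _ z z98 bz.
move=> /(_ _ _ _)/wrap[x x1||x x1 bx|H].
- by rewrite blaschke_circle//; exact: fM.
- apply: le_trans Mf _; rewrite exprSr -mulrA ler_wpM2l ?(ltW (k0 n))//.
  exact: blaschke0.
- by apply: fz => //; exact: blaschke_zero bx.
have : K * n.+1%:R = K * n%:R + K by rewrite -natr1 mulrDr mulr1.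
by rewrite {3}/K; lra.
Qed.

(** Harnack's inequality for [Re psi + Lam] bounds [psi'] by a constant over [rho], which is
    integrated along a segment of length at most [3/2 * rho]. The radius cancels, so small discs
    cost nothing. *)
Lemma borel_caratheodory (psi : C -> C) (z0 : C) (rho Lam : R) : 0 < rho -> hol z0 (2 * rho) psi ->
  (forall z, cmod (z - z0) < 2 * rho -> - Lam <= Re (psi z)) ->
  forall z, cmod (z - z0) <= 3/2 * rho ->
  cmod (psi z) <= cmod (psi z0) + 12 * expR 12 * (cmod (psi z0) + Lam).
Proof.
move=> rho0 hp pL z zr.
have rr : 0 < 3/2 * rho < 2 * rho by apply/andP; split; lra.
have := @harnack (fun x => Re (psi x) + Lam) (cd psi) z0 _ _ rr (hol_cd hp).
move=> /(_ _ _)/wrap[x xr|x xr|H].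
- by apply: is_cder_grad; apply/is_cder_cd/hp.
- by have := pL x xr; lra.
set B := 4 / _ * _ * _ in H.
have zz : z0 + (z - z0) = z by rewrite addrC subrK.
have z1 : cmod (z0 - z0) <= 3/2 * rho by rewrite subrr cmod0; lra.
have z2 : cmod (z0 + (z - z0) - z0) <= 3/2 * rho by rewrite zz.
have := @cder_lipschitz R psi (cd psi) z0 (z - z0) B.
rewrite zz => /(_ _ _)/wrap[t t01|t t01|E].
- apply/is_cder_cd/hp; apply: le_lt_trans (seg_disc z1 z2 t01) _; lra.
- by apply: H; exact: seg_disc.
have -> : psi z = psi z0 + (psi z - psi z0) by rewrite addrC subrK.
apply: le_trans (le_cmodD _ _) _; rewrite lerD2l; apply: le_trans E _.
have B0 : 0 <= B := le_trans (cmod_ge0 _) (H _ z1).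
apply: le_trans (ler_wpM2l B0 zr) _.
have -> : B * (3/2 * rho) = 12 * expR 12 * (Re (psi z0) + Lam).
  rewrite /B; have -> : 4 * (3/2 * rho) / (2 * rho - 3/2 * rho) = 12.
    by field; rewrite gt_eqF//; lra.
  by field; rewrite gt_eqF//; lra.
rewrite ler_wpM2l ?mulr_ge0 ?expR_ge0// lerD2r; exact: Re_le.
Qed.

End Harnack.

(** * Primes and the saddle point *)

Section Primes.
Variable R : realType.

Lemma natr_gt0 (n : nat) : (0 < n)%N -> 0 < n%:R :> R.
Proof. by rewrite ltr0n. Qed.

Lemma ln_nat_ge0 (n : nat) : 0 <= ln (n%:R : R).
Proof.
by case: n => [|n]; [rewrite ln0|rewrite ln_ge0// ler1n].
Qed.

Lemma pow_logn_gt0 (p m : nat) : (0 < p ^ logn p m)%N.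
Proof. by case: p => [|p]; [rewrite lognE|rewrite expn_gt0]. Qed.

Lemma ln_nat_logn (m n : nat) : (0 < m <= n)%N ->
  ln (m%:R : R) = \sum_(0 <= p < n.+1 | prime p) (logn p m)%:R * ln p%:R.
Proof.
move=> /andP[m0 mn].
rewrite -{1}(partnT m0) (widen_partn _ mn) natr_prod.
have -> : ln (\prod_(0 <= p < n.+1 | p \in predT) (p ^ logn p m)%:R : R) =
    \sum_(0 <= p < n.+1 | p \in predT) (logn p m)%:R * ln p%:R.
  elim: (index_iota 0 n.+1) => [|p s IH]; first by rewrite !big_nil ln1.
  rewrite !big_cons /= lnM ?posrE; last 2 first.
  - by rewrite ltr0n pow_logn_gt0.
  - by apply: prodr_gt0 => p' _; rewrite ltr0n pow_logn_gt0.
  rewrite IH; congr (_ + _); rewrite natrX.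
  have [->|p0] := posnP p; first by rewrite (lognE 0) /= expr0 ln1 mul0r.
  by rewrite lnXn ?natr_gt0// mulr_natl.
rewrite [RHS]big_mkcond [LHS]big_mkcond /=; apply: eq_bigr => p _.
by case: ifP => // np; rewrite lognE np mul0r.
Qed.

Lemma ln_fact_logn (n : nat) :
  ln (n`!%:R : R) = \sum_(0 <= p < n.+1 | prime p) (logn p n`!)%:R * ln p%:R.
Proof.
suff H N : (n <= N)%N -> ln (n`!%:R : R) = \sum_(0 <= p < N.+1 | prime p) (logn p n`!)%:R * ln p%:R.
  exact: H.
elim: n => [_|n IH nN].
  rewrite fact0 ln1 big1// => p _; by rewrite logn1 mul0r.
rewrite factS natrM lnM ?posrE ?natr_gt0 ?fact_gt0// IH 1?ltnW// (@ln_nat_logn _ N)//.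
rewrite -big_split; apply: eq_bigr => p pp /=.
by rewrite lognM ?fact_gt0// natrD mulrDl.
Qed.

Lemma geo_sum_le (x : R) (m : nat) : 1 < x -> \sum_(1 <= k < m.+1) x ^- k <= (x - 1)^-1.
Proof.
move=> x1; have x0 : 0 < x by lra.
suff -> : \sum_(1 <= k < m.+1) x ^- k = (1 - x ^- m) / (x - 1).
  rewrite ler_pdivrMr ?subr_gt0// mulVf; last by rewrite subr_eq0 gt_eqF.
  by rewrite gerBl invr_ge0 exprn_ge0// ltW.
elim: m => [|m IH]; first by rewrite big_geq// expr0 invr1 subrr mul0r.
rewrite big_nat_recr//= IH exprS; field.
by rewrite ?expf_neq0 ?subr_eq0 ?gt_eqF.
Qed.

Lemma logn_fact_le (p n : nat) : prime p -> (logn p n`!)%:R <= n%:R * (2 / p%:R) :> R.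
Proof.
move=> pp; have p2 : 2 <= p%:R :> R by rewrite ler_nat prime_gt1.
have p0 : 0 < p%:R :> R by lra.
rewrite logn_fact// natr_sum.
apply: (@le_trans _ _ (\sum_(1 <= k < n.+1) n%:R * (p%:R ^- k))).
  apply: ler_sum => k _; rewrite -natrX ler_pdivlMr ?ltr0n ?expn_gt0 ?prime_gt0//.
  by rewrite -natrM ler_nat leq_divM.
rewrite -mulr_sumr ler_wpM2l//; apply: le_trans (geo_sum_le _ _) _; first by lra.
by rewrite ler_pdivlMr// mulrC ler_pdivrMr; lra.
Qed.

Lemma logn_fact_ge (p n : nat) : prime p -> (p <= n)%N -> n%:R / (2 * p%:R) <= (logn p n`!)%:R :> R.
Proof.
move=> pp pn; have p0 : 0 < p%:R :> R by rewrite ltr0n prime_gt0.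
rewrite ler_pdivrMr ?mulr_gt0// -!natrM ler_nat logn_fact//.
have n0 : (0 < n)%N by apply: leq_trans pn; exact: prime_gt0.
rewrite big_ltn ?ltnS// expn1.
set S := (\sum_(_ <= _ < _) _)%N.
have d1 : (0 < n %/ p)%N by rewrite divn_gt0 ?prime_gt0.
have := divn_eq n p; have := ltn_pmod n (prime_gt0 pp).
set d := (n %/ p)%N in d1 *; set r := (n %% p)%N => rp ->.
by nia.
Qed.

Lemma ln_fact_ge (n : nat) : n%:R * ln (n%:R : R) - n%:R <= ln (n`!%:R : R).
Proof.
elim: n => [|n IH]; first by rewrite fact0 ln1 mul0r subrr.
rewrite factS natrM lnM ?posrE ?natr_gt0 ?fact_gt0//.
have [->|n0] := posnP n; first by rewrite fact0 !ln1; lra.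
have np : 0 < n%:R :> R by rewrite ltr0n.
have : n%:R * (ln n.+1%:R - ln n%:R) <= 1 :> R.
  rewrite -ler_pdivlMl// mulr1 -ln_div ?posrE ?natr_gt0//.
  have -> : n.+1%:R / n%:R = 1 + n%:R^-1 :> R by rewrite -natr1 mulrDl divff ?gt_eqF// mul1r.
  by apply: le_ln1Dx; have : 0 < n%:R^-1 :> R by [rewrite invr_gt0]; lra.
rewrite -natr1 mulrBr; move: IH.
set a := ln n%:R; set b := ln (n%:R + 1); set N := (n%:R : R); set f := ln _.
have -> : (N + 1) * b = N * b + b by ring.
lra.
Qed.

(** A weak Mertens estimate: n! is expanded into prime powers, each exponent is at most 2n / p, and
    the sum is compared with n ln n - n <= ln n!. *)
Lemma sum_ln_prime_ge (n : nat) : (0 < n)%N ->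
  (ln (n%:R : R) - 1) / 2 <= \sum_(0 <= p < n.+1 | prime p) ln p%:R / p%:R.
Proof.
move=> n0; have np : 0 < n%:R :> R by rewrite ltr0n.
set S := \sum_(_ <= _ < _ | _) _.
suff H : ln (n`!%:R : R) <= n%:R * 2 * S.
  have := le_trans (ln_fact_ge n) H.
  have -> : n%:R * ln n%:R - n%:R = n%:R * (ln n%:R - 1) :> R by ring.
  by rewrite -mulrA ler_pM2l//; lra.
rewrite ln_fact_logn /S mulr_sumr; apply: ler_sum => p pp.
have := ler_wpM2r (ln_nat_ge0 p) (logn_fact_le n pp).
move/le_trans; apply; rewrite le_eqVlt; apply/orP; left; apply/eqP; ring.
Qed.

(** The same expansion, now with exponents at least n / (2p) and n! <= n^n. *)
Lemma sum_ln_prime_le (n : nat) : (0 < n)%N ->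
  \sum_(0 <= p < n.+1 | prime p) ln p%:R / p%:R <= 2 * ln (n%:R : R).
Proof.
move=> n0; have np : 0 < n%:R :> R by rewrite ltr0n.
set S := \sum_(_ <= _ < _ | _) _.
have H : n%:R / 2 * S <= ln (n`!%:R : R).
  rewrite ln_fact_logn /S mulr_sumr big_nat_cond [X in _ <= X]big_nat_cond.
  apply: ler_sum => p /andP[/andP[_ pn] pp]; rewrite ltnS in pn.
  have := ler_wpM2r (ln_nat_ge0 p) (logn_fact_ge pp pn).
  apply: le_trans; rewrite le_eqVlt; apply/orP; left; apply/eqP.
  by field; rewrite pnatr_eq0 -lt0n prime_gt0.
have : ln (n`!%:R : R) <= n%:R * ln n%:R.
  suff P m : (m <= n)%N -> ln (m`!%:R : R) <= m%:R * ln n%:R by exact: P.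
  elim: m => [_|m IH mn]; first by rewrite fact0 ln1 mul0r.
  rewrite factS natrM lnM ?posrE ?natr_gt0 ?fact_gt0// -[X in _ <= X * _]natr1 mulrDl mul1r addrC.
  by apply: lerD; [apply: IH; exact: ltnW|rewrite ler_ln ?posrE ?natr_gt0// ler_nat].
move/(le_trans H); rewrite -ler_pdivlMl ?divr_gt0// => /le_trans; apply.
rewrite le_eqVlt; apply/orP; left; apply/eqP; field; exact: lt0r_neq0.
Qed.

Lemma sum_ln_prime_dvd (q n : nat) : (0 < q)%N ->
  \sum_(0 <= p < n.+1 | prime p && (p %| q)%N) ln (p%:R : R) <= ln q%:R.
Proof.
move=> q0.
have qm : (0 < q <= maxn q n)%N by rewrite q0 leq_maxl.
rewrite (ln_nat_logn qm).
apply: (@le_trans _ _ (\sum_(0 <= p < n.+1 | prime p) (logn p q)%:R * ln p%:R)).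
  rewrite big_mkcondr /=; apply: ler_sum => p pp; case: ifPn => [pq|_].
    by rewrite ler_peMl ?ln_nat_ge0// ler1n logn_gt0 mem_primes pp q0.
  by rewrite mulr_ge0 ?ln_nat_ge0.
rewrite (@big_cat_nat _ _ _ n.+1 0 (maxn q n).+1)//=; last by rewrite ltnS leq_maxr.
rewrite lerDl; apply: sumr_ge0 => p _; by rewrite mulr_ge0 ?ln_nat_ge0.
Qed.

(* [exp (t / 16) = exp (t / 176) ^ 11 >= (t / 176) ^ 11]. *)
Lemma expR_gt_pow10 (t : R) : 176 ^+ 11 <= t -> t ^+ 10 <= expR (t / 16).
Proof.
move=> t0; have tp : 0 < t by apply: lt_le_trans t0; exact: exprn_gt0.
have -> : expR (t / 16) = expR (t / 176) ^+ 11.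
  by rewrite -expRM_natl; congr expR; field.
apply: (@le_trans _ _ ((t / 176) ^+ 11)); last first.
  rewrite lerXn2r ?nnegrE ?expR_ge0 ?divr_ge0 ?ltW//.
  by have := expR_ge1Dx (t / 176); lra.
rewrite expr_div_n ler_pdivlMr ?exprn_gt0// [t ^+ 11]exprSr.
by rewrite ler_wpM2l// exprn_ge0// ltW.
Qed.

Lemma ler_sum_nat_widen (g : nat -> R) (P Q : pred nat) (m n : nat) : (forall p, 0 <= g p) ->
  (forall p, (p < n)%N -> P p -> Q p && (p < m)%N) ->
  \sum_(0 <= p < n | P p) g p <= \sum_(0 <= p < m | Q p) g p.
Proof.
move=> g0 PQ.
rewrite (big_nat_widen _ _ _ _ _ (leq_maxl n m)) [X in _ <= X](big_nat_widen _ _ _ _ _ (leq_maxr n m)).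
rewrite big_mkcond [X in _ <= X]big_mkcond; apply: ler_sum => p _.
case: ifP => [/andP[Pp pn]|_]; first by rewrite (PQ p pn Pp).
by case: ifP.
Qed.

(** With [z = y^(1/16)], remove from the sum of (log p) / p the primes below [z] and those dividing
    [q]; at least [ln y / 8] remains. Each remaining prime satisfies 1 / (p^alpha - 1) >= p^(1 -
    alpha) / p >= z^(1 - alpha) / p. *)
Lemma saddle_lower_bound (q : nat) (x y alpha : R) : (0 < q)%N -> 2 <= y -> alpha <= 1 ->
  is_saddle_point q x y alpha -> 176 ^+ 11 <= ln y -> ln q%:R <= ln y ^+ 10 ->
  expR (ln y / 16 * (1 - alpha)) * (ln y / 8) <= ln x.
Proof.
move=> q0 y2 a1 [a0 <-] ly lq.
have T2 : 16 <= 176 ^+ 11 :> R.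
  apply: (@le_trans _ _ (176 ^+ 1)); first by rewrite expr1; lra.
  by rewrite ler_weXn2l//; lra.
have y0 : 0 < y by lra.
set n := Num.truncn y; set l := ln y in ly lq *.
have l16 : 16 <= l := le_trans T2 ly.
pose z := expR (l / 16); have z0 : 0 < z := expR_gt0 _.
pose g (p : nat) : R := ln p%:R / p%:R.
have g0 p : 0 <= g p by rewrite divr_ge0// ln_nat_ge0.
have n1 : (0 < n)%N by rewrite truncn_gt0; lra.
have lnn : l - 1 <= ln n%:R.
  have ny : y / 2 <= n%:R.
    have := truncnS_gt y; rewrite -/n -natr1 => h.
    have : 1 <= n%:R :> R by rewrite ler1n.
    by lra.
  apply: (@le_trans _ _ (ln (y / 2))); last by rewrite ler_ln ?posrE ?divr_gt0// natr_gt0.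
  rewrite ln_div ?posrE//; have : ln (1 + 1) <= 1 :> R by apply: le_ln1Dx; lra.
  by rewrite -[2]/(1 + 1) -/l; lra.
have S1 := sum_ln_prime_ge n1.
have small : \sum_(0 <= p < n.+1 | prime p && (p%:R < z)) g p <= l / 8.
  pose m := Num.truncn z.
  have m0 : (0 < m)%N.
    rewrite truncn_gt0; apply: le_trans (expR_ge1Dx _); lra.
  apply: (@le_trans _ _ (\sum_(0 <= p < m.+1 | prime p) g p)); last first.
    apply: le_trans (sum_ln_prime_le m0) _.
    have -> : l / 8 = 2 * (l / 16) by field.
    rewrite ler_wpM2l// -[l / 16]expRK ler_ln ?posrE ?natr_gt0//.
    by rewrite -/z /m truncn_le ltW.
  have le_m p : p%:R < z -> (p < m.+1)%N.
    by move=> pz; rewrite ltnS /m truncn_ge_nat ltW.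
  by apply: ler_sum_nat_widen => // p _ /andP[-> /le_m].
(* Here p >= z, so these terms add up to at most (ln q) / z, and z >= (ln y)^10 >= ln q. *)
have dvd : \sum_(0 <= p < n.+1 | (prime p && ~~ (p%:R < z)) && (p %| q)%N) g p <= 1.
  have zl : l ^+ 10 <= z := expR_gt_pow10 ly.
  apply: (@le_trans _ _ (z^-1 * \sum_(0 <= p < n.+1 | prime p && (p %| q)%N) ln p%:R)); last first.
    rewrite mulrC ler_pdivrMr// mul1r.
    exact: le_trans (sum_ln_prime_dvd n q0) (le_trans lq zl).
  rewrite mulr_sumr big_mkcond [X in _ <= X]big_mkcond; apply: ler_sum => p _.
  case: (prime p) => //=; case: (p %| q)%N; rewrite ?andbT ?andbF//.
  have L0 := ln_nat_ge0 p.
  case: ifP => [|_]; last by rewrite mulr_ge0// invr_ge0 ltW.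
  rewrite -leNgt => zp; rewrite /g mulrC ler_wpM2r// lef_pV2 ?posrE//.
  exact: lt_le_trans zp.
pose S := \sum_(0 <= p < n.+1 | (prime p && ~~ (p%:R < z)) && ~~ (p %| q)%N) g p.
have SS : l / 8 <= S.
  move: S1; rewrite (bigID (fun p : nat => p%:R < z)) /=.
  rewrite [X in _ <= _ + X](bigID (fun p : nat => (p %| q)%N)) /= -/g.
  move: small dvd; rewrite /S /g => h1 h2 h3; lra.
apply: le_trans (ler_wpM2l (expR_ge0 _) SS) _.
rewrite /S mulr_sumr big_mkcond [X in _ <= X]big_mkcond; apply: ler_sum => p _.
have [pp|] := boolP (prime p) => //=.
have [pq|pq] := boolP (p %| q)%N; rewrite ?andbF ?andbT//=.
have p1 : 1 < p%:R :> R by rewrite ltr1n prime_gt1.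
have p0 : 0 < p%:R :> R by lra.
have L0 : 0 < ln (p%:R : R) by rewrite ln_gt0.
have pE : p%:R `^ alpha = expR (alpha * ln p%:R) by rewrite /powR gt_eqF.
have D0 : 0 < p%:R `^ alpha - 1.
  by rewrite pE subr_gt0 expR_gt1 mulr_gt0.
case: ifP => [|_]; last by rewrite divr_ge0// ltW.
rewrite -leNgt => zp; rewrite /g mulrCA ler_wpM2l ?(ltW L0)//.
rewrite ler_pdivrMr// [X in _ <= X]mulrC ler_pdivlMr//.
apply: (@le_trans _ _ (expR (l / 16 * (1 - alpha)) * p%:R `^ alpha)).
  by rewrite ler_wpM2l ?expR_ge0//; lra.
rewrite pE -expRD -[X in _ <= X]lnK ?posrE// ler_expR.
have zl : l / 16 <= ln p%:R by rewrite -[l / 16]expRK ler_ln ?posrE.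
have : l / 16 * (1 - alpha) <= ln p%:R * (1 - alpha) by rewrite ler_wpM2r// subr_ge0.
lra.
Qed.

End Primes.

(** * The von Mangoldt function *)

Section Arithmetic.
Variable R : realType.
Local Notation C := (Cplx R).
Local Notation Re := (@complex.Re R).
Local Notation ofR := (@ofR R).

Definition npow (s : R) (n : nat) : R := expR (- (s * ln n%:R)).

Lemma npow_ge0 s n : 0 <= npow s n. Proof. exact: expR_ge0. Qed.

Lemma npow1 s : npow s 1 = 1.
Proof. by rewrite /npow ln1 mulr0 oppr0 expR0. Qed.

Lemma npow_le1 s n : 0 <= s -> npow s n <= 1.
Proof. by move=> s0; rewrite /npow -[X in _ <= X]expR0 ler_expR oppr_le0 mulr_ge0// ln_nat_ge0. Qed.

Lemma npowD s t n : npow (s + t) n = npow s n * npow t n.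
Proof. by rewrite /npow -expRD; congr expR; ring. Qed.

Lemma npow_1V n : (0 < n)%N -> npow 1 n = n%:R^-1.
Proof. by move=> n0; rewrite /npow mul1r expRN lnK// posrE ltr0n. Qed.

Lemma npow_1D s n : (0 < n)%N -> npow (1 + s) n = npow s n / n%:R.
Proof. by move=> n0; rewrite npowD npow_1V// mulrC. Qed.

Lemma npow_antis s t n : s <= t -> npow t n <= npow s n.
Proof. by move=> st; rewrite ler_expR lerN2 ler_wpM2r// ln_nat_ge0. Qed.

Lemma npow_anti s m n : 0 <= s -> (0 < m <= n)%N -> npow s n <= npow s m.
Proof.
move=> s0 /andP[m0 mn]; rewrite ler_expR lerN2 ler_wpM2l// ler_ln ?posrE ?ltr0n ?ler_nat//.
exact: leq_trans mn.
Qed.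

Lemma npowM s m n : (0 < m)%N -> (0 < n)%N -> npow s (m * n) = npow s m * npow s n.
Proof.
by move=> m0 n0; rewrite /npow natrM lnM ?posrE ?ltr0n// mulrDr opprD expRD.
Qed.

Lemma lnS_ge n : (0 < n)%N -> n.+1%:R^-1 <= ln (n.+1%:R : R) - ln n%:R.
Proof.
move=> n0; have np : 0 < n%:R :> R by rewrite ltr0n.
have n1 : 0 < n.+1%:R :> R by rewrite ltr0n.
rewrite -opprB -ln_div ?posrE// lerNr.
have -> : n%:R / n.+1%:R = 1 + (- n.+1%:R^-1) :> R.
  by rewrite -natr1; field; rewrite natr1 pnatr_eq0.
apply: le_ln1Dx; rewrite ltrN2 invf_lt1// ltr1n//.
Qed.

Lemma lnS_le n : (0 < n)%N -> ln (n.+1%:R : R) - ln n%:R <= n%:R^-1.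
Proof.
move=> n0; have np : 0 < n%:R :> R by rewrite ltr0n.
rewrite -ln_div ?posrE ?ltr0n//.
have -> : n.+1%:R / n%:R = 1 + n%:R^-1 :> R.
  by rewrite -natr1 mulrDl divff ?gt_eqF// mul1r.
by apply: le_ln1Dx; have : 0 < n%:R^-1 :> R by [rewrite invr_gt0]; lra.
Qed.

(** This and the next lemma replace the comparison of a sum of n^(-1-s) with an integral: n^(-s) / s
    is the telescoping primitive. *)
Lemma npow_tele_ge s n : 0 < s -> (0 < n)%N ->
  s * (npow s n.+1 / n.+1%:R) <= npow s n - npow s n.+1.
Proof.
move=> s0 n0.
have -> : npow s n = npow s n.+1 * expR (s * (ln n.+1%:R - ln n%:R)).
  by rewrite /npow -expRD; congr expR; ring.
have := expR_ge1Dx (s * (ln n.+1%:R - ln n%:R)).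
have := ler_wpM2l (ltW s0) (lnS_ge n0).
set a := s * n.+1%:R^-1; set E := expR _ => h1 h2.
have -> : s * (npow s n.+1 / n.+1%:R) = npow s n.+1 * a by rewrite /a; ring.
have -> : npow s n.+1 * E - npow s n.+1 = npow s n.+1 * (E - 1) by ring.
by rewrite ler_wpM2l ?npow_ge0//; lra.
Qed.

Lemma npow_tele_le s n : 0 < s -> (0 < n)%N ->
  npow s n - npow s n.+1 <= s * (npow s n / n%:R).
Proof.
move=> s0 n0.
have -> : npow s n.+1 = npow s n * expR (- (s * (ln n.+1%:R - ln n%:R))).
  by rewrite /npow -expRD; congr expR; ring.
have := expR_ge1Dx (- (s * (ln n.+1%:R - ln n%:R))).
have := ler_wpM2l (ltW s0) (lnS_le n0).
set a := s * n%:R^-1; set E := expR _ => h1 h2.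
have -> : s * (npow s n / n%:R) = npow s n * a by rewrite /a; ring.
have -> : npow s n - npow s n * E = npow s n * (1 - E) by ring.
by rewrite ler_wpM2l ?npow_ge0//; lra.
Qed.

Lemma sum_npow_tail s m n : 0 < s -> (0 < m)%N ->
  \sum_(m <= k < n) npow s k.+1 / k.+1%:R <= npow s m / s.
Proof.
move=> s0 m0; have [mn|nm] := leqP m n; last first.
  by rewrite big_geq; [rewrite divr_ge0 ?npow_ge0 ?(ltW s0)|exact: ltnW].
suff H : \sum_(m <= k < n) npow s k.+1 / k.+1%:R <= (npow s m - npow s n) / s.
  by apply: le_trans H _; rewrite ler_pM2r ?invr_gt0// gerBl npow_ge0.
rewrite -(subnKC mn); elim: (n - m)%N => [|k IH]; first by rewrite addn0 big_geq// subrr mul0r.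
rewrite addnS big_nat_recr ?leq_addr//=.
have := @npow_tele_ge s (m + k) s0 (leq_trans m0 (leq_addr _ _)).
rewrite -ler_pdivlMl// => h; apply: le_trans (lerD IH h) _.
by rewrite le_eqVlt; apply/orP; left; apply/eqP; field; rewrite gt_eqF.
Qed.

Lemma sum_npow_le s n : 0 < s -> \sum_(1 <= k < n.+1) npow (1 + s) k <= 1 + s^-1.
Proof.
move=> s0; case: n => [|n]; first by rewrite big_geq// addr_ge0// invr_ge0 ltW.
rewrite big_ltn// npow1 lerD2l big_add1 /=.
apply: le_trans (_ : _ <= \sum_(1 <= k < n.+1) npow s k.+1 / k.+1%:R) _.
  by apply: ler_sum => k _; rewrite npow_1D.
by apply: le_trans (sum_npow_tail _ s0 _) _; rewrite ?npow1 ?mul1r.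
Qed.

Lemma sum_npow_ge s n : 0 < s -> (1 - npow s n.+1) / s <= \sum_(1 <= k < n.+1) npow (1 + s) k.
Proof.
move=> s0; elim: n => [|n IH]; first by rewrite npow1 subrr mul0r big_geq.
rewrite big_nat_recr//= npow_1D//.
have := @npow_tele_le s n.+1 s0 isT; rewrite -ler_pdivrMl// => h.
apply: le_trans (lerD IH h).
by rewrite le_eqVlt; apply/orP; left; apply/eqP; field; rewrite gt_eqF.
Qed.

Lemma ln_npow_le s n : 0 < s -> ln n%:R * npow (1 + s) n <= 2 / s * npow (1 + s / 2) n.
Proof.
move=> s0.
have -> : npow (1 + s) n = npow (1 + s / 2) n * npow (s / 2) n.
  by rewrite -npowD -addrA -splitr.
rewrite mulrCA mulrC ler_wpM2r ?npow_ge0//.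
rewrite /npow expRN ler_pdivrMr ?expR_gt0//.
have := expR_ge1Dx (s / 2 * ln n%:R); set E := expR _ => h.
rewrite -ler_pdivrMl ?divr_gt0// invf_div; lra.
Qed.

Lemma npow_small s (e : R) : 0 < s -> 0 < e ->
  exists N0 : nat, forall N, (N0 <= N)%N -> npow s N <= e.
Proof.
move=> s0 e0; exists (Num.truncn (expR (- ln e / s))).+1 => N NN.
rewrite /npow -[X in _ <= X]lnK ?posrE// ler_expR lerNl mulrC -ler_pdivrMr//.
rewrite -[X in X <= _]expRK ler_ln ?posrE ?expR_gt0//.
  apply: ltW; apply: lt_le_trans (truncnS_gt _) _; by rewrite ler_nat.
by rewrite ltr0n; exact: leq_trans NN.
Qed.

(* Truncated von Mangoldt function: [ln p] at the prime powers [p ^ k] with [p, k <= N]. *)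
Definition mangoldt (N d : nat) : R :=
  \sum_(0 <= p < N.+1 | prime p) \sum_(1 <= k < N.+1) (if d == (p ^ k)%N then ln p%:R else 0).

Lemma mangoldt_ge0 N d : 0 <= mangoldt N d.
Proof. by apply: sumr_ge0 => p _; apply: sumr_ge0 => k _; case: ifP => // _; exact: ln_nat_ge0. Qed.

(** The n-th coefficient of the product of the truncated series of the von Mangoldt function and of
    zeta. It is [ln n] while [n <= N], and beyond that lies between 0 and [ln n]. *)
Definition mangoldt_div (N n : nat) : R :=
  \sum_(1 <= d < N.+1) (if (d %| n)%N && (n %/ d <= N)%N then mangoldt N d else 0).

Lemma sum_if_eq (V : nmodType) (a b c : nat) (g : nat -> V) :
  \sum_(a <= n < b) (if n == c then g n else 0) = if (a <= c < b)%N then g c else 0.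
Proof.
case: ifP => [cab|cab].
  rewrite (big_rem c) ?mem_index_iota//= eqxx big1_seq ?addr0// => n /= nr.
  case: eqP => // nc; move: nr; rewrite nc mem_rem_uniqF//; exact: iota_uniq.
rewrite big_nat big1// => n nab; case: eqP => // nc; by rewrite -nc nab in cab.
Qed.

Lemma sum_leq_nat (N L : nat) : \sum_(1 <= k < N.+1) (if (k <= L)%N then 1 else 0 : R) = (minn N L)%:R.
Proof.
elim: N => [|N IH]; first by rewrite big_geq// min0n.
rewrite big_nat_recr//= IH; case: (leqP N.+1 L) => h.
  by rewrite (minn_idPl (ltnW h)) natr1.
by rewrite addr0 (minn_idPr _).
Qed.

Lemma mangoldt_div_expand N n : mangoldt_div N n =
  \sum_(0 <= p < N.+1 | prime p) \sum_(1 <= k < N.+1)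
    (if [&& (p ^ k <= N)%N, (p ^ k %| n)%N & (n %/ p ^ k <= N)%N] then ln p%:R else 0).
Proof.
transitivity (\sum_(1 <= d < N.+1) \sum_(0 <= p < N.+1 | prime p) \sum_(1 <= k < N.+1)
   (if d == (p ^ k)%N then (if (d %| n)%N && (n %/ d <= N)%N then ln p%:R else 0 : R) else 0)).
  apply: eq_bigr => d _; case: ifP => _; first by [].
  rewrite big1// => p _; rewrite big1// => k _; by case: ifP.
rewrite exchange_big /=; apply: eq_bigr => p pp; rewrite exchange_big /=; apply: eq_bigr => k _.
rewrite (sum_if_eq 1 N.+1 (p ^ k) (fun d => if (d %| n)%N && (n %/ d <= N)%N then ln p%:R else 0 : R)).
rewrite expn_gt0 prime_gt0//= ltnS; by case: (p ^ k <= N)%N.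
Qed.

Lemma mangoldt_div_ge0 N n : 0 <= mangoldt_div N n.
Proof. by apply: sumr_ge0 => d _; case: ifP => // _; exact: mangoldt_ge0. Qed.

Lemma mangoldt_div_le N n : (0 < n)%N -> mangoldt_div N n <= ln n%:R.
Proof.
move=> n0; rewrite mangoldt_div_expand.
have nm : (0 < n <= maxn n N)%N by rewrite n0 leq_maxl.
rewrite (ln_nat_logn R nm).
apply: (@le_trans _ _ (\sum_(0 <= p < N.+1 | prime p) (logn p n)%:R * ln p%:R)).
  apply: ler_sum => p pp; apply: (@le_trans _ _ ((minn N (logn p n))%:R * ln p%:R)).
    rewrite -sum_leq_nat mulr_suml; apply: ler_sum => k _.
    case: ifP => [/and3P[_ h _]|_]; last by case: ifP => _; rewrite ?mul1r ?mul0r ?ln_nat_ge0.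
    by rewrite -pfactor_dvdn// h mul1r.
  by rewrite ler_wpM2r ?ln_nat_ge0// ler_nat geq_minr.
rewrite (@big_cat_nat _ _ _ N.+1 0 (maxn n N).+1)//=; last by rewrite ltnS leq_maxr.
rewrite lerDl; apply: sumr_ge0 => p _; by rewrite mulr_ge0 ?ln_nat_ge0.
Qed.

Lemma mangoldt_div_eq N n : (0 < n <= N)%N -> mangoldt_div N n = ln n%:R.
Proof.
move=> /andP[n0 nN]; rewrite mangoldt_div_expand.
rewrite (@ln_nat_logn R n N) ?n0//; apply: eq_bigr => p pp.
have lN : (logn p n <= N)%N.
  apply: leq_trans nN; apply: ltnW; apply: leq_trans (ltn_expl _ (prime_gt1 pp)) _.
  by apply: dvdn_leq => //; exact: pfactor_dvdnn.
rewrite -[X in X%:R * _](minn_idPr lN) -sum_leq_nat mulr_suml; apply: eq_bigr => k _.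
rewrite -pfactor_dvdn//.
have [h|h] := boolP (p ^ k %| n)%N; last by rewrite andbF mul0r.
rewrite (leq_trans (dvdn_leq n0 h) nN) (leq_trans (leq_div _ _) nN)// mul1r//.
Qed.

Lemma dirichlet_product (N : nat) (f : nat -> C) :
  (forall m n, (0 < m)%N -> (0 < n)%N -> f (m * n)%N = f m * f n) ->
  (\sum_(1 <= d < N.+1) ofR (mangoldt N d) * f d) * (\sum_(1 <= m < N.+1) f m) =
  \sum_(1 <= n < (N * N).+1) f n * ofR (mangoldt_div N n).
Proof.
move=> fM; rewrite mulr_suml.
transitivity (\sum_(1 <= d < N.+1) \sum_(1 <= n < (N * N).+1)
   (if (d %| n)%N && (n %/ d <= N)%N then f n * ofR (mangoldt N d) else 0)).
  apply: eq_big_nat => d /andP[d0 dN]; rewrite ltnS in dN; rewrite mulr_sumr.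
  transitivity (\sum_(1 <= m < N.+1) \sum_(1 <= n < (N * N).+1)
     (if n == (d * m)%N then f n * ofR (mangoldt N d) else 0)).
    apply: eq_big_nat => m /andP[m0 mN]; rewrite ltnS in mN.
    rewrite (sum_if_eq 1 (N * N).+1 (d * m) (fun n => f n * ofR (mangoldt N d))).
    rewrite ltnS muln_gt0 d0 m0 leq_mul//= fM//; ring.
  rewrite exchange_big /=; apply: eq_big_nat => n /andP[n0 _].
  transitivity (\sum_(1 <= m < N.+1) (if m == (n %/ d)%N then
      (if (d %| n)%N then f n * ofR (mangoldt N d) else 0) else 0)).
    apply: eq_big_nat => m _.
    have [dn|dn] := boolP (d %| n)%N.
      rewrite -{1}(divnK dn) mulnC eqn_pmul2l// eq_sym.
      by case: eqP => // ->.
    case: eqP => [E|_]; last by case: ifP.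
    by rewrite E dvdn_mulr in dn.
  rewrite (sum_if_eq 1 N.+1 (n %/ d) (fun _ => if (d %| n)%N then f n * ofR (mangoldt N d) else 0)).
  rewrite ltnS; have [dn|dn] := boolP (d %| n)%N; last by case: ifP.
  by rewrite divn_gt0// (dvdn_leq n0 dn).
rewrite exchange_big /=; apply: eq_bigr => n _.
rewrite /mangoldt_div (big_morph ofR (@ofRD R) (@ofR0 R)) mulr_sumr.
by apply: eq_bigr => d _; case: ifP => //; rewrite ofR0 mulr0.
Qed.

(** The bound -zeta'/zeta(1 + s) << 1/s without dividing series: the truncated product is at most 6
    / s^2, and the truncated zeta factor is at least 1 / (2s) once [N] is large in terms of [s]. *)
Lemma mangoldt_series_le (N : nat) (s : R) : 0 < s <= 1 -> npow s N.+1 <= 2^-1 ->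
  \sum_(1 <= d < N.+1) mangoldt N d * npow (1 + s) d <= 12 / s.
Proof.
move=> /andP[s0 s1] sN.
have := @dirichlet_product N (fun n => ofR (npow (1 + s) n)) _.
move=> /(_ _)/wrap[m n m0 n0|]; first by rewrite -ofRM npowM.
under eq_bigr do rewrite -ofRM.
rewrite -!(big_morph ofR (@ofRD R) (@ofR0 R)) -ofRM.
under [X in _ = X]eq_bigr do rewrite -ofRM.
rewrite -(big_morph ofR (@ofRD R) (@ofR0 R)) => /ofR_inj.
set Z := \sum_(_ <= _ < _) _; set W := \sum_(_ <= _ < _) npow _ _; set T := \sum_(_ <= _ < _) _ => E.
have Z0 : 0 <= Z by apply: sumr_ge0 => d _; rewrite mulr_ge0 ?mangoldt_ge0 ?npow_ge0.
have W1 : (2 * s)^-1 <= W.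
  apply: le_trans (sum_npow_ge N s0).
  have -> : (2 * s)^-1 = 2^-1 / s by field; rewrite gt_eqF.
  by rewrite ler_pM2r ?invr_gt0//; lra.
have T1 : T <= 6 / s ^+ 2.
  apply: (@le_trans _ _ (\sum_(1 <= n < (N * N).+1) 2 / s * npow (1 + s / 2) n)).
    rewrite /T big_nat [X in _ <= X]big_nat; apply: ler_sum => n /andP[n0 _].
    apply: le_trans (ln_npow_le n s0); rewrite mulrC ler_wpM2r ?npow_ge0//.
    exact: mangoldt_div_le.
  have s2 : 0 < s / 2 by rewrite divr_gt0.
  rewrite -mulr_sumr; have := sum_npow_le (N * N) s2.
  have s2' : 0 <= 2 / s by rewrite divr_ge0// ltW.
  move=> /(ler_wpM2l s2')/le_trans; apply.
  have -> : 6 / s ^+ 2 = 2 / s * (3 / s) by field; rewrite gt_eqF.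
  rewrite ler_wpM2l// invf_div.
  have : 1 <= s^-1 by rewrite invf_ge1.
  lra.
have : Z * (2 * s)^-1 <= 6 / s ^+ 2 by apply: le_trans T1; rewrite -E ler_wpM2l.
rewrite ler_pdivrMr ?mulr_gt0// => /le_trans; apply.
by rewrite le_eqVlt; apply/orP; left; apply/eqP; field; rewrite gt_eqF.
Qed.

(** The product of two sums up to [N] agrees with the series of [ln n] only up to [N]; this controls
    the excess coefficients up to [N * N]. *)
Lemma mangoldt_tail_small (s e : R) : 0 < s -> 0 < e -> exists N0 : nat, forall N, (N0 <= N)%N ->
  \sum_(N.+1 <= n < (N * N).+1) npow (1 + s) n * ln n%:R <= e.
Proof.
move=> s0 e0; have s2 : 0 < s / 2 by rewrite divr_gt0.
have e1 : 0 < e / ((2 / s) * (2 / s)) by rewrite divr_gt0// mulr_gt0// divr_gt0.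
have [N0 HN] := npow_small s2 e1; exists N0.+1 => N NN.
apply: (@le_trans _ _ (2 / s * \sum_(N <= n < N * N) npow (s / 2) n.+1 / n.+1%:R)).
  rewrite big_add1 /= mulr_sumr; apply: ler_sum => n _.
  by rewrite mulrC; apply: le_trans (ln_npow_le _ s0) _; rewrite npow_1D.
have N0' : (0 < N)%N by exact: leq_trans NN.
have := sum_npow_tail (N * N) s2 N0'.
have s2' : 0 <= 2 / s by rewrite divr_ge0// ltW.
move=> /(ler_wpM2l s2')/le_trans; apply.
have ss : 0 < 2 / s * (2 / s) by rewrite mulr_gt0// divr_gt0.
have := HN N (ltnW NN); rewrite ler_pdivlMr// => h; apply: le_trans h.
by rewrite le_eqVlt; apply/orP; left; apply/eqP; field; rewrite gt_eqF.
Qed.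

End Arithmetic.

(** * Dirichlet L-functions *)

Section LFunction.
Variable R : realType.
Local Notation C := (Cplx R).
Local Notation Re := (@complex.Re R).
Local Notation Im := (@complex.Im R).
Local Notation ofR := (@ofR R).

Lemma le_cmod_sum_nat (a b : nat) (F : nat -> C) :
  cmod (\sum_(a <= n < b) F n) <= \sum_(a <= n < b) cmod (F n).
Proof.
elim/big_ind2: _ => [|z x w y zx wy|//]; first by rewrite cmod0.
exact: le_trans (le_cmodD _ _) (lerD zx wy).
Qed.

Definition cpow (n : nat) (s : C) : C := cexp (- (ofR (ln n%:R) * s)).

Lemma nat_cpowNE n (s : C) : nat_cpowN n s = cpow n s.
Proof.
rewrite /nat_cpowN /cpow /cexp cReN cImN ReZ ImZ ![ln _ * _]mulrC cosN sinN.
by apply: complexP; rewrite /= ?mulrN.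
Qed.

Lemma cmod_cpow n s : cmod (cpow n s) = npow (Re s) n.
Proof. by rewrite cmod_cexp cReN ReZ mulrC. Qed.

Lemma cpowM m n s : (0 < m)%N -> (0 < n)%N -> cpow (m * n) s = cpow m s * cpow n s.
Proof.
move=> m0 n0; rewrite /cpow -cexpD natrM lnM ?posrE ?ltr0n// ofRD.
by congr cexp; ring.
Qed.

Lemma is_cder_cpow n s : is_cder (cpow n) s (- (ofR (ln n%:R) * cpow n s)).
Proof.
have := @is_cder_comp R (@cexp R) (fun x => - ofR (ln n%:R) * x) s _ _
  (is_cderZ (- ofR (ln n%:R)) (is_cder_id s)) (is_cder_cexp _).
under eq_fun do rewrite mulNr.
by move/is_cder_eq; apply; rewrite /cpow mulNr; ring.
Qed.

(** The exponential is Lipschitz on the segment between the two exponents, where its modulus is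
    largest at the [n] end because [Re s] is nonnegative. *)
Lemma cpow_diff n s : (0 < n)%N -> 0 <= Re s ->
  cmod (cpow n s - cpow n.+1 s) <= cmod s * (npow (Re s) n / n%:R).
Proof.
move=> n0 s0; pose d := ln (n.+1%:R : R) - ln n%:R.
have d0 : 0 <= d by rewrite subr_ge0 ler_ln ?posrE ?ltr0n// ler_nat.
have := @cder_lipschitz R (@cexp R) (@cexp R) (- (ofR (ln n%:R) * s)) (- (ofR d * s)) (npow (Re s) n).
move=> /(_ _ _)/wrap[t _|t /andP[t0 _]|].
- exact: is_cder_cexp.
- rewrite cmod_cexp cReD cReN ReZ ReZ cReN ReZ /npow ler_expR.
  have : 0 <= t * (d * Re s) by rewrite !mulr_ge0.
  lra.
rewrite cmodB cmodN cmodM cmod_ofR ger0_norm//.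
have -> : - (ofR (ln n%:R) * s) + - (ofR d * s) = - (ofR (ln n.+1%:R) * s).
  by rewrite /d ofRB; ring.
move=> /le_trans; apply.
have -> : cmod s * (npow (Re s) n / n%:R) = npow (Re s) n * (n%:R^-1 * cmod s) by ring.
by rewrite ler_wpM2l ?npow_ge0// ler_wpM2r ?cmod_ge0// lnS_le.
Qed.

Lemma logderiv_algebra (a b c v d : C) : a = (a - d) + (d + v * c) + v * (b - c) - v * b.
Proof. by ring. Qed.

(** * Character sums and partial sums of the Dirichlet series *)

Section Character.
Variables (q : nat) (chi : nat -> C).
Hypotheses (q1 : (1 < q)%N) (hchi : is_dirichlet_character q chi)
  (chi_np : chi <> principal_character R q).

Let q0 : (0 < q)%N. Proof. exact: ltnW. Qed.

Lemma charM m n : chi (m * n)%N = chi m * chi n.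
Proof. by have [_ _ h _] := hchi. Qed.

Lemma char1 : chi 1%N = 1. Proof. by have [_ h _ _] := hchi. Qed.

Lemma char_addM n k : chi (n + k * q)%N = chi n.
Proof.
have [h _ _ _] := hchi; elim: k => [|k IH]; first by rewrite mul0n addn0.
by rewrite mulSn addnCA addnC h.
Qed.

Lemma char_mod n : chi (n %% q)%N = chi n.
Proof. by rewrite {2}(divn_eq n q) addnC char_addM. Qed.

Lemma char_eq0 n : ~~ coprime n q -> chi n = 0.
Proof. by have [_ _ _ h] := hchi; rewrite -h negbK => /eqP. Qed.

Lemma charX n k : chi (n ^ k)%N = chi n ^+ k.
Proof. by elim: k => [|k IH]; rewrite ?expn0 ?char1// expnS exprS charM IH. Qed.

(** By Euler's theorem the nonzero values of [chi] are roots of unity of order dividing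
    [totient q]. *)
Lemma cmod_char_le1 n : cmod (chi n) <= 1.
Proof.
have [co|/char_eq0 ->] := boolP (coprime n q); last by rewrite cmod0.
have E : chi n ^+ totient q = 1.
  rewrite -charX -char_mod; have := cyclic.Euler_exp_totient co => ->.
  by rewrite char_mod char1.
have t0 : (0 < totient q)%N by rewrite totient_gt0.
have : cmod (chi n) ^+ totient q = 1 by rewrite -cmodX E cmod1.
move/eqP; rewrite pexpr_eq1 ?cmod_ge0// => /eqP ->; exact: lexx.
Qed.

Lemma char_nontrivial : exists2 a, coprime a q & chi a != 1.
Proof.
apply: contrapT => H; apply: chi_np; apply/funext => n; rewrite /principal_character.
have [co|/char_eq0 ->//] := boolP (coprime n q).
by apply/eqP/negPn/negP => h; apply: H; exists n.
Qed.

(** Multiplication by some [a] with [chi a != 1] permutes the residues and multiplies the sum by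
    [chi a]. *)
Lemma char_sum_period : \sum_(0 <= n < q) chi n = 0.
Proof.
have [a co a1] := char_nontrivial.
rewrite big_mkord; set S := \sum_(i < q) chi i.
pose h (i : 'I_q) : 'I_q := Ordinal (ltn_pmod (a * i) q0).
have hinj : injective h.
  suff W (i j : 'I_q) : (i <= j)%N -> h i = h j -> i = j.
    move=> i j; case: (leqP i j) => [ij|/ltnW ji] E; first exact: W.
    by apply/esym/W.
  move=> ij /(congr1 val) /= E; apply: val_inj; apply/eqP; rewrite eqn_leq ij /=.
  have : (q %| a * j - a * i)%N by rewrite -eqn_mod_dvd ?leq_mul// E.
  rewrite -mulnBr Gauss_dvdr; last by rewrite coprime_sym.
  have [/eqP|p /dvdn_leq] := posnP (j - i)%N; first by rewrite subn_eq0.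
  move=> /(_ p); rewrite leqNgt => /negP[]; apply: leq_ltn_trans (ltn_ord j).
  exact: leq_subr.
have E : S = chi a * S.
  rewrite [LHS](reindex_inj hinj) /= mulr_sumr; apply: eq_bigr => i _.
  by rewrite char_mod charM.
apply/eqP; have : (1 - chi a) * S == 0 by rewrite mulrBl mul1r -E subrr.
by rewrite mulf_eq0 subr_eq0 eq_sym (negbTE a1).
Qed.

Lemma char_psum_le N : cmod (\sum_(0 <= n < N) chi n) <= q%:R.
Proof.
elim/ltn_ind: N => N IH; have [Nq|qN] := ltnP N q.
  apply: le_trans (le_cmod_sum_nat _ _ _) _.
  apply: (@le_trans _ _ (\sum_(0 <= n < N) 1)); first by apply: ler_sum => n _; exact: cmod_char_le1.
  by rewrite sumr_const_nat subn0 ler_nat ltnW.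
rewrite (@big_cat_nat _ _ _ q)//= char_sum_period add0r.
rewrite -{1}(add0n q) -(subnK qN) big_addn addnK.
rewrite (eq_bigr chi); last by move=> n _; rewrite -{1}(mul1n q) char_addM.
by apply: IH; rewrite ltn_subrL q0 (leq_trans q0 qN).
Qed.

Definition csum (N : nat) : C := \sum_(1 <= n < N.+1) chi n.

Lemma csum_le N : cmod (csum N) <= q%:R.
Proof.
have := char_psum_le N.+1; rewrite big_ltn// char_eq0 ?add0r//.
by rewrite /coprime gcd0n gtn_eqF.
Qed.

Definition dsum (N : nat) (s : C) : C := \sum_(1 <= n < N.+1) chi n * cpow n s.

Lemma abel_summation (s : C) M N : (M <= N)%N ->
  dsum N s - dsum M s = csum N * cpow N.+1 s - csum M * cpow M.+1 s
    + \sum_(M <= n < N) csum n.+1 * (cpow n.+1 s - cpow n.+2 s).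
Proof.
move=> MN; rewrite -(subnKC MN); elim: (N - M)%N => [|k IH].
  by rewrite addn0 !subrr big_geq// addr0.
rewrite addnS [X in _ = _ + X]big_nat_recr ?leq_addr//=.
have -> : dsum (M + k).+1 s = dsum (M + k) s + chi (M + k).+1 * cpow (M + k).+1 s.
  by rewrite /dsum big_nat_recr.
have -> : csum (M + k).+1 = csum (M + k) + chi (M + k).+1 by rewrite /csum big_nat_recr.
rewrite addrAC IH.
move: (csum _) (csum M) (cpow _ _) (cpow _ _) (cpow _ _) (chi _) (\sum_(_ <= _ < _) _) => *; ring.
Qed.

Lemma csum_diff_le (s : C) M N : 0 <= Re s ->
  cmod (\sum_(M <= n < N) csum n.+1 * (cpow n.+1 s - cpow n.+2 s)) <=
  q%:R * (cmod s * \sum_(M <= n < N) npow (Re s) n.+1 / n.+1%:R).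
Proof.
move=> s0; apply: le_trans (le_cmod_sum_nat _ _ _) _; rewrite !mulr_sumr; apply: ler_sum => n _.
by rewrite cmodM ler_pM ?cmod_ge0 ?csum_le// cpow_diff.
Qed.

(** Valid for all [Re s > 0]: summation by parts uses only that the character sums are bounded by
    [q]. It is the source of the growth bound for the continuation. *)
Lemma dsum_le (s : C) N : 0 < Re s -> cmod (dsum N s) <= q%:R * (1 + cmod s * (1 + (Re s)^-1)).
Proof.
move=> s0; have := @abel_summation s 0%N N (leq0n N).
rewrite {2}/dsum big_geq// subr0 {2}/csum big_geq// mul0r subr0 => ->.
apply: le_trans (le_cmodD _ _) _; rewrite mulrDr mulr1; apply: lerD.
  rewrite cmodM -[X in _ <= X]mulr1 ler_pM ?cmod_ge0 ?csum_le// cmod_cpow.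
  by apply: npow_le1; exact: ltW.
apply: le_trans (csum_diff_le _ _ (ltW s0)) _; rewrite !ler_wpM2l ?cmod_ge0//.
have := sum_npow_le N s0; rewrite big_add1 /=; apply: le_trans.
by apply: ler_sum => n _; rewrite npow_1D.
Qed.

Lemma dsum_tail (s : C) M N : 0 < Re s -> (0 < M <= N)%N ->
  cmod (dsum N s - dsum M s) <= q%:R * (npow (Re s) M * (2 + cmod s / Re s)).
Proof.
move=> s0 /andP[M0 MN]; rewrite abel_summation//.
have E k : (M <= k)%N -> cmod (csum k * cpow k.+1 s) <= q%:R * npow (Re s) M.
  move=> Mk; rewrite cmodM ler_pM ?cmod_ge0 ?csum_le// cmod_cpow npow_anti ?(ltW s0)//.
  by rewrite M0 leqW.
apply: le_trans (le_cmodD _ _) _.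
apply: le_trans (lerD (le_cmodB _ _) (csum_diff_le _ _ (ltW s0))) _.
have := sum_npow_tail N s0 M0.
move=> /(ler_wpM2l (cmod_ge0 s))/(ler_wpM2l (ler0n R q)) => h.
apply: le_trans (lerD (lerD (E N MN) (E M (leqnn M))) h) _.
rewrite le_eqVlt; apply/orP; left; apply/eqP; field; exact: lt0r_neq0.
Qed.

(** * The continued L-function *)

Section Continuation.
Variable F : C -> C.
Hypothesis hF : is_dirichlet_L q chi F.

Lemma is_cder_F s : is_cder F s (cd F s).
Proof. by apply: derivable_is_cder; have [h _] := hF; apply: h; right. Qed.

Lemma F_approx (s : C) (e : R) : 1 < Re s -> 0 < e ->
  exists N0 : nat, forall N, (N0 <= N)%N -> cmod (F s - dsum N s) <= e.
Proof.
move=> s1 e0; have [_ /(_ s s1)] := hF.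
move=> /cvgrPdist_le /(_ (ofR e)).
rewrite -ofR0 ltcR => /(_ e0)[N0 _ HN]; exists N0 => N NN.
have := HN N NN; rewrite /= normC_cmod -/(ofR _) lecR /series /=.
rewrite /dsum big_add1 /=.
by under eq_bigr do rewrite nat_cpowNE.
Qed.

Lemma F_tail (s : C) M : 1 < Re s -> (0 < M)%N ->
  cmod (F s - dsum M s) <= q%:R * (npow (Re s) M * (2 + cmod s / Re s)).
Proof.
move=> s1 M0; apply/ler_addgt0Pr => e e0; have [N0 HN] := F_approx s1 e0.
pose N := maxn N0 M.
have -> : F s - dsum M s = (dsum N s - dsum M s) + (F s - dsum N s) by ring.
apply: le_trans (le_cmodD _ _) _; apply: lerD; last by apply: HN; rewrite leq_maxl.
by apply: dsum_tail; [lra|rewrite M0 leq_maxr].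
Qed.

Lemma F_tail1 (s : C) (N : nat) : 1 < Re s -> (0 < N)%N ->
  cmod (F s - dsum N s) <= q%:R * (2 + cmod s) / N%:R.
Proof.
move=> s1 N0; apply: le_trans (F_tail s1 N0) _; rewrite -mulrA ler_wpM2l//.
rewrite mulrC; have N0' : 0 < N%:R :> R by rewrite ltr0n.
apply: ler_pM; rewrite ?npow_ge0//.
- by rewrite addr_ge0// divr_ge0 ?cmod_ge0//; lra.
- by rewrite lerD2l ler_pdivrMr; [rewrite ler_peMr ?cmod_ge0// ltW|lra].
- by rewrite -npow_1V//; apply: npow_antis; exact: ltW.
Qed.

Lemma is_cder_dsum N s : is_cder (dsum N) s (\sum_(1 <= n < N.+1) chi n * (- (ofR (ln n%:R) * cpow n s))).
Proof.
rewrite big_add1 big_mkord (_ : dsum N = fun x => \sum_(i < N) chi i.+1 * cpow i.+1 x).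
  by apply: is_cder_sum => i; apply: is_cderZ; exact: is_cder_cpow.
by apply/funext => x; rewrite /dsum big_add1 big_mkord.
Qed.

(* The maximum principle for the product of the four rotations of [H] about [c]:
   on the circle one of the four factors is evaluated in [Re z > 1]. *)
Lemma rotation_max (H : C -> C) (c : C) (M e : R) : (forall z, exists d, is_cder H z d) ->
  5/8 <= Re c -> 0 <= M -> 0 <= e ->
  (forall z, cmod (z - c) = 3/5 -> cmod (H z) <= M) ->
  (forall z, cmod (z - c) = 3/5 -> 1 < Re z -> cmod (H z) <= e) ->
  cmod (H c) ^+ 4 <= M ^+ 3 * e.
Proof.
move=> hH c58 M0 e0 HM He.
pose K k z := H (c + k * z).
have hK k : hol 0 1 (K k).
  move=> z _; have [d D] := hH (c + k * z); eexists.
  apply: (is_cder_comp (g := fun z => c + k * z)); last exact: D.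
  by apply: is_cderD; [exact: is_cder_cst|apply: is_cderZ; exact: is_cder_id].
pose P z := (K 1 z * K 'i z) * (K (- 1) z * K (- 'i) z).
have hP : hol 0 1 P by apply: holM; apply: holM.
have r1 : 0 < (3/5 : R) < 1 by apply/andP; split; lra.
have i1 : cmod ('i : C) = 1 by rewrite /cmod /= expr0n expr1n add0r sqrtr1.
have := max_modulus (M := M ^+ 3 * e) r1 hP; move=> /(_ _ 0)/wrap[z|].
  rewrite subr0 => z35.
  have KM k : cmod k = 1 -> cmod (K k z) <= M.
    by move=> k1; apply: HM; rewrite addrCK cmodM k1 mul1r.
  have Ke k : cmod k = 1 -> 1 < Re (c + k * z) -> cmod (K k z) <= e.
    by move=> k1 h; apply: He => //; rewrite addrCK cmodM k1 mul1r.
  have m1 := KM 1 (@cmod1 R); have m2 := KM 'i i1.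
  have m3 : cmod (K (- 1) z) <= M by apply: KM; rewrite cmodN cmod1.
  have m4 : cmod (K (- 'i) z) <= M by apply: KM; rewrite cmodN.
  have e1 := Ke 1 (@cmod1 R); have e2 := Ke 'i i1.
  have e3 : 1 < Re (c + - 1 * z) -> cmod (K (- 1) z) <= e by apply: Ke; rewrite cmodN cmod1.
  have e4 : 1 < Re (c + - 'i * z) -> cmod (K (- 'i) z) <= e by apply: Ke; rewrite cmodN.
  have ab : Re z ^+ 2 + Im z ^+ 2 = 9/25 by rewrite -sqr_cmod z35; field.
  move: e1 e2 e3 e4; rewrite !(cReD, cReM, cReN, cImN) /= => e1 e2 e3 e4.
  rewrite /P !cmodM.
  move: m1 m2 m3 m4 e1 e2 e3 e4 (cmod_ge0 (K 1 z)) (cmod_ge0 (K 'i z)) (cmod_ge0 (K (- 1) z)) (cmod_ge0 (K (- 'i) z)).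
  move: (cmod (K 1 z)) (cmod (K 'i z)) (cmod (K (- 1) z)) (cmod (K (- 'i) z)) => x1 x2 x3 x4 m1 m2 m3 m4 e1 e2 e3 e4 p1 p2 p3 p4.
  have P4 (u1 u2 u3 u4 : R) : 0 <= u1 -> 0 <= u2 -> 0 <= u3 -> 0 <= u4 -> u1 <= e -> u2 <= M ->
      u3 <= M -> u4 <= M -> u1 * u2 * u3 * u4 <= M ^+ 3 * e.
    move=> *; have -> : M ^+ 3 * e = e * M * M * M by ring.
    by do 3! (apply: ler_pM; rewrite ?mulr_ge0//).
  have -> : x1 * x2 * (x3 * x4) = x1 * x2 * x3 * x4 by ring.
  (* On the circle of radius 3/5 one of [Re z], [Im z] has absolute value at least 21/50, since 2
     (21/50)^2 < (3/5)^2; and 5/8 + 21/50 > 1. *)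
  have [a1|a1] := lerP (21/50) (Re z); first by apply: P4 => //; apply: e1; lra.
  have [a2|a2] := lerP (21/50) (- Re z).
    have -> : x1 * x2 * x3 * x4 = x3 * x1 * x2 * x4 by ring.
    by apply: P4 => //; apply: e3; lra.
  have [b1|b1] := lerP (21/50) (Im z).
    have -> : x1 * x2 * x3 * x4 = x4 * x1 * x2 * x3 by ring.
    by apply: P4 => //; apply: e4; lra.
  have [b2|b2] := lerP (21/50) (- Im z).
    have -> : x1 * x2 * x3 * x4 = x2 * x1 * x3 * x4 by ring.
    by apply: P4 => //; apply: e2; lra.
  exfalso; nra.
rewrite subrr cmod0 => /(_ _)/wrap[|]; first by lra.
rewrite /P /K !mulr0 !addr0 !cmodM => h; apply: le_trans h.
by rewrite le_eqVlt; apply/orP; left; apply/eqP; ring.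
Qed.

(** The partial sums tend to [F] with error O(1/N) for [Re s > 1] and stay bounded for [Re s > 0].
    [rotation_max] carries the convergence to [c], where [F] then inherits [dsum_le]; the factor is
    13/5 = 1 + 8/5. *)
Lemma F_le (c : C) : 5/8 <= Re c -> cmod (F c) <= q%:R * (1 + 13/5 * cmod c).
Proof.
move=> c58.
have hFc : hol c 1 F by move=> z _; eexists; exact: is_cder_F.
have r1 : 0 < (3/5 : R) < 1 by apply/andP; split; lra.
have [B HB] := hol_bounded r1 hFc.
(* The circle of radius 3/5 about [c] stays in [Re z >= 5/8 - 3/5 = 1/40], whence 40. The size of
   [B] is irrelevant: it disappears as N grows. *)
pose M := `|B| + q%:R * (1 + (cmod c + 1) * (1 + 40)).
have c0 := cmod_ge0 c.
have M0 : 0 <= M by rewrite addr_ge0// mulr_ge0// addr_ge0// mulr_ge0//; lra.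
have nearc z : cmod (z - c) = 3/5 -> 1/40 <= Re z /\ cmod z <= cmod c + 1.
  move=> zc; have := normRe_le (z - c); rewrite zc cReD cReN ler_norml => /andP[h _].
  split; first lra.
  have -> : z = (z - c) + c by rewrite subrK.
  by apply: le_trans (le_cmodD _ _) _; lra.
pose E := q%:R * (3 + cmod c) : R.
have E0 : 0 <= E by rewrite mulr_ge0//; lra.
have key N : (0 < N)%N -> cmod (F c - dsum N c) ^+ 4 <= M ^+ 3 * (E / N%:R).
  move=> N0; apply: (@rotation_max (fun z => F z - dsum N z)) => //.
  - by move=> z; eexists; apply: is_cderB; [exact: is_cder_F|exact: is_cder_dsum].
  - by rewrite divr_ge0.
  - move=> z zc; have [z1 z2] := nearc z zc.
    apply: le_trans (le_cmodB _ _) _; apply: lerD.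
      by apply: le_trans (HB z _) (ler_norm _); rewrite zc.
    have zp : 0 < Re z by lra.
    apply: le_trans (dsum_le N zp) _; rewrite ler_wpM2l// lerD2l ler_pM ?cmod_ge0//.
      by rewrite addr_ge0// invr_ge0 ltW.
    rewrite lerD2l -[40]invrK lef_pV2 ?posrE//; lra.
  - move=> z zc z1; have [_ z2] := nearc z zc.
    apply: le_trans (F_tail1 z1 N0) _; rewrite ler_pM2r ?invr_gt0 ?ltr0n// ler_wpM2l//; lra.
apply/ler_addgt0Pr => e e0.
have e4 : 0 < e ^+ 4 by rewrite exprn_gt0.
pose N := (Num.truncn (M ^+ 3 * E / e ^+ 4)).+1.
have N0 : 0 < N%:R :> R by rewrite ltr0n.
have : cmod (F c - dsum N c) <= e.
  rewrite -(ler_pXn2r (n := 4)) ?nnegrE ?cmod_ge0 ?(ltW e0)//.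
  apply: le_trans (key N isT) _; rewrite mulrA ler_pdivrMr// [e ^+ 4 * _]mulrC -ler_pdivrMr//.
  exact/ltW/truncnS_gt.
have := le_cmodD (dsum N c) (F c - dsum N c); rewrite [dsum N c + _]addrC subrK.
move=> /le_trans h /(lerD (lexx (cmod (dsum N c))))/h /le_trans; apply; rewrite lerD2r.
have cp : 0 < Re c by lra.
apply: le_trans (dsum_le N cp) _; rewrite ler_wpM2l// lerD2l mulrC ler_wpM2r//.
have : (Re c)^-1 <= (5/8)^-1 by rewrite lef_pV2 ?posrE//; lra.
lra.
Qed.

Lemma npow2 n : (0 < n)%N -> npow 2 n = n%:R^-1 * n%:R^-1 :> R.
Proof. by move=> n0; rewrite -[2]/(1 + 1) npowD !npow_1V. Qed.

Lemma sum_inv_sq (N : nat) : \sum_(2 <= n < N.+1) npow 2 n <= 3/4 :> R.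
Proof.
have H k : \sum_(2 <= n < k.+3) npow 2 n <= 3/4 - k.+2%:R^-1 :> R.
  elim: k => [|k IH].
    by rewrite big_nat1 npow2//; lra.
  rewrite big_nat_recr//=; apply: le_trans (lerD IH (lexx _)) _.
  rewrite npow2//.
  have k0 : 0 < k.+2%:R :> R by rewrite ltr0n.
  have -> : k.+3%:R = k.+2%:R + 1 :> R by rewrite natr1.
  move: (k.+2%:R : R) k0 => x k0.
  have : (x + 1)^-1 / (x + 1) <= x^-1 - (x + 1)^-1.
    have -> : x^-1 - (x + 1)^-1 = x^-1 * (x + 1)^-1 by field; rewrite !gt_eqF//; lra.
    rewrite ler_wpM2r ?invr_ge0 ?lef_pV2 ?posrE//; lra.
  lra.
case: N => [|[|N]]; first by rewrite big_geq//; lra.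
  by rewrite big_geq//; lra.
by apply: le_trans (H N) _; rewrite gerBl invr_ge0.
Qed.

(** The term n = 1 dominates: the others add up to at most 3/4 in modulus by [sum_inv_sq]. *)
Lemma F_ge (s : C) : Re s = 2 -> 1/4 <= cmod (F s).
Proof.
move=> s2; apply/ler_addgt0Pr => e e0.
have s1 : 1 < Re s by rewrite s2; lra.
have [N0 HN] := F_approx s1 e0; have {}HN := HN N0.+1 (leqnSn _).
have D : 1/4 <= cmod (dsum N0.+1 s).
  rewrite /dsum big_ltn// char1.
  have -> : cpow 1 s = 1 by rewrite /cpow ln1 ofR0 mul0r oppr0 cexp0.
  rewrite mulr1; apply: le_trans (le_Bcmod (1 : C) _); rewrite cmod1.
  have := le_cmod_sum_nat 2 N0.+2 (fun n => chi n * cpow n s).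
  have : \sum_(2 <= n < N0.+2) cmod (chi n * cpow n s) <= 3/4.
    apply: le_trans (sum_inv_sq N0.+1); apply: ler_sum => n _.
    by rewrite cmodM cmod_cpow s2 ler_piMl ?npow_ge0// cmod_char_le1.
  lra.
have := le_Bcmod (dsum N0.+1 s) (F s - dsum N0.+1 s).
by rewrite [dsum _ _ + _]addrC subrK => h; lra.
Qed.

(** From L' = - V L with [V] the von Mangoldt sum twisted by [chi], kept as an approximate identity
    between partial sums. [F] is not inverted, so this lemma needs no information about its
    zeros. *)
Lemma F_logderiv (s : C) (eta : R) : 0 < eta <= 1 -> 1 + eta <= Re s ->
  cmod (cd F s) <= 12 / eta * cmod (F s).
Proof.
move=> /andP[eta0 eta1] s1; have s1' : 1 < Re s by lra.
pose Z := 12 / eta; have Z0 : 0 <= Z by rewrite divr_ge0// ltW.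
apply/ler_addgt0Pr => e e0.
(* Two of the three approximation errors enter once; the error of [dsum] is multiplied by [V], of
   modulus at most [Z]. *)
have e1 : 0 < e / (2 + Z) by rewrite divr_gt0// ltr_wpDr.
set e' := e / (2 + Z) in e1.
have [N1 H1] := mangoldt_tail_small eta0 e1.
have h2 : 0 < 2^-1 :> R by rewrite invr_gt0.
have [N2 H2] := npow_small eta0 h2.
pose B := q%:R * (3 + cmod s) / (eta / 2).
have B0 : 0 <= B by rewrite divr_ge0 ?mulr_ge0 ?addr_ge0 ?cmod_ge0 ?divr_ge0// ltW.
have [N [Np n1 n2 n3 n4]] : exists N : nat, [/\ (0 < N)%N, (N1 <= N)%N, (N2 <= N)%N,
    (Num.truncn (B / e') < N)%N & (Num.truncn (q%:R * (2 + cmod s) / e') < N)%N].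
  exists (maxn (maxn N1 N2) (maxn (Num.truncn (B / e')) (Num.truncn (q%:R * (2 + cmod s) / e')))).+1.
  by split; rewrite ?ltnS ?leqW// !leq_max leqnn ?orbT.
have N0 : 0 < N%:R :> R by rewrite ltr0n.
have NB (x : R) : (Num.truncn x < N)%N -> x <= N%:R.
  by move=> h; apply: ltW; apply: lt_le_trans (truncnS_gt x) _; rewrite ler_nat.
have A1 : cmod (F s - dsum N s) <= e'.
  apply: le_trans (F_tail1 s1' Np) _; rewrite ler_pdivrMr// [e' * _]mulrC -ler_pdivrMr//.
  exact: NB.
(* Cauchy's estimate for [F - dsum N] on the circle of radius [eta / 2], which lies in
   [Re z > 1]. *)
have A2 : cmod (cd F s - \sum_(1 <= n < N.+1) chi n * (- (ofR (ln n%:R) * cpow n s))) <= e'.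
  have D : is_cder (fun z => F z - dsum N z) s (cd F s - \sum_(1 <= n < N.+1) chi n * (- (ofR (ln n%:R) * cpow n s))).
    by apply: is_cderB; [exact: is_cder_F|exact: is_cder_dsum].
  rewrite -(is_cder_cdE D).
  have rr : 0 < eta / 2 < eta by apply/andP; split; lra.
  apply: le_trans (_ : _ <= B / N%:R) _; last first.
    rewrite ler_pdivrMr// [e' * _]mulrC -ler_pdivrMr//; exact: NB.
  have -> : B / N%:R = (q%:R * (3 + cmod s) / N%:R) / (eta / 2) by rewrite /B mulrAC.
  apply: (cauchy_estimate (r := eta)) => // [z _|z zs].
    by eexists; apply: is_cderB; [exact: is_cder_F|exact: is_cder_dsum].
  have z1 : 1 < Re z.
    have := normRe_le (z - s); rewrite zs cReD cReN ler_norml => /andP[h _]; lra.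
  apply: le_trans (F_tail1 z1 Np) _; rewrite ler_pM2r ?invr_gt0// ler_wpM2l//.
  have -> : z = (z - s) + s by rewrite subrK.
  by have := le_cmodD (z - s) s; lra.
pose f n := chi n * cpow n s.
have fM m n : (0 < m)%N -> (0 < n)%N -> f (m * n)%N = f m * f n.
  by move=> m0 n0; rewrite /f charM cpowM//; ring.
pose V := \sum_(1 <= d < N.+1) ofR (mangoldt R N d) * f d.
have NN : (N.+1 <= (N * N).+1)%N by rewrite ltnS leq_pmulr.
have fb n : cmod (f n) <= npow (1 + eta) n.
  rewrite cmodM cmod_cpow; apply: (@le_trans _ _ (npow (Re s) n)); last exact: npow_antis.
  by rewrite ler_piMl ?npow_ge0// cmod_char_le1.
have VZ : cmod V <= Z.
  have N2' : npow eta N.+1 <= 2^-1 by apply: H2; rewrite leqW.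
  have e01 : 0 < eta <= 1 by rewrite eta0.
  apply: le_trans (mangoldt_series_le e01 N2').
  apply: le_trans (le_cmod_sum_nat _ _ _) _; apply: ler_sum => d _.
  by rewrite cmodM cmod_ofR ger0_norm ?mangoldt_ge0// ler_wpM2l ?mangoldt_ge0.
(* The coefficients with n <= N cancel exactly; the rest is the tail of [mangoldt_tail_small]. *)
have A3 : cmod (\sum_(1 <= n < N.+1) chi n * (- (ofR (ln n%:R) * cpow n s)) + V * dsum N s) <= e'.
  rewrite /V /dsum (dirichlet_product N fM) (@big_cat_nat _ _ _ N.+1 1 (N * N).+1)//= addrA -big_split /=.
  rewrite big_nat big1 ?add0r => [|n /andP[n0 nN]]; last first.
    by rewrite mangoldt_div_eq ?n0// /f; ring.
  apply: le_trans (le_cmod_sum_nat _ _ _) _.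
  apply: le_trans (H1 N n1).
  rewrite big_nat [X in _ <= X]big_nat; apply: ler_sum => n /andP[n0 _].
  have n0' : (0 < n)%N by exact: leq_trans n0.
  rewrite cmodM cmod_ofR ger0_norm ?mangoldt_div_ge0//.
  by apply: ler_pM; rewrite ?cmod_ge0 ?mangoldt_div_ge0 ?fb ?mangoldt_div_le.
move: A2 A3; set D := \sum_(1 <= n < N.+1) _ => A2 A3.
have E : cd F s = (cd F s - D) + (D + V * dsum N s) + V * (F s - dsum N s) - V * F s.
  exact: logderiv_algebra.
rewrite [X in cmod X <= _]E.
apply: le_trans (le_cmodB _ _) _; rewrite [X in _ <= X]addrC; apply: lerD; last first.
  by rewrite cmodM ler_wpM2r ?cmod_ge0.
apply: le_trans (le_cmodD _ _) _.
have : cmod (V * (F s - dsum N s)) <= Z * e' by rewrite cmodM ler_pM ?cmod_ge0.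
have := le_cmodD (cd F s - D) (D + V * dsum N s).
have -> : e = (2 + Z) * e' by rewrite /e' mulrC divfK// gt_eqF// ltr_wpDr.
lra.
Qed.

End Continuation.
End Character.
End LFunction.

(** * The logarithmic derivative near the line [Re s = 1] *)

Section LogDerivative.
Variable R : realType.
Local Notation C := (Cplx R).
Local Notation Re := (@complex.Re R).
Local Notation Im := (@complex.Im R).
Local Notation ofR := (@ofR R).

Lemma cd_shift (f : C -> C) (a z : C) : (exists d, is_cder f (a + z) d) ->
  cd (fun x => f (a + x)) z = cd f (a + z).
Proof. by move=> /is_cder_cd D; apply: is_cder_cdE; exact: is_cder_shift D. Qed.

Definition powers_cover (k c : R) : Prop :=
  forall x, 1 <= x -> exists2 n : nat, x <= k ^+ n & n%:R <= c * (ln x + 1).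

Lemma pow_ge_exists (k : R) : 1 < k -> exists2 c : R, 0 < c & powers_cover k c.
Proof.
move=> k1; have k0 : 0 < k by lra.
have lk : 0 < ln k by rewrite ln_gt0.
exists ((ln k)^-1 + 1); first by rewrite addr_gt0// invr_gt0.
move=> x x1; have lx : 0 <= ln x by rewrite ln_ge0.
exists (Num.truncn (ln x / ln k)).+1.
  rewrite -ler_ln ?posrE ?exprn_gt0//; last by lra.
  by rewrite lnXn// -mulr_natl -ler_pdivrMr//; apply: ltW; exact: truncnS_gt.
rewrite -natr1.
have : (Num.truncn (ln x / ln k))%:R <= ln x / ln k by rewrite truncn_le// divr_ge0// ltW.
have : 0 < (ln k)^-1 by rewrite invr_gt0.
by rewrite mulrDl mul1r mulrDr mulr1 mulrC; lra.
Qed.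

Section Bound.
Variables (q : nat) (chi : nat -> C) (F : C -> C) (r : R).
Hypotheses (q8 : (8 <= q)%N) (hchi : is_dirichlet_character q chi)
  (chi_np : chi <> principal_character R q) (hF : is_dirichlet_L q chi F)
  (r_itv : 0 < r <= 1/2) (lq1 : 1 <= ln (q%:R : R)) (rq : 1 <= r * ln q%:R)
  (F_neq0 : forall sigma t : R, 1 - r < sigma -> `|t| <= q%:R -> F (sigma +i* t) != 0).

Let q1 : (1 < q)%N. Proof. exact: leq_trans q8. Qed.
Let q8R : 8 <= q%:R :> R. Proof. by rewrite ler_nat. Qed.

(** The cap 1/8 keeps the disc of radius [2 * rad] about [1 + rad + it] inside the disc of radius
    9/8 about [2 + it], where the lower bound for Re L'/L is known. *)
Definition rad : R := Num.min r (1/8).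

Lemma rad_bounds : [/\ 0 < rad, rad <= r, rad <= 1/8, r / 8 <= rad / 2 & 12 / rad <= 96 * ln q%:R].
Proof.
have [r0 r12] := andP r_itv; have := rq; have := lq1; set l := ln _ => l1 rl.
have rad0 : 0 < rad by rewrite lt_min r0; lra.
split=> //; rewrite /rad ?ge_min ?lexx ?orbT//.
  by case: (leP r (1/8)) => h; lra.
rewrite ler_pdivrMr//; case: (leP r (1/8)) => h; last by lra.
by have -> : 96 * l * r = 96 * (r * l) by [ring]; lra.
Qed.

Lemma F_neq0C z : 1 - r < Re z -> `|Im z| <= q%:R -> F z != 0.
Proof. by case: z => a b; exact: F_neq0. Qed.

(** [logderiv_lower] is applied around [2 + it], hence the abscissa [- 1 - rad]. Zeros in the disc
    have |Im| <= q/2 + 5/4 <= q, because q >= 8, and so lie left of the zero-free region. *)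
Lemma F_log_lower (K c : R) (t : R) : 0 < K -> `|t| <= q%:R / 2 ->
  logderiv_lower K -> powers_cover (11/10) c ->
  0 < c ->
  forall z, cmod (z - (2 +i* t)) <= 9/8 -> 1 - rad < Re z -> - (K * c * 19 * ln q%:R) <= Re (cd F z / F z).
Proof.
move=> K0 tq HK Hc c0 z z98 zr; have [rad0 radr rad8 _ _] := rad_bounds.
have q8' := q8R; have l1 := lq1.
have Q0 : 0 < q%:R :> R by lra.
(* 16 q^2 is the quotient of the upper bound 4 q^2 on the circle by the lower bound 1/4 at the
   centre; its logarithm plus 1 is at most 19 log q. *)
have [|n Hn1 Hn2] := Hc (16 * q%:R ^+ 2).
  have : 1 <= q%:R ^+ 2 :> R by rewrite exprn_ege1//; lra.
  lra.
pose a : C := 2 +i* t; pose f x := F (a + x).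
have ca : cmod a <= 2 + q%:R / 2.
  by apply: le_trans (cmod_le_ReIm _) _; rewrite /= ger0_norm//; lra.
have hf : hol 0 2 f.
  by move=> x _; eexists; apply: is_cder_shift; exact: (is_cder_F chi_np hF).
have fM x : cmod x = 11/8 -> cmod (f x) <= 4 * q%:R ^+ 2.
  move=> x1; have Rx : 5/8 <= Re (a + x).
    by rewrite cReD /=; have := normRe_le x; rewrite x1 ler_norml => /andP[h _]; lra.
  apply: le_trans (F_le q1 hchi chi_np hF Rx) _.
  have h : cmod (a + x) <= q%:R by apply: le_trans (le_cmodD _ _) _; rewrite x1; lra.
  have -> : 4 * q%:R ^+ 2 = q%:R * (4 * q%:R) :> R by ring.
  by rewrite ler_wpM2l//; lra.
have := HK n f (4 * q%:R ^+ 2) (- 1 - rad) hf _ fM _ _ (z - a) z98 _.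
move=> /(_ _ _ _ _)/wrap[||x x1 fx||].
- by rewrite mulr_gt0// exprn_gt0.
- have : 1/4 <= cmod (f 0) by rewrite /f addr0; apply: (F_ge q1 hchi hF).
  have kp : 0 < (11/10 : R) ^+ n by rewrite exprn_gt0//; lra.
  move=> /(ler_wpM2l (ltW kp)); lra.
- rewrite leNgt; apply/negP => rx; have : F (a + x) != 0; last by rewrite -/(f x) fx eqxx.
  apply: F_neq0C; first by rewrite cReD /=; lra.
  rewrite cImD /=; apply: le_trans (ler_normD _ _) _.
  by have := normIm_le x; lra.
- by rewrite cReD cReN /=; lra.
have E : a + (z - a) = z by rewrite addrC subrK.
rewrite /f cd_shift; last by eexists; exact: (is_cder_F chi_np hF).
rewrite E; apply: le_trans; rewrite lerN2 -!mulrA ler_wpM2l ?(ltW K0)//.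
apply: le_trans Hn2 _; rewrite ler_wpM2l ?(ltW c0)//.
have l16 : ln (16 : R) = 4 * ln 2.
  by have -> : (16 : R) = 2 ^+ 4 by [ring]; rewrite lnXn// mulr_natl.
rewrite lnM ?posrE ?exprn_gt0// lnXn// -[ln q%:R *+ 2]mulr_natl l16.
have : ln (1 + 1) <= 1 :> R by apply: le_ln1Dx; lra.
rewrite -[1 + 1]/(2 : R); lra.
Qed.

(** Right of [1 + rad] the Dirichlet series suffices. Otherwise [sigma >= 1 - r / 8 >= 1 - rad / 2]
    lies within [3/2 * rad] of the centre [1 + rad], the reach of [borel_caratheodory]. *)
Lemma F_logderiv_bound (K c sigma t : R) : 0 < K -> `|t| <= q%:R / 2 ->
  logderiv_lower K -> powers_cover (11/10) c ->
  0 < c -> 1 - r / 8 <= sigma ->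
  cmod (cd F (sigma +i* t) / F (sigma +i* t)) <=
    (96 + 12 * expR 12 * (96 + K * c * 19)) * ln q%:R.
Proof.
move=> K0 tq HK Hc c0 sr; have [rad0 radr rad8 rad2 rad96] := rad_bounds.
have q8' := q8R; have l1 := lq1; have [r0 r12] := andP r_itv.
set l := ln _ in l1 rad96 *.
have Fn z : 1 - rad < Re z -> `|Im z| <= q%:R -> F z != 0.
  by move=> h; apply: F_neq0C; lra.
have big (s : C) : 1 + rad <= Re s -> `|Im s| <= q%:R -> cmod (cd F s / F s) <= 96 * l.
  move=> s1 s2; have Fs : F s != 0 by apply: Fn => //; lra.
  rewrite cmod_div ler_pdivrMr ?cmod_gt0//.
  have rr : 0 < rad <= 1 by rewrite rad0 /=; lra.
  apply: le_trans (F_logderiv q1 hchi chi_np hF rr s1) _.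
  by rewrite ler_wpM2r// cmod_ge0.
have E0 := expR_ge0 (12 : R).
have C0 : 0 <= 12 * expR 12 * (96 + K * c * 19) * l.
  by rewrite !mulr_ge0 ?addr_ge0 ?mulr_ge0 ?(ltW K0) ?(ltW c0)//; lra.
have [s1|s1] := leP (1 + rad) sigma.
  by rewrite mulrDl; apply: le_trans (big (sigma +i* t) s1 _) _; rewrite /=; lra.
pose s0 : C := (1 + rad) +i* t.
have := @borel_caratheodory R (fun z => cd F z / F z) s0 rad (K * c * 19 * l) rad0.
have near0 z : cmod (z - s0) < 2 * rad -> 1 - rad < Re z /\ `|Im z| <= q%:R.
  move=> zs; have := normRe_le (z - s0); have := normIm_le (z - s0).
  rewrite cReD cImD cReN cImN /= => h1 h2; split.
    by move: h2; rewrite ler_norml => /andP[h2 _]; lra.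
  have -> : Im z = (Im z - t) + t by ring.
  by apply: le_trans (ler_normD _ _) _; lra.
move=> /(_ _ _ (sigma +i* t) _)/wrap[|z zs||].
- apply: holM; first by apply: hol_cd => z _; eexists; exact: (is_cder_F chi_np hF).
  apply: holV; first by move=> z _; eexists; exact: (is_cder_F chi_np hF).
  by move=> z /near0[]; exact: Fn.
- have [z1 z2] := near0 z zs.
  apply: (F_log_lower K0 tq HK Hc c0) => //.
  have -> : z - (2 +i* t) = (z - s0) + ofR (- (1 - rad)).
    by apply: complexP; rewrite ?cReD ?cImD ?cReN ?cImN /=; ring.
  apply: le_trans (le_cmodD _ _) _; rewrite cmod_ofR normrN ger0_norm; lra.
- have -> : (sigma +i* t) - s0 = ofR (sigma - (1 + rad)).
    by apply: complexP; rewrite ?cReD ?cImD ?cReN ?cImN /=; ring.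
  by rewrite cmod_ofR ler_norml; apply/andP; split; lra.
move=> /le_trans; apply.
have b0 : cmod (cd F s0 / F s0) <= 96 * l by apply: big; rewrite /=; lra.
rewrite [X in _ <= X]mulrDl; apply: lerD => //; rewrite -[X in _ <= X]mulrA ler_wpM2l ?mulr_ge0//.
by rewrite mulrDl lerD2r.
Qed.

End Bound.

(** Without a continuation [dirichlet_L] would be the default function 0; one nonzero value excludes
    this. *)
Lemma dirichlet_LP (q : nat) (chi : nat -> C) (z : C) : dirichlet_L q chi z != 0 ->
  is_dirichlet_L q chi (dirichlet_L q chi).
Proof.
move=> L0; have [[F hF]|nF] := pselect (exists F, is_dirichlet_L q chi F).
  by have := xgetPex (fun=> 0 : C) (ex_intro [set F | is_dirichlet_L q chi F] F hF).
move: L0; rewrite /dirichlet_L xgetPN ?eqxx// => F hF; apply: nF; by exists F.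
Qed.

(** * Inequalities between the parameters *)

Lemma ln2_ge : 2^-1 <= ln (2 : R).
Proof.
rewrite -[X in ln X]invrK lnV ?posrE ?invr_gt0// lerNr.
have h : -1 < - 2^-1 :> R by lra.
have := le_ln1Dx h; have -> // : 1 + (- 2^-1) = 2^-1 :> R by field.
Qed.

Lemma ln_ge_double_log (u : R) : 8 <= u -> [/\ ln 8 <= ln u, 1 <= ln u & ln u <= ln (u * ln u)].
Proof.
move=> u8; have u0 : 0 < u by lra.
have l8 : 3/2 <= ln (8 : R).
  have -> : (8 : R) = 2 ^+ 3 by ring.
  by rewrite lnXn// -mulr_natl; have := ln2_ge; lra.
have lu : ln 8 <= ln u by rewrite ler_ln ?posrE.
split=> //; first by lra.
rewrite ler_ln; [|by rewrite posrE|by rewrite posrE mulr_gt0//; lra].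
by rewrite ler_peMr ?(ltW u0)//; lra.
Qed.

(** The summand [16 * lq] will give u >= 8, as lq is at least half of log y; the whole bound will
    give B k / log x <= r / 16. *)
Lemma smoothness_gap (B lx lq : R) : 0 < B -> 0 < lq -> 16 <= lx / ((B + 1) * lq) ->
  16 * (B * lq) + 16 * lq <= lx.
Proof.
move=> B0 lq0; have B1 : 0 < B + 1 by lra.
by rewrite ler_pdivlMr ?mulr_gt0//; lra.
Qed.

(** The lower bound [T * (A + 1) <= k] meets the upper bound [k <= lq / 2 <= A * ly / 2], which
    forces [ly] and [lq] to be large. *)
Lemma zero_free_width (T A ly lq k v : R) : 512 <= T -> 0 < A -> 1 <= v -> lq <= A * ly ->
  k <= lq / 2 -> T <= k / ((A + 1) * v) ->
  [/\ 512 * ((A + 1) * v) <= k, 1 <= k, T <= ly & 8 <= lq].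
Proof.
move=> T512 A0 v1 lqA kq; have A1 : 0 < A + 1 by lra.
have Av : 0 < (A + 1) * v by rewrite mulr_gt0//; lra.
rewrite ler_pdivlMr// => kK.
have kA : T * (A + 1) <= k.
  by apply: le_trans kK; rewrite mulrA ler_peMr// mulr_ge0//; lra.
have TA : 0 <= T * A by rewrite mulr_ge0//; lra.
have kT : T <= k by move: kA; rewrite mulrDr mulr1; lra.
split; [|lra| |lra].
  by apply: le_trans kK; rewrite ler_wpM2r// ltW.
by rewrite -(ler_pM2l A0); move: kA; rewrite mulrDr mulr1 (mulrC A); lra.
Qed.

(** Here [a] stands for 1 - alpha and [v] for log (u log u); 512 = 32 * 16 combines the constant of
    the saddle point bound with the wanted 1/16. *)
Lemma saddle_distance (A ly lq k v a : R) : 0 < A -> 0 < ly -> 0 < lq -> 0 <= a -> lq <= A * ly ->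
  512 * ((A + 1) * v) <= k -> ly * a <= 32 * v -> a <= k / lq / 16.
Proof.
move=> A0 ly0 lq0 a0 lqA kA H.
have h1 : lq * a <= (A + 1) * ly * a by rewrite ler_wpM2r// mulrDl mul1r; lra.
have h2 : (A + 1) * (ly * a) <= (A + 1) * (32 * v) by rewrite ler_wpM2l//; lra.
by rewrite mulrAC ler_pdivlMr// [_ * lq]mulrC; lra.
Qed.

Lemma sigma_range (B lx lq k : R) : 0 < lq -> 0 <= k -> 0 < lx ->
  16 * (B * lq) + 16 * lq <= lx -> B * k / lx <= k / lq / 16.
Proof.
move=> lq0 k0 lx0 H; rewrite ler_pdivrMr//.
have r16 : 0 <= k / lq / 16 by rewrite !divr_ge0// ltW.
apply: le_trans (ler_wpM2l r16 H).
have -> : k / lq / 16 * (16 * (B * lq) + 16 * lq) = B * k + k.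
  by field; exact: lt0r_neq0.
by rewrite lerDl.
Qed.

Lemma ln_lt_pow10 (x y : R) : 1 <= x -> 0 < y -> expR (ln x `^ 10^-1) < y -> ln x <= ln y ^+ 10.
Proof.
move=> x1 y0 exy; have lx0 : 0 <= ln x by rewrite ln_ge0.
have h : ln x `^ 10^-1 <= ln y.
  by rewrite -[X in X <= _]expRK ler_ln ?posrE ?expR_gt0// ltW.
have -> : ln x = (ln x `^ 10^-1) ^+ 10.
  by rewrite -powR_mulrn ?powR_ge0// -powRrM mulVf// powRr1.
by rewrite lerXn2r ?nnegrE ?powR_ge0// (le_trans (powR_ge0 _ _) h).
Qed.

Lemma ln_sqrt_le (y z : R) : 1 < y -> Num.sqrt y <= z -> ln y / 2 <= ln z.
Proof.
move=> y1 yz; have sy : 0 < Num.sqrt y by rewrite sqrtr_gt0; lra.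
have : ln (Num.sqrt y) <= ln z by rewrite ler_ln ?posrE// (lt_le_trans sy).
suff -> : ln y = 2 * ln (Num.sqrt y) by lra.
by rewrite mulr_natl -lnXn// sqr_sqrtr//; lra.
Qed.

(** Dividing [saddle_lower_bound] by log y leaves y^((1 - alpha) / 16) <= 8 u, and 8 u <= u^2. *)
Lemma saddle_log_bound (q : nat) (x y alpha : R) : (0 < q)%N -> 2 <= y -> alpha <= 1 ->
  is_saddle_point q x y alpha -> 176 ^+ 11 <= ln y -> ln q%:R <= ln y ^+ 10 ->
  8 <= ln x / ln y -> ln y * (1 - alpha) <= 32 * ln (ln x / ln y).
Proof.
move=> q0 y2 a1 sad ly lq u8; have := saddle_lower_bound q0 y2 a1 sad ly lq.
have ly0 : 0 < ln y by rewrite ln_gt0//; lra.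
move: u8; set u := ln x / ln y => u8.
have -> : ln x = u * ln y by rewrite /u divfK// gt_eqF.
move: {ly lq sad q0} (ln y) ly0 => l l0 H.
have [lu _ _] := ln_ge_double_log u8.
have u0 : 0 < u by lra.
have {}H : expR (l / 16 * (1 - alpha)) <= 8 * u.
  by rewrite -(ler_pM2r l0); lra.
have : l / 16 * (1 - alpha) <= ln 8 + ln u.
  rewrite -lnM ?posrE// -[X in X <= _]expRK ler_ln ?posrE ?expR_gt0//.
  by rewrite mulr_gt0.
by lra.
Qed.

End LogDerivative.

Theorem lemma3 (R : realType) :
  exists K1 K2 : R, forall A B : R, 0 < A -> 0 < B ->
  exists M : R, forall (x y : R) (q : nat) (k alpha : R),
    2 <= y ->
    Num.sqrt y <= q%:R -> q%:R <= y `^ A ->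
    expR (ln x `^ 10^-1) < y -> y <= x ->
    let u := ln x / ln y in
    K1 <= ln x / ((B + 1) * ln q%:R) ->
    0 <= k -> k <= ln q%:R / 2 ->
    K2 <= k / ((A + 1) * ln (u * ln u)) ->
    is_saddle_point q x y alpha ->
    forall chi : nat -> Cplx R, is_primitive_character q chi -> Xi q k chi ->
    forall sigma t : R,
      alpha - B * k / ln x <= sigma -> sigma <= alpha ->
      `|t| <= q%:R / 2 ->
      let L : Cplx R -> Cplx R := dirichlet_L q chi in
      let s : Cplx R := sigma +i* t in
      L s != 0 /\ `|derive1 L s / L s| <= (M * ln q%:R)%:C.
Proof.
have [K K0 HK] := logderiv_lower_bound R.
have k1 : 1 < 11/10 :> R by lra.
have [c c0 Hc] := pow_ge_exists k1.
(* 512 is the constant of [saddle_distance], and 176^11 is the threshold of [expR_gt_pow10] for log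
   y. *)
have [T T512 HT] : exists2 T : R, 512 <= T & forall l, T <= l -> 176 ^+ 11 <= l.
  exists (Num.max 512 (176 ^+ 11)) => [|l]; first by rewrite le_max lexx.
  by rewrite ge_max => /andP[].
exists 16, T => A B A0 B0.
exists (96 + 12 * expR 12 * (96 + K * c * 19)).
move=> x y q k alpha y2 sq qA exy yx u K1 k0 kq K2 sad chi _ [hchi chi_np nz _] sigma t s1 _ tq L s.
have y1 : 1 < y by apply: lt_le_trans y2; rewrite ltr1n.
have y0 : 0 < y := lt_trans ltr01 y1.
have ly0 : 0 < ln y by rewrite ln_gt0.
have lqy := ln_sqrt_le y1 sq.
have lq0 : 0 < ln (q%:R : R) by apply: lt_le_trans lqy; rewrite divr_gt0.
have Q0 : 0 < q%:R :> R by apply: lt_le_trans sq; rewrite sqrtr_gt0.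
have q0 : (0 < q)%N by rewrite -(ltr0n R).
have lqA : ln q%:R <= A * ln y by rewrite -ln_powR ler_ln ?posrE ?powR_gt0.
have lx10 := ln_lt_pow10 (le_trans (ltW y1) yx) y0 exy.
have lx16 := smoothness_gap B0 lq0 K1.
have lx0 : 0 < ln x by rewrite ln_gt0// (lt_le_trans y1).
have Bq : 0 < B * ln q%:R by rewrite mulr_gt0.
have u8 : 8 <= u by rewrite /u ler_pdivlMr//; move: lqy lx16 Bq; clear; lra.
have [_ lu1 vu] := ln_ge_double_log u8.
have [kA k1' lyT lqT] := zero_free_width T512 A0 (le_trans lu1 vu) lqA kq K2.
have q8 : (8 <= q)%N.
  rewrite -(ler_nat R); apply: le_trans lqT _.
  by rewrite -[X in _ <= X]lnK ?posrE//; apply: le_trans (expR_ge1Dx _); rewrite lerDr.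
pose r := k / ln (q%:R : R).
have r0 : 0 < r by rewrite divr_gt0// (lt_le_trans ltr01).
have r_itv : 0 < r <= 1/2 by rewrite r0 ler_pdivrMr// mul1r mulrC.
have al : 1 - alpha <= r / 16.
  (* The saddle point estimate is stated for alpha <= 1; beyond 1 there is nothing to prove. *)
  have [a1|/ltW a1] := lerP 1 alpha.
    by apply: (@le_trans _ _ 0); [rewrite subr_le0|rewrite divr_ge0// ltW].
  have lqx : ln q%:R <= ln y ^+ 10.
    by apply: le_trans lx10; move: lx16 Bq lq0; clear; lra.
  apply: (saddle_distance A0 ly0 lq0 _ lqA kA); first by rewrite subr_ge0.
  apply: le_trans (saddle_log_bound q0 y2 a1 sad (HT _ lyT) lqx u8) _.
  by rewrite ler_wpM2l.
have Bk := sigma_range lq0 k0 lx0 lx16.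
have sr : 1 - r / 8 <= sigma.
  by apply: le_trans s1; move: al Bk; rewrite -/r; clear; lra.
(* Besides being part of the claim, this shows that [L] is a genuine continuation and not the
   default value. *)
have Ls : L s != 0.
  apply: nz; first by apply: lt_le_trans sr; rewrite -/r; move: r0; clear; lra.
  by apply: le_trans tq _; rewrite ler_pdivrMr// ler_peMr// ler1n.
split=> //.
have hL : is_dirichlet_L q chi L := dirichlet_LP Ls.
rewrite normC_cmod -!/(ofR _) lecR.
have lq1 : 1 <= ln (q%:R : R) by apply: le_trans lqT; rewrite ler1n.
have rq : 1 <= r * ln q%:R by rewrite /r divfK// gt_eqF.
exact: (F_logderiv_bound q8 hchi chi_np hL r_itv lq1 rq nz K0 tq HK Hc c0 sr).
Qed.
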